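(* Let $E$ be a real separable Banach space with open unit ball $B$, let $L:\mathbb{R}_+\times E\times E\to\mathbb{R}\cup\{+\infty\}$ and let $\Gamma:\mathbb{R}_+\times E\rightsquigarrow E$ be a multifunction. Assume: (a) $\mathcal{A}_{(t,\xi)}\neq\emptyset$ for every $(t,\xi)\in\mathbb{R}_+\times E$; (b) $L(\cdot,x,y)$ is measurable for every $(x,y)\in E\times E$; (c) there exist an integrable function $l_1:\mathbb{R}_+\to\mathbb{R}_+$ and a locally bounded, integrable function $l_2:\mathbb{R}_+\to\mathbb{R}_+$ such that $|L(t,0,0)|\le l_1(t)$ and $|L(t,x,y)-L(t,x',y')|\le l_1(t)\|x-x'\|+l_2(t)\|y-y'\|$ for every $t\in\mathbb{R}_+$ and every $(x,y),(x',y')\in E\times E$; (d) $\Gamma$ has nonempty closed values; (e) $\Gamma(\cdot,x)$ is lower semicontinuous for every $x\in E$; (f) there exists a locally integrable function $\gamma:\mathbb{R}_+\to\mathbb{R}_+$ such that $\Gamma(t,0)\subset\gamma(t)B$ and $\Gamma(t,x)\subset\Gamma(t,x')+\gamma(t)\|x-x'\|B$ for every $t\in\mathbb{R}_+$ and $x,x'\in E$; (g) $\int_0^\infty \exp\left(\int_0^s\gamma(\tau)d\tau\right)\left(1+\int_0^s\gamma(\tau)d\tau\right)\left(l_1(s)+l_2(s)\gamma(s)\right)ds<\infty$. Let $\xi\in E$ and let $x_0(\cdot)\in\mathcal{A}_{(0,\xi)}$ be an optimal trajectory for $(\mathrm{P}_0)$ such that: (h) for every $T>0$ there exists $\eta>0$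 such that for a.e. $t\in[0,T]$, $\dot{x}_0(t)\in\Gamma(t,x_0(t)+\eta v)$ for every $v\in B$. Suppose that $\partial^-_xV(0,x_0(0))$ is nonempty and that $\partial^+_xL(t,x_0(t),\dot{x}_0(t))$ is nonempty for a.e. $t\in\mathbb{R}_+$. Then for every $x^*\in\partial^-_xV(0,x_0(0))$ and every weakly$^*$ scalarly measurable selector $f:\mathbb{R}_+\to E^*$ of the multifunction $t\rightsquigarrow\partial^+_xL(t,x_0(t),\dot{x}_0(t))$, the function $p:\mathbb{R}_+\to E^*$ defined by the Gelfand integral $p(t):=\int_0^tf(s)ds-x^*$ is locally absolutely continuous and satisfies: (i) $-p(t)\in\partial^-_xV(t,x_0(t))$ for every $t\in\mathbb{R}_+$; (ii) $p(t)\in\partial^\circ_yL(t,x_0(t),\dot{x}_0(t))+N_{\Gamma(t,x_0(t))}(\dot{x}_0(t))$ for a.e. $t\in\mathbb{R}_+$; (iii) $\dot{p}(t)\in\partial^+_xL(t,x_0(t),\dot{x}_0(t))$ for a.e. $t\in\mathbb{R}_+$; (iv) $H(t,x_0(t),p(t))=\langle p(t),\dot{x}_0(t)\rangle-L(t,x_0(t),\dot{x}_0(t))$ for a.e. $t\in\mathbb{R}_+$; (v) $\lim_{t\to\infty}p(t)=0$, where $\dot{p}(t)$ denotes the weak$^*$ derivative of $p(\cdot)$ at $t$. In particular, if $\partial^-_xV(0,x_0(0))$ is nonempty, then $\partial^-_xV(t,x_0(t))$ is nonempty for every $t\in\mathbb{R}_+$.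
   Context: $\mathbb{R}_+=[0,\infty)$ carries Lebesgue measure and the Lebesgue $\sigma$-algebra; $E^*$ is the norm dual of $E$. For $t\ge0$, $W^{1,1}_{\mathrm{loc}}([t,\infty),E)$ is the set of locally Bochner integrable $x:[t,\infty)\to E$ whose strong derivative $\dot{x}(s)$ (norm limit of difference quotients) exists for a.e. $s$, with $\dot{x}(\cdot)$ locally Bochner integrable and $x(s)=x(t)+\int_t^s\dot{x}(\tau)d\tau$ for all $s\ge t$. Admissible trajectories: $\mathcal{A}_{(t,\xi)}=\{x(\cdot)\in W^{1,1}_{\mathrm{loc}}([t,\infty),E): \dot{x}(s)\in\Gamma(s,x(s))\text{ for a.e. }s\in[t,\infty),\ x(t)=\xi\}$. Integrals over $[t,\infty)$ of $L(s,x(s),\dot{x}(s))$ are improper: $\int_t^\infty=\lim_{T\to\infty}\int_t^T$ when the limit exists. The problem $(\mathrm{P}_t)$ is to minimize $\int_t^\infty L(s,x(s),\dot{x}(s))ds$ over $x(\cdot)\in\mathcal{A}_{(t,\xi)}$. The value function is $V(t,\xi)=\inf_{x(\cdot)\in\mathcal{A}_{(t,\xi)}}\int_t^\infty L(s,x(s),\dot{x}(s))ds$ (with value $+\infty$ if $\mathcal{A}_{(t,\xi)}=\emptyset$ or no integral is well defined). $x_0(\cdot)\in\mathcal{A}_{(0,\xi)}$ is optimal for $(\mathrm{P}_0)$ if $\int_0^\infty L(s,x_0(s),\dot{x}_0(s))ds=V(0,\xi)>-\infty$. The Hamiltonian is $H(t,x,x^* )=\sup_{y\in\Gamma(t,x)}\{\langle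 x^*,y\rangle-L(t,x,y)\}$ for $(t,x,x^* )\in\mathbb{R}_+\times E\times E^*$. A multifunction $G:\mathbb{R}_+\rightsquigarrow E$ is lower semicontinuous if $\{t: G(t)\cap O\neq\emptyset\}$ is open in $\mathbb{R}_+$ for every open $O\subset E$. For $\varphi:E\to\mathbb{R}\cup\{+\infty\}$ and $\bar{x}$ with $\varphi(\bar x)<\infty$: $\varphi^-(\bar{x};v)=\liminf_{u\to v,\,\theta\downarrow0}\frac{\varphi(\bar{x}+\theta u)-\varphi(\bar{x})}{\theta}$ and $\varphi^+(\bar{x};v)=\limsup_{u\to v,\,\theta\downarrow0}\frac{\varphi(\bar{x}+\theta u)-\varphi(\bar{x})}{\theta}$; the Dini–Hadamard subdifferential is $\partial^-\varphi(\bar{x})=\{x^*\in E^*:\langle x^*,v\rangle\le\varphi^-(\bar{x};v)\ \forall v\in E\}$ and the Dini–Hadamard superdifferential is $\partial^+\varphi(\bar{x})=\{x^*\in E^*:\langle x^*,v\rangle\ge\varphi^+(\bar{x};v)\ \forall v\in E\}$. If $\varphi$ is Lipschitz near $\bar{x}$, the Clarke directional derivative is $\varphi^\circ(\bar{x};v)=\limsup_{x\to\bar{x},\,\theta\downarrow0}\frac{\varphi(x+\theta v)-\varphi(x)}{\theta}$ and the Clarke subdifferential is $\partial^\circ\varphi(\bar{x})=\{x^*\in E^*:\langle x^*,v\rangle\le\varphi^\circ(\bar{x};v)\ \forall v\in E\}$. For nonempty $C\subset E$ with distance function $d_C(x)=\inf_{c\in C}\|x-c\|$ and $\bar{x}\in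 C$: $T_C(\bar{x})=\{v\in E: d_C^\circ(\bar{x};v)=0\}$ (Clarke tangent cone) and $N_C(\bar{x})=\{x^*\in E^*:\langle x^*,v\rangle\le0\ \forall v\in T_C(\bar{x})\}$ (Clarke normal cone). Subscripts denote partial objects: $\partial^-_xV(t,x)$ refers to $V(t,\cdot)$ at $x$; $\partial^+_xL(t,x,y)$ refers to $L(t,\cdot,y)$ at $x$; $\partial^\circ_yL(t,x,y)$ refers to $L(t,x,\cdot)$ at $y$. A function $f:\mathbb{R}_+\to E^*$ is weakly$^*$ scalarly measurable if $\langle f(\cdot),x\rangle$ is measurable for every $x\in E$; it is Gelfand integrable over a measurable set $A$ with Gelfand integral $x_A^*=\int_Af\,dt\in E^*$ if $\langle x^*_A,x\rangle=\int_A\langle f(t),x\rangle dt$ for every $x\in E$. A selector of a multifunction $\Phi$ is a function $f$ with $f(t)\in\Phi(t)$ for a.e. $t$. $p:\mathbb{R}_+\to E^*$ is locally absolutely continuous if its restriction to $[0,\tau]$ is absolutely continuous (for the dual norm) for every $\tau>0$. $p$ is weakly$^*$ differentiable at $t>0$ with weak$^*$ derivative $\dot{p}(t)\in E^*$ if $\lim_{h\to0}\langle\frac{p(t+h)-p(t)}{h},x\rangle=\langle\dot{p}(t),x\rangle$ for every $x\in E$. *)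

(* Defs.v *)
From HB Require Import structures.
From mathcomp Require Import all_boot all_order all_algebra.
From mathcomp Require Import all_classical all_reals all_analysis.
(* Re-imported so that the canonical measurable structure on \bar R is found. *)
From mathcomp Require Import measurable_realfun.
Set Implicit Arguments.
Unset Strict Implicit.
Unset Printing Implicit Defensive.
Import Order.TTheory GRing.Theory Num.Theory.
Import numFieldNormedType.Exports.
Local Open Scope classical_set_scope.
Local Open Scope ring_scope.

Section Dual.
(* The norm dual of E: continuous linear functionals with the operator norm. *)
Context {R : realType} {E : normedModType R}.

Definition dual_pred : {pred E -> R^o} :=
  mem [set f : E -> R^o | linear f /\ continuous f].

Record dual := Dual { dual_fun :> E -> R^o; _ : dual_fun \in dual_pred }.

HB.instance Definition _ := [isSub for dual_fun].
HB.instance Definition _ := [Choice of dual by <:].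

Lemma dual_submod_closed : submod_closed dual_pred.
Proof.
split; first by rewrite inE; split;
  [move=> a u v /=; rewrite scaler0 addr0|exact: cst_continuous].
move=> a f g; rewrite !inE => -[lf cf] [lg cg]; split.
  move=> b u v; rewrite !fctE lf lg !scalerDr !scalerA mulrC.
  by rewrite -!addrA; congr (_ + _); rewrite addrCA.
move=> x; apply: cvgD; [apply: cvgZl_tmp; exact: cf| exact: cg].
Qed.
HB.instance Definition _ :=
  GRing.isSubmodClosed.Build R (E -> R^o) dual_pred dual_submod_closed.
HB.instance Definition _ := [SubChoice_isSubLmodule of dual by <:].


Lemma dual_linear (f : dual) : linear f.
Proof. by case: f => f /=; rewrite inE => -[]. Qed.

Lemma dual_continuous (f : dual) : continuous f.
Proof. by case: f => f /=; rewrite inE => -[]. Qed.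

HB.instance Definition _ (f : dual) :=
  GRing.isLinear.Build R E R^o *:%R f (dual_linear f).

Definition dual_norm (f : dual) : R :=
  sup [set `|f v| | v in [set v | `|v| <= 1]].

Lemma dual_norm_has_sup (f : dual) :
  has_sup [set `|f v| | v in [set v | `|v| <= 1]].
Proof.
split; first by exists `|f 0|, 0 => //=; rewrite normr0.
have [M Mf] : exists M, forall v, `|f v| <= M * `|v|.
  have /linear_boundedP/pinfty_ex_gt0[M _ Mf] :
      bounded_near f (nbhs (0 : E)).
    exact/linear_bounded_continuous/dual_continuous.
  by exists M.
exists `|M| => _ [v /= v1 <-]; rewrite (le_trans (Mf v))//.
rewrite (le_trans (ler_wpM2r (normr_ge0 v) (ler_norm M)))//.
by rewrite -[leRHS]mulr1 ler_wpM2l.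
Qed.

Lemma dual_norm_ub (f : dual) v : `|v| <= 1 -> `|f v| <= dual_norm f.
Proof.
by move=> v1; apply: sup_upper_bound; [exact: dual_norm_has_sup|exists v].
Qed.

Lemma dual_norm_le (f : dual) M :
  (forall v, `|v| <= 1 -> `|f v| <= M) -> dual_norm f <= M.
Proof.
move=> fM; apply: ge_sup; first by have [] := dual_norm_has_sup f.
by move=> _ [v /= v1 <-]; exact: fM.
Qed.

Let dual_normD (f g : dual) : dual_norm (f + g) <= dual_norm f + dual_norm g.
Proof.
apply: dual_norm_le => v v1; rewrite (le_trans (ler_normD _ _))//.
by rewrite lerD// dual_norm_ub.
Qed.

Let dual_normZ (a : R) (f : dual) : dual_norm (a *: f) = `|a| * dual_norm f.
Proof.
apply/le_anti/andP; split.
  apply: dual_norm_le => v v1.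
  by rewrite [X in `|X|]/= normrM ler_wpM2l// dual_norm_ub.
have [->|a0] := eqVneq a 0.
  rewrite normr0 mul0r (le_trans (normr_ge0 ((0 *: f : dual) 0)))//.
  by rewrite dual_norm_ub// normr0.
rewrite -ler_pdivlMl ?normr_gt0//; apply: dual_norm_le => v v1.
by rewrite ler_pdivlMl ?normr_gt0// -normrM (dual_norm_ub (a *: f)).
Qed.

Let dual_norm0_eq0 (f : dual) : dual_norm f = 0 -> f = 0.
Proof.
move=> f0; apply/val_inj/funext => v /=.
have [->|v0] := eqVneq v 0; first by rewrite linear0.
have : `|f (`|v|^-1 *: v)| <= 0.
  by rewrite -f0 dual_norm_ub// normrZ normfV normr_id mulVf// normr_eq0.
rewrite normr_le0 linearZ/= scaler_eq0 invr_eq0 normr_eq0 (negbTE v0)/=.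
by move/eqP.
Qed.

HB.instance Definition _ := Lmodule_isNormed.Build R dual
  dual_normD dual_normZ dual_norm0_eq0.

End Dual.
Arguments dual {R} E.

(* R_+ is rendered by R together with 0 <= t (or `[0, +oo[): functions and
   multifunctions of time are total on R, and their values outside the relevant
   half-line are never used. The measure space is R with the Lebesgue
   (complete, i.e. Caratheodory) sigma-algebra rather than the Borel one. *)
Notation lebesgue_type R :=
  (caratheodory_type (mu_ext (@wlength R idfun))) (only parsing).

Section Bochner.
Context {R : realType} {E : normedModType R}.
Local Notation mu := (@completed_lebesgue_measure R).
Implicit Types (D : set R) (f x : R -> E) (h : {fimfun R >-> E}).

Definition simple_on D h :=
  forall y, measurable (D `&` h @^-1` [set y] : set (lebesgue_type R)) /\
    (y != 0 -> (mu (D `&` h @^-1` [set y]) < +oo)%E).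

Definition simple_integral D h : E :=
  \sum_(y \in range h) fine (mu (D `&` h @^-1` [set y])) *: y.

(* The a.e. convergence makes f strongly measurable on D. *)
Definition bochner_approx D f (hn : nat -> {fimfun R >-> E}) :=
  [/\ forall n, simple_on D (hn n),
      {ae mu, forall s, D s -> hn n s @[n --> \oo] --> f s} &
      (\int[mu]_(s in D) `|f s - hn n s|%:E)%E @[n --> \oo] --> 0%E].

Definition bochner_integrable D f := exists hn, bochner_approx D f hn.

Definition is_bochner_integral D f (v : E) :=
  exists2 hn, bochner_approx D f hn &
    simple_integral D (hn n) @[n --> \oo] --> v.

Definition locally_bochner_integrable (t : R) f :=
  forall T, t <= T -> bochner_integrable `[t, T] f.

(* At the single point s = t the two-sided derivative of the total function x
   is not the derivative on [t, +oo[; this is harmless, every use being a.e. *)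
Definition W11loc (t : R) x :=
  [/\ locally_bochner_integrable t x,
      {ae mu, forall s, t <= s -> derivable x s 1},
      locally_bochner_integrable t (derive1 x) &
      forall s, t <= s -> is_bochner_integral `[t, s] (derive1 x) (x s - x t)].

End Bochner.

Section Differentials.
Context {R : realType} {E : normedModType R}.
Implicit Types (phi : E -> \bar R) (C : set E) (x u v : E).
Local Open Scope ereal_scope.

Definition diff_quotient phi x (theta : R) u : \bar R :=
  (phi (x + theta *: u)%R - phi x) * (theta^-1)%:E.

Definition dini_lower phi x v : \bar R :=
  limf_einf (fun z : E * R => diff_quotient phi x z.2 z.1)
    (filter_prod (nbhs v) 0^'+).

Definition dini_upper phi x v : \bar R :=
  limf_esup (fun z : E * R => diff_quotient phi x z.2 z.1)
    (filter_prod (nbhs v) 0^'+).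

(* Both differentials are empty outside the domain of phi. *)
Definition dini_subdiff phi x : set (dual E) :=
  [set q | phi x \is a fin_num /\ forall v, (q v)%:E <= dini_lower phi x v].

Definition dini_superdiff phi x : set (dual E) :=
  [set q | phi x \is a fin_num /\ forall v, dini_upper phi x v <= (q v)%:E].

Definition clarke_derivative phi x v : \bar R :=
  limf_esup (fun z : E * R => diff_quotient phi z.1 z.2 v)
    (filter_prod (nbhs x) 0^'+).

Definition clarke_subdiff phi x : set (dual E) :=
  [set q | forall v, (q v)%:E <= clarke_derivative phi x v].

Definition dist_to C x : R := inf [set `|x - c|%R | c in C].

Definition clarke_tangent C x : set E :=
  [set v | clarke_derivative (EFin \o dist_to C) x v = 0].

Definition clarke_normal C x : set (dual E) :=
  [set q | forall v, clarke_tangent C x v -> (q v <= 0)%R].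

End Differentials.

Section Control.
Context {R : realType} {E : normedModType R}.
Local Notation mu := (@completed_lebesgue_measure R).
Implicit Types (L : R -> E -> E -> \bar R) (Gamma : R -> E -> set E).
Local Open Scope ereal_scope.

Definition lsc_multifunction (G : R -> set E) :=
  forall O : set E, open O -> exists2 U : set R, open U &
    [set t | (0 <= t)%R /\ G t `&` O !=set0] = `[0%R, +oo[ `&` U.

Definition admissible Gamma (t : R) (xi : E) : set (R -> E) :=
  [set x | [/\ W11loc t x,
      {ae mu, forall s, (t <= s)%R -> Gamma s (x s) (derive1 x s)} & x t = xi]].

(* Measurable, and not of the form +oo - oo. *)
Definition integral_defined (D : set R) (g : R -> \bar R) :=
  measurable_fun (D : set (lebesgue_type R)) g /\
  (\int[mu]_(s in D) g^\+ s < +oo \/ \int[mu]_(s in D) g^\- s < +oo).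

Definition is_improper_integral (t : R) (g : R -> \bar R) (c : \bar R) :=
  (forall T, (t <= T)%R -> integral_defined `[t, T] g) /\
  \int[mu]_(s in `[t, T]) g s @[T --> +oo%R] --> c.

Definition is_cost L (t : R) (x : R -> E) (c : \bar R) :=
  is_improper_integral t (fun s => L s (x s) (derive1 x s)) c.

(* The infimum runs over the trajectories whose improper integral is defined,
   and is +oo when there are none. *)
Definition value L Gamma (t : R) (xi : E) : \bar R :=
  ereal_inf [set c | exists2 x, admissible Gamma t xi x & is_cost L t x c].

Definition optimal L Gamma (xi : E) (x0 : R -> E) :=
  [/\ admissible Gamma 0%R xi x0, is_cost L 0%R x0 (value L Gamma 0%R xi) &
      -oo < value L Gamma 0%R xi].

Definition hamiltonian L Gamma (t : R) (x : E) (q : dual E) : \bar R :=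
  ereal_sup [set (q y)%:E - L t x y | y in Gamma t x].

End Control.

Section DualValued.
Context {R : realType} {E : normedModType R}.
Local Notation mu := (@completed_lebesgue_measure R).
Implicit Types (f p : R -> dual E) (q : dual E).

Definition weakly_star_measurable f :=
  forall v, measurable_fun (`[0, +oo[%classic : set (lebesgue_type R))
    (fun t => f t v : R).

Definition is_gelfand_integral (A : set R) f q :=
  forall v, mu.-integrable A (fun t => (f t v)%:E) /\
    q v = \int[mu]_(t in A) (f t v).

Definition is_weak_star_derivative p (t : R) q :=
  forall v, h^-1 * (p (t + h) v - p t v) @[h --> 0^'] --> (q v : R).

End DualValued.

Definition locally_absolutely_continuous {R : realType} {V : normedModType R}
    (p : R -> V) :=
  forall tau : R, 0 < tau -> forall eps : R, 0 < eps ->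
  exists2 delta : R, 0 < delta &
    forall (n : nat) (a b : 'I_n -> R),
      (forall i, 0 <= a i /\ a i <= b i /\ b i <= tau) ->
      (forall i j, i != j -> `]a i, b i[ `&` `]a j, b j[ = set0) ->
      \sum_(i < n) (b i - a i) < delta ->
      \sum_(i < n) `|p (b i) - p (a i)| < eps.

Definition separable {T : topologicalType} :=
  exists2 D : set T, countable D & dense D.
Arguments separable T : clear implicits.

(* Main.v *)
(* By Filippov's theorem and Gronwall's inequality, V(t, .) is Lipschitz with
   the integral over [t, +oo[ of the weight in (g) as constant, which tends to 0
   as t tends to infinity.  By (h) the translates of x0 by small vectors are
   admissible on [0, t], so that dynamic programming compares V(0, .) near x0(0)
   with V(t, .) near x0(t) up to difference quotients of L along x0; with
   Fatou's lemma, x^* minus the integral of f over [0, t] is a subgradient of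
   V(t, .) at x0(t).  This is (i), and (v) follows since subgradients are bounded
   by the Lipschitz constant.  At common Lebesgue points, replacing x0'(t) on a
   short interval by y in Gamma(t, x0(t)), while shifting the initial point so
   that the endpoint is unchanged to first order, shows that x0'(t) maximizes
   <p(t), y> - L(t, x0(t), y) over Gamma(t, x0(t)): this is (iv), and (ii) follows
   by exact penalization with the distance to Gamma(t, x0(t)). *)

From HB Require Import structures.
Require Import Defs.
From mathcomp Require Import all_boot all_order all_algebra.
From mathcomp Require Import all_classical all_reals all_analysis.
From mathcomp Require Import measurable_realfun.
From mathcomp Require Import ring lra.
Set Implicit Arguments.
Unset Strict Implicit.
Unset Printing Implicit Defensive.
Import Order.TTheory GRing.Theory Num.Theory.
Import numFieldNormedType.Exports.
Local Open Scope classical_set_scope.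
Local Open Scope ring_scope.

(** * Sublinear functionals and the dual space *)

Section HahnBanach.
Context {R : realType} {E : lmodType R}.
Implicit Types S : E -> R.

(** Vector integration is kept scalar throughout: strong measurability is measurability of all
    distance functions, equalities between vectors are tested against functionals, and norm
    inequalities are recovered by Hahn-Banach. Gronwall, Fatou and Lebesgue points are then needed
    for real functions only. The recurring obstacle is the null set. The weak-star derivative needs
    one null set for all directions, and maximality needs one for all states and velocities. Both
    come from a countable dense sequence, the integrable Lipschitz constants [l1] and [l2] carrying
    the estimates to the whole space. In maximality every error must be [O(th * e)] with a constant
    independent of [th] and [e]. The perturbed velocity is close to [y] only in mean, and this is
    where the local bound on [l2] enters. *)

Definition sublinear S :=
  (forall u v, S (u + v) <= S u + S v) /\
  (forall a v, 0 <= a -> S (a *: v) = a * S v).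

Lemma sublinear0 S : sublinear S -> S 0 = 0.
Proof. by move=> [_ Sh]; rewrite -(scale0r (0 : E)) Sh// mul0r. Qed.

Lemma sublinear_ge S v : sublinear S -> - S (- v) <= S v.
Proof.
move=> hS; have [Sa _] := hS.
by have := Sa v (- v); rewrite subrr sublinear0//; lra.
Qed.

(** For [a > 0] the reverse inequality is the given one applied to [a^-1] and [a *: v]. *)
Lemma sublinearW S : (forall u v, S (u + v) <= S u + S v) -> 0 <= S 0 ->
  S 0 <= 0 -> (forall a v, 0 < a -> S (a *: v) <= a * S v) -> sublinear S.
Proof.
move=> Sa S0 S0' Sh; split=> // a v; rewrite le_eqVlt => /predU1P[<-|a0].
  by rewrite scale0r mul0r; apply/eqP; rewrite eq_le S0 S0'.
apply/le_anti; rewrite Sh//=.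
have := Sh a^-1 (a *: v); rewrite invr_gt0 => /(_ a0).
by rewrite scalerA mulVf ?gt_eqF// scale1r ler_pdivlMl.
Qed.

(** With [t = 1 / theta] this is the one-sided directional derivative of [S] at [w] in direction
    [v]. It is below [S], and at [- w] it is at most [- S w]; these two facts force a minimal
    sublinear functional to be odd. *)
Definition along S w v : R := inf [set S (v + t *: w) - t * S w | t in [set t | 0 <= t]].

Section along.
Variables (S : E -> R) (w : E).
Hypothesis hS : sublinear S.

Let lb v : lbound [set S (v + t *: w) - t * S w | t in [set t | 0 <= t]]
   (- S (- v)).
Proof.
move=> _ [t /= t0 <-]; have [Sa Sh] := hS.
have := Sa (- v) (v + t *: w); rewrite addrA addNr add0r Sh//; lra.
Qed.

Lemma along_le v t : 0 <= t -> along S w v <= S (v + t *: w) - t * S w.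
Proof. by move=> t0; apply: ge_inf; [exists (- S (- v)); exact: lb|exists t]. Qed.

Lemma along_lb v r : (forall t, 0 <= t -> r <= S (v + t *: w) - t * S w) ->
  r <= along S w v.
Proof.
move=> h; apply: lb_le_inf; first by exists (S (v + 0 *: w) - 0 * S w), 0 => /=.
by move=> _ [t /= t0 <-]; exact: h.
Qed.

Lemma along_sublinear : sublinear (along S w).
Proof.
have [Sa Sh] := hS.
apply: sublinearW.
- move=> u v.
  (* The infima are removed one at a time: a parameter [a] for [u] and a parameter [b] for [v]
     combine to [a + b] for the sum. *)
  have h a : 0 <= a -> along S w (u + v) - (S (u + a *: w) - a * S w) <= along S w v.
    move=> a0; apply: along_lb => b b0.
    have := along_le (u + v) (addr_ge0 a0 b0).
    have := Sa (u + a *: w) (v + b *: w).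
    rewrite addrACA -scalerDl => h1 h2; lra.
  suff : along S w (u + v) - along S w v <= along S w u by lra.
  by apply: along_lb => a a0; have := h _ a0; lra.
- by apply: along_lb => t t0; rewrite add0r Sh// subrr.
- by have := @along_le 0 0 (lexx _); rewrite scale0r add0r (sublinear0 hS) mul0r subr0.
- move=> a v a0; rewrite -ler_pdivrMl//; apply: along_lb => t t0.
  have := @along_le (a *: v) (a * t) (mulr_ge0 (ltW a0) t0).
  rewrite -scalerA -scalerDr Sh ?(ltW a0)// => h.
  by rewrite ler_pdivrMl// mulrBr mulrA.
Qed.

Lemma along_leS v : along S w v <= S v.
Proof. by have := @along_le v 0 (lexx _); rewrite scale0r addr0 mul0r subr0. Qed.

Lemma alongN : along S w (- w) <= - S w.
Proof.
have := @along_le (- w) 1 ler01.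
by rewrite scale1r addNr (sublinear0 hS) mul1r sub0r.
Qed.
End along.

(* A minimal sublinear functional is linear, because [along S w] is below S. *)
Theorem sublinear_dominates_linear S : sublinear S ->
  exists f : E -> R^o, linear f /\ forall v, f v <= S v.
Proof.
move=> hS.
pose X := {p : E -> R | sublinear p /\ forall v, p v <= S v}.
(* The order is reversed, so that Zorn's maximal element is pointwise minimal. *)
pose leX (p q : X) := `[< forall v, sval q v <= sval p v >].
pose S0 : X := exist _ S (conj hS (fun v => lexx _)).
have [||||[m [hm mS]] mmin] := @Zorn X leX.
- by move=> p; apply/asboolP.
- by move=> p q r /asboolP pq /asboolP qr; apply/asboolP => v; exact: le_trans (pq v).
- move=> [p hp] [q hq] /asboolP/= pq /asboolP/= qp.
  by apply: eq_exist => //=; apply/funext => v; apply/le_anti; rewrite pq qp.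
- move=> A totA.
  have [[p0 Ap0]|A0] := pselect (A !=set0); last first.
    by exists S0 => s As; exfalso; apply: A0; exists s.
  (* A nonempty chain is bounded by its pointwise infimum. For subadditivity, two members of the
     chain are comparable and the smaller one serves both arguments. *)
  pose p v := inf [set sval q v | q in A].
  have lb v : lbound [set sval q v | q in A] (- S (- v)).
    move=> _ [[q [hq qS]] Aq <-] /=; apply: le_trans (sublinear_ge v hq).
    by rewrite lerN2.
  have ple v q : A q -> p v <= sval q v.
    by move=> Aq; apply: ge_inf; [exists (- S (- v)); exact: lb|exists q].
  have plb v r : (forall q, A q -> r <= sval q v) -> r <= p v.
    by move=> h; apply: lb_le_inf;
      [exists (sval p0 v); exists p0|move=> _ [q Aq <-]; exact: h].
  have hp : sublinear p.
    apply: sublinearW.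
    + move=> u v.
      have h q : A q -> p (u + v) - sval q u <= p v.
        move=> Aq; apply: plb => q' Aq'.
        have [/asboolP qq'|/asboolP qq'] := totA _ _ Aq Aq'.
        * have := ple (u + v) _ Aq'; have [Sa _] := (svalP q').1.
          by have := Sa u v; have := qq' u; lra.
        * have := ple (u + v) _ Aq; have [Sa _] := (svalP q).1.
          by have := Sa u v; have := qq' v; lra.
      suff : p (u + v) - p v <= p u by lra.
      by apply: plb => q Aq; have := h _ Aq; lra.
    + by apply: plb => q Aq; rewrite sublinear0//; exact: (svalP q).1.
    + by apply: le_trans (ple _ _ Ap0) _; rewrite sublinear0//; exact: (svalP p0).1.
    + move=> a v a0; rewrite -ler_pdivrMl//; apply: plb => q Aq.
      rewrite ler_pdivrMl//; apply: le_trans (ple _ _ Aq) _.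
      by rewrite (svalP q).1.2// ltW.
  have pS v : p v <= S v by apply: le_trans (ple _ _ Ap0) _; exact: (svalP p0).2.
  by exists (exist _ p (conj hp pS)) => q Aq; apply/asboolP => v /=; exact: ple.
(* Minimality, as [along m w] is sublinear and below [m]. With [alongN] this makes [m] odd, and an
   odd sublinear functional is linear. *)
- have mE w : along m w = m.
    have hl : sublinear (along m w) by exact: along_sublinear.
    have hlS v : along m w v <= S v := le_trans (along_leS w hm v) (mS v).
    have := mmin (exist _ _ (conj hl hlS)).
    have /[swap]/[apply] : leX (exist _ m (conj hm mS)) (exist _ _ (conj hl hlS)).
      by apply/asboolP => v /=; exact: along_leS.
    by move=> /(congr1 sval).
  have mN w : m (- w) = - m w.
    apply/le_anti; rewrite -{1}(mE w) alongN//=.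
    by have := sublinear_ge w hm; lra.
  have mD u v : m (u + v) = m u + m v.
    apply/le_anti; rewrite hm.1/=.
    have := hm.1 (- u) (- v); rewrite -opprD !mN; lra.
  exists m; split => // a u v; rewrite mD; congr (_ + _).
  have [a0|a0] := leP 0 a; first by rewrite hm.2.
  rewrite -[a]opprK scaleNr mN hm.2 ?oppr_ge0 ?ltW//.
  by rewrite /GRing.scale/= !mulNr opprK.
Qed.
End HahnBanach.

Section DualFunctionals.
Context {R : realType} {E : normedModType R}.

(** The one-sided bound suffices because [f] is odd; it yields continuity and the norm estimate
    together. *)
Lemma dual_of_bounded (f : E -> R^o) K : linear f ->
  (forall v, f v <= K * `|v|) -> exists2 q : dual E, (q : E -> R) = f & `|q| <= `|K|.
Proof.
move=> lf fK.
have fZ a v : f (a *: v) = a * f v.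
  by have := lf a v 0; rewrite addr0 => ->; have := lf (-1) v v;
   rewrite !scaleN1r addNr => ->; rewrite addNr addr0.
have fD u v : f (u + v) = f u + f v.
  by have := lf 1 u v; rewrite !scale1r.
have fN v : f (- v) = - f v by rewrite -scaleN1r fZ mulN1r.
have fB v : `|f v| <= `|K| * `|v|.
  rewrite ler_norml; apply/andP; split.
    rewrite lerNl -fN; apply: le_trans (fK _) _.
    by rewrite normrN ler_wpM2r// ler_norm.
  by apply: le_trans (fK _) _; rewrite ler_wpM2r// ler_norm.
have cf : continuous f.
  move=> v; apply/cvgrPdist_le => /= e e0.
  have K0 : 0 < `|K| + 1 by rewrite ltr_wpDl.
  near=> u.
  have -> : f v - f u = f (v - u) by rewrite fD fN.
  apply: le_trans (fB _) _.
  have : `|v - u| <= e / (`|K| + 1).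
    near: u; have /cvgrPdist_le := @cvg_id E (nbhs v); apply.
    by rewrite divr_gt0.
  rewrite ler_pdivlMr// mulrC; apply: le_trans.
  by rewrite ler_wpM2r// lerDl.
have P : f \in dual_pred by rewrite inE.
exists (Dual P) => //.
by apply: dual_norm_le => v v1; apply: le_trans (fB v) _; rewrite ler_piMr.
Unshelve. all: by end_near. Qed.

Lemma dualD (p q : dual E) v : (p + q) v = p v + q v. Proof. by []. Qed.
Lemma dualB (p q : dual E) v : (p - q) v = p v - q v. Proof. by []. Qed.
Lemma dualN (p : dual E) v : (- p) v = - p v. Proof. by []. Qed.

Lemma dual_le_norm (q : dual E) v : `|q v| <= `|q| * `|v|.
Proof.
have [->|v0] := eqVneq v 0; first by rewrite linear0 !normr0 mulr0.
have vp : 0 < `|v| by rewrite normr_gt0.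
have := @dual_norm_ub _ _ q (`|v|^-1 *: v).
rewrite normrZ ger0_norm ?invr_ge0// mulVf ?gt_eqF// => /(_ (lexx _)).
rewrite linearZ/= normrM ger0_norm ?invr_ge0//.
by rewrite mulrC ler_pdivrMr.
Qed.

Lemma sublinear_dual S K : sublinear S -> (forall v : E, S v <= K * `|v|) ->
  exists2 q : dual E, forall v, q v <= S v & `|q| <= `|K|.
Proof.
move=> hS SK; have [f [lf fS]] := sublinear_dominates_linear hS.
have [|q qf qK] := @dual_of_bounded f K lf.
  by move=> v; exact: le_trans (SK v).
by exists q => // v; rewrite qf.
Qed.

Lemma norm_sublinear : sublinear (fun v : E => `|v|).
Proof. by split=> [u v|a v a0]; [exact: ler_normD|rewrite normrZ ger0_norm]. Qed.

(** A functional below [along Num.norm u] is below the norm, and at [- u] it is at most [- |u|], so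
    it attains the norm at [u]. *)
Lemma norming_functional (u : E) :
  exists2 q : dual E, q u = `|u| & forall v, `|q v| <= `|v|.
Proof.
have hl := along_sublinear u norm_sublinear.
have [|q qS q1] := @sublinear_dual (along Num.norm u) 1 hl.
  by move=> v; rewrite mul1r; exact: along_leS norm_sublinear _.
have qv v : `|q v| <= `|v|.
  by apply: le_trans (dual_le_norm _ _) _; rewrite ler_piMl// (le_trans q1)// normr1.
exists q => //; apply/le_anti; rewrite (le_trans (ler_norm _) (qv u))/=.
have := qS (- u); rewrite linearN/= => h.
by have := alongN u norm_sublinear; lra.
Qed.

(** Reduces norm inequalities for vector integrals to inequalities between real integrals, the
    functional passing under the integral sign. *)
Lemma norm_le_dual (u : E) r :
  (forall q : dual E, (forall v, `|q v| <= `|v|) -> q u <= r) -> `|u| <= r.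
Proof. by move=> h; have [q <- /h] := norming_functional u. Qed.

(* The infimal convolution of S1 with the reflection of S2 dominates q. *)
Lemma sublinear_sandwich S1 S2 K : sublinear S1 -> sublinear S2 ->
  (forall v : E, 0 <= S1 v + S2 v) -> (forall v, S1 v <= K * `|v|) ->
  exists q : dual E, forall v, q v <= S1 v /\ - q v <= S2 v.
Proof.
move=> h1 h2 h12 S1K.
pose S v := inf [set S1 (v + w) + S2 w | w in setT].
have lb v : lbound [set S1 (v + w) + S2 w | w in setT] (- S2 v).
  by move=> _ [w _ <-]; have := h12 (v + w); have := h2.1 v w; lra.
have Sle v w : S v <= S1 (v + w) + S2 w.
  by apply: ge_inf; [exists (- S2 v); exact: lb|exists w].
have Slb v r : (forall w, r <= S1 (v + w) + S2 w) -> r <= S v.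
  by move=> h; apply: lb_le_inf;
    [exists (S1 (v + 0) + S2 0); exists 0|move=> _ [w _ <-]; exact: h].
have S1S v : S v <= S1 v.
  by have := Sle v 0; rewrite addr0 (sublinear0 h2) addr0.
have hS : sublinear S.
  apply: sublinearW.
  - move=> u v.
    have h w : S (u + v) - (S1 (u + w) + S2 w) <= S v.
      apply: Slb => w'; have := Sle (u + v) (w + w').
      have := h1.1 (u + w) (v + w'); have := h2.1 w w'.
      by rewrite addrACA; lra.
    suff : S (u + v) - S v <= S u by lra.
    by apply: Slb => w; have := h w; lra.
  - by apply: Slb => w; rewrite add0r.
  - by have := S1S 0; rewrite (sublinear0 h1).
  - move=> a v a0; rewrite -ler_pdivrMl//; apply: Slb => w.
    rewrite ler_pdivrMl//; have := Sle (a *: v) (a *: w).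
    by rewrite -scalerDr (h1.2 a) ?(ltW a0)// (h2.2 a) ?(ltW a0)// -mulrDr.
have [|q qS _] := @sublinear_dual S K hS.
  by move=> v; exact: le_trans (S1S v) (S1K v).
exists q => v; split; first exact: le_trans (qS v) (S1S v).
have := Sle (- v) v; rewrite addNr (sublinear0 h1) add0r.
by have := qS (- v); rewrite linearN/=; lra.
Qed.

(* Here Sum P (v_i) >= 0 whenever Sum v_i = 0 makes
   v |-> inf { Sum P (v_i) | Sum v_i = v } finite, hence sublinear. *)
Lemma dual_below_homogeneous (P : E -> R) K :
  (forall a v, 0 < a -> P (a *: v) = a * P v) -> (forall v, P v <= K * `|v|) ->
  (forall s : seq E, \sum_(v <- s) v = 0 -> 0 <= \sum_(v <- s) P v) ->
  exists q : dual E, forall v, q v <= P v.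
Proof.
move=> Ph PK Psum.
pose S v := inf [set \sum_(w <- s) P w | s in [set s | \sum_(w <- s) w = v]].
have lb v : lbound [set \sum_(w <- s) P w | s in [set s | \sum_(w <- s) w = v]]
    (- P (- v)).
  move=> _ [s /= sv <-]; have := Psum (- v :: s).
  by rewrite !big_cons sv addNr => /(_ erefl); lra.
have Sle v s : \sum_(w <- s) w = v -> S v <= \sum_(w <- s) P w.
  by move=> sv; apply: ge_inf; [exists (- P (- v)); exact: lb|exists s].
have Slb v r : (forall s, \sum_(w <- s) w = v -> r <= \sum_(w <- s) P w) ->
    r <= S v.
  move=> h; apply: lb_le_inf; last by move=> _ [s sv <-]; exact: h.
  by exists (\sum_(w <- [:: v]) P w); exists [:: v] => //=; rewrite big_seq1.
have SP v : S v <= P v.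
  by have := @Sle v [:: v]; rewrite !big_seq1; exact.
have hS : sublinear S.
  apply: sublinearW.
  - move=> u v.
    have h s : \sum_(w <- s) w = u -> S (u + v) - \sum_(w <- s) P w <= S v.
      move=> su; apply: Slb => s' sv; have := @Sle (u + v) (s ++ s').
      by rewrite !big_cat/= su sv => /(_ erefl); lra.
    suff : S (u + v) - S v <= S u by lra.
    by apply: Slb => w wu; have := h _ wu; lra.
  - by apply: Slb => s s0; exact: Psum.
  - by have := @Sle 0 [::]; rewrite !big_nil; exact.
  - move=> a v a0; rewrite -ler_pdivrMl//; apply: Slb => s sv.
    rewrite ler_pdivrMl//; have := @Sle (a *: v) (map (fun w => a *: w) s).
    rewrite !big_map -scaler_sumr sv => /(_ erefl).
    by under eq_bigr do rewrite Ph//; rewrite -mulr_sumr.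
have [|q qS _] := @sublinear_dual S K hS.
  by move=> v; exact: le_trans (SP v) (PK v).
by exists q => v; exact: le_trans (qS v) (SP v).
Qed.

End DualFunctionals.

(** * Integrals of real functions *)

Section RealIntegrals.
Context d {T : measurableType d} {R : realType}.
Variable mu : {measure set T -> \bar R}.
Implicit Types (D A : set T) (f g : T -> R).
Local Notation Lint D f := (mu.-integrable D (EFin \o (f : T -> R))).

Lemma lint_meas D f : Lint D f -> measurable_fun D f.
Proof. by move=> /(measurable_int mu) /measurable_EFinP. Qed.

Lemma lint_le D f g : measurable D -> measurable_fun D f -> Lint D g ->
  (forall x, D x -> `|f x| <= g x) -> Lint D f.
Proof.
move=> mD mf ig fg; apply: le_integrable ig => //; first exact/measurable_EFinP.
by move=> x Dx /=; rewrite lee_fin (le_trans (fg _ Dx))// ler_norm.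
Qed.

Lemma lintS D A f : measurable D -> measurable A -> A `<=` D -> Lint D f -> Lint A f.
Proof. by move=> mD mA AD; exact: integrableS. Qed.

Lemma lintD D f g : measurable D -> Lint D f -> Lint D g ->
  Lint D (fun x => f x + g x).
Proof.
by move=> mD lf lg; have := integrableD mD lf lg; apply: eq_integrable.
Qed.

Lemma lintZ D r f : measurable D -> Lint D f -> Lint D (fun x => r * f x).
Proof. by move=> mD /(integrableZl mD r); apply: eq_integrable. Qed.

Lemma lintN D f : measurable D -> Lint D f -> Lint D (fun x => - f x).
Proof. by move=> mD /(integrableN); apply: eq_integrable. Qed.

Lemma lintB D f g : measurable D -> Lint D f -> Lint D g ->
  Lint D (fun x => f x - g x).
Proof. by move=> mD lf lg; apply: lintD => //; exact: lintN. Qed.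

Lemma lint_norm D f : measurable D -> Lint D f -> Lint D (fun x => `|f x|).
Proof. by move=> mD /integrable_norm. Qed.

Lemma lint_cst D r : measurable D -> (mu D < +oo)%E -> Lint D (fun=> r).
Proof.
move=> mD muD; apply: (@measurable_bounded_integrable _ _ R mu (cst r)) => //.
by exists `|r|; split => [|M rM x _]; [exact: num_real|exact: ltW].
Qed.

Lemma ae_eqP D (f g : T -> R) : {ae mu, forall x, D x -> f x = g x} ->
  ae_eq mu D (EFin \o f) (EFin \o g).
Proof. by apply: filterS => x fg Dx /=; rewrite fg. Qed.

Hypothesis cmu : measure_is_complete mu.

Lemma ae_meas D f g : {ae mu, forall x, D x -> f x = g x} ->
  measurable_fun D f -> measurable_fun D g.
Proof.
by move=> /ae_eqP fg /measurable_EFinP mf; apply/measurable_EFinP;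
  exact: ae_measurable_fun fg mf.
Qed.

Lemma ae_lint D f g : measurable D -> {ae mu, forall x, D x -> f x = g x} ->
  Lint D f -> Lint D g.
Proof.
move=> mD fg lf; have mg := ae_meas fg (lint_meas lf).
apply/integrableP; split; first exact/measurable_EFinP.
have /integrableP[mf] := lf; congr (_ < _)%E.
apply: ge0_ae_eq_integral => //; try by apply: measurableT_comp => //; exact/measurable_EFinP.
by apply: filterS fg => x fg Dx /=; rewrite fg.
Qed.

Lemma ae_Rint D f g : measurable D -> {ae mu, forall x, D x -> f x = g x} ->
  measurable_fun D f -> \int[mu]_(x in D) f x = \int[mu]_(x in D) g x.
Proof.
move=> mD fg mf; congr fine; apply: ae_eq_integral => //.
- exact/measurable_EFinP.
- by apply/measurable_EFinP; exact: ae_meas fg mf.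
- exact: ae_eqP.
Qed.

(** [f] is replaced by 0 where the bound fails; by completeness this change on a null set preserves
    measurability. *)
Lemma lint_le_ae D f g : measurable D -> measurable_fun D f -> Lint D g ->
  {ae mu, forall x, D x -> `|f x| <= g x} -> Lint D f.
Proof.
move=> mD mf lg fg.
pose f' x := if `|f x| <= g x then f x else 0.
have ff' : {ae mu, forall x, D x -> f x = f' x}.
  by apply: filterS fg => x fg Dx; rewrite /f' fg.
have f'f : {ae mu, forall x, D x -> f' x = f x}.
  by apply: filterS ff' => x h Dx; rewrite h.
apply: (ae_lint mD f'f).
apply: (@lint_le _ _ (fun x => `|g x|)) => //; last 2 first.
- exact: lint_norm.
- move=> x _; rewrite /f'; case: ifPn => [fgx|_]; last by rewrite normr0.
  by rewrite (le_trans fgx)// ler_norm.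
by apply: ae_meas mf.
Qed.

Lemma le_Rint_ae D f g : measurable D -> Lint D f -> Lint D g ->
  {ae mu, forall x, D x -> f x <= g x} ->
  \int[mu]_(x in D) f x <= \int[mu]_(x in D) g x.
Proof.
move=> mD lf lg fg.
pose g' x := Num.max (f x) (g x).
have gg' : {ae mu, forall x, D x -> g x = g' x}.
  by apply: filterS fg => x fg Dx; rewrite /g' (max_idPr (fg Dx)).
rewrite (ae_Rint mD gg' (lint_meas lg)).
apply: le_Rintegral => //; first exact: ae_lint gg' lg.
by move=> x _; rewrite /g' le_max lexx.
Qed.

(** Multiplication by the indicator of the complement of the exceptional null set turns almost
    everywhere convergence into convergence at every point of [D]. *)
Lemma ae_cvg_meas D (f_ : nat -> T -> R) f : measurable D ->
  (forall n, measurable_fun D (f_ n)) ->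
  {ae mu, forall x, D x -> f_ n x @[n --> \oo] --> f x} -> measurable_fun D f.
Proof.
move=> mD mf [N [mN N0 NP]].
have ND x : ~ N x -> D x -> f_ n x @[n --> \oo] --> f x.
  by move=> nNx; apply: contrapT => h; apply: nNx; exact: NP.
have ae0 g : {ae mu, forall x, D x -> g x * \1_(~` N) x = g x}.
  exists N; split => // x /= h; apply: contrapT => nNx; apply: h => _.
  by rewrite indicE mem_set ?mulr1.
apply: (ae_meas (ae0 f)).
apply: (@measurable_fun_cvg _ _ _ D (fun n x => f_ n x * \1_(~` N) x)).
  move=> n; apply: measurable_funM => //.
  by apply: measurable_indic; exact: measurableC.
move=> x Dx; have [Nx|nNx] := pselect (N x).
  rewrite indicE memNset ?mulr0//.
  under eq_cvg do rewrite mulr0.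
  exact: cvg_cst.
rewrite indicE mem_set ?mulr1//; under eq_cvg do rewrite mulr1.
exact: ND.
Qed.

Lemma lint_dominated D (f_ : nat -> T -> R) f g : measurable D ->
  (forall n, measurable_fun D (f_ n)) ->
  {ae mu, forall x, D x -> f_ n x @[n --> \oo] --> f x} ->
  Lint D g -> {ae mu, forall x, D x -> forall n, `|f_ n x| <= g x} ->
  Lint D f /\
  \int[mu]_(x in D) f_ n x @[n --> \oo] --> \int[mu]_(x in D) f x.
Proof.
move=> mD mf ff lg fg; have mf' := ae_cvg_meas mD mf ff.
have [|||||lf _ h] := @dominated_convergence _ _ _ mu D mD
  (fun n => EFin \o f_ n) (EFin \o f) (EFin \o g).
- by move=> n; exact/measurable_EFinP.
- exact/measurable_EFinP.
- apply: filterS ff => x ff Dx; apply: cvg_EFin => //; last exact: ff.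
  by apply: nearW.
- by [].
- by apply: filterS fg => x fg n Dx /=; rewrite lee_fin fg.
split=> //; rewrite /Rintegral.
apply: fine_cvg; rewrite fineK//; exact: integrable_fin_num.
Qed.

(* The dominating functions [g - n] truncated at 0 tend to 0 pointwise. *)
Lemma lint_excess_small D g e : measurable D -> Lint D g -> 0 < e ->
  exists n : nat, Lint D (fun x => Num.max (g x - n%:R) 0) /\
    \int[mu]_(x in D) Num.max (g x - n%:R) 0 < e.
Proof.
move=> mD lg e0.
pose h (n : nat) x := Num.max (g x - n%:R) 0.
have mh n : measurable_fun D (h n).
  apply: measurable_maxr => //; apply: measurable_funB => //; exact: lint_meas lg.
have hle n x : `|h n x| <= `|g x|.
  rewrite ger0_norm /h ?le_max ?lexx ?orbT// ge_max normr_ge0 andbT.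
  by rewrite (le_trans _ (ler_norm _))// gerBl.
have lh n : Lint D (h n).
  by apply: (lint_le mD (mh n) (lint_norm mD lg)) => x _; exact: hle.
have h0 x : h n x @[n --> \oo] --> (0 : R).
  apply: cvg_near_cst; near=> n; apply/max_idPr; rewrite subr_le0.
  near: n; exact: nbhs_infty_ger.
have [||_ /cvgrPdist_lt/(_ _ e0)[n _ /(_ n (leqnn _))] hn] :=
  @lint_dominated D h (fun=> 0) (fun x => `|g x|) mD mh _ (lint_norm mD lg).
- by apply: aeW => x _; exact: h0.
- by apply: aeW => x _ n; exact: hle.
have hn0 : 0 <= \int[mu]_(x in D) h n x.
  by apply: Rintegral_ge0 => x _; rewrite le_max lexx orbT.
exists n; split; first exact: lh.
by move: hn; rewrite [X in X - _]/Rintegral integral0 sub0r normrN ger0_norm.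
Unshelve. all: by end_near. Qed.

End RealIntegrals.

(** * Lebesgue measure on the line *)

Notation "\I_ [ a , b ] f" := (\int[completed_lebesgue_measure]_(s in `[a, b]) (f s))
  (at level 36, f at level 36, a at level 60, b at level 60) : ring_scope.

Section LebesgueLine.
Context {R : realType}.
Local Notation mu := (@completed_lebesgue_measure R).
Local Notation T := (lebesgue_type R).
Local Notation Lint D f := (mu.-integrable (D : set T) (EFin \o (f : R -> R))).

#[global] Instance clm_ae_filter :
  Filter (almost_everywhere (@completed_lebesgue_measure R)).
Proof. exact: (ae_filter_ringOfSetsType (@completed_lebesgue_measure R)). Qed.

Definition clm_complete := @completed_lebesgue_measure_is_complete R.

Lemma borel_lebesgue (A : set R) :
  measurable (A : set (measurableTypeR R)) -> measurable (A : set T).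
Proof. exact: sub_caratheodory. Qed.

Lemma borel_lebesgue_fun (D : set R) (f : R -> R) :
  measurable_fun setT (f : measurableTypeR R -> measurableTypeR R) ->
  measurable_fun (D : set T) f.
Proof.
move=> mf; apply: (@measurable_funS _ _ _ _ setT) => //.
by move=> _ A mA; apply: borel_lebesgue; exact: mf.
Qed.

Lemma lebesgue_itv (i : interval R) : measurable ([set` i] : set T).
Proof. by apply: borel_lebesgue; exact: measurable_itv. Qed.

Lemma continuous_lebesgue (D : set R) (f : R -> R) : continuous f ->
  measurable_fun (D : set T) f.
Proof. by move=> cf; apply: borel_lebesgue_fun; exact: continuous_measurable_fun. Qed.

Lemma clm_itvcc (a b : R) : a <= b -> mu `[a, b] = (b - a)%:E.
Proof.
move=> ab; rewrite -[LHS]/(lebesgue_measure `[a, b]%classic).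
rewrite lebesgue_measure_itv/= lte_fin; case: ifPn => //; rewrite -leNgt => ba.
by have -> : b = a by [apply/le_anti; rewrite ba]; rewrite subrr.
Qed.

Lemma clm_set1 (a : R) : mu [set a] = 0%E.
Proof. by rewrite -[LHS]/(lebesgue_measure [set a]) lebesgue_measure_set1. Qed.

Lemma clm_itv_fin (a b : R) : (mu `[a, b] < +oo)%E.
Proof.
rewrite -[X in (X < _)%E]/(lebesgue_measure `[a, b]%classic).
by rewrite lebesgue_measure_itv/= lte_fin; case: ifP => _; rewrite -?EFinB ltry.
Qed.

Lemma ae_neq (a : R) : {ae mu, forall s, s <> a}.
Proof.
exists [set a]; split => //; [|exact: clm_set1|by move=> x /= /contrapT].
by rewrite -set_itv1; exact: lebesgue_itv.
Qed.

(** Change of variables along the identity from the Lebesgue to the Borel sigma-algebra; it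
    transports results stated for [lebesgue_measure]. *)
Lemma ge0_integral_clm (D : set R) (f : R -> \bar R) :
  measurable (D : set (measurableTypeR R)) ->
  measurable_fun (D : set (measurableTypeR R)) f ->
  (forall y, D y -> 0 <= f y)%E ->
  (\int[lebesgue_measure]_(x in D) f x = \int[mu]_(x in D) f x)%E.
Proof.
move=> mD mf f0.
have mid : measurable_fun setT (idfun : T -> measurableTypeR R).
  by move=> _ A mA; rewrite setTI; exact: borel_lebesgue.
apply: (@ge0_integral_pushforward _ _ _ _ R (idfun : T -> measurableTypeR R)
  mid mu D f mD mf).
by move=> y /set_mem; exact: f0.
Qed.

Lemma itvcc_sub (a b c e : R) : a <= c -> e <= b -> `[c, e] `<=` `[a, b].
Proof.
move=> ac eb x /=; rewrite !in_itv/= => /andP[cx xe].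
by rewrite (le_trans ac cx) (le_trans xe eb).
Qed.

Lemma lint_itvS (a b c e : R) f : a <= c -> e <= b ->
  Lint `[a, b] f -> Lint `[c, e] f.
Proof.
move=> ac eb; apply: lintS; try exact: lebesgue_itv.
exact: itvcc_sub.
Qed.

Lemma lint_itv_cst (a b r : R) : Lint `[a, b] (fun=> r).
Proof. by apply: lint_cst; [exact: lebesgue_itv|exact: clm_itv_fin]. Qed.

Lemma Rint_itv_cst (a b r : R) : a <= b -> \I_[a, b] (fun=> r) = r * (b - a).
Proof.
move=> ab; rewrite Rintegral_cst; last exact: lebesgue_itv.
by congr (r * _); exact: (congr1 fine (clm_itvcc ab)).
Qed.

Lemma Rint_set1 (a : R) f : \int[mu]_(s in [set a]) f s = 0.
Proof.
rewrite /Rintegral (@eq_integral _ _ _ mu _ (fun=> (f a)%:E)); last first.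
  by move=> x /set_mem ->.
rewrite integral_cst; last by rewrite -set_itv1; exact: lebesgue_itv.
apply: (eq_trans (congr1 (fun z => fine ((f a)%:E * z)%E) (clm_set1 a))).
by rewrite mule0.
Qed.

Lemma Rint_itv_pt (a b : R) f : b <= a -> \I_[a, b] f = 0.
Proof.
rewrite le_eqVlt => /predU1P[->|ba]; first by rewrite set_itv1 Rint_set1.
by rewrite set_itv_ge ?Rintegral_set0// bnd_simp -ltNge.
Qed.

Lemma Rint_itv_oc (a b : R) f : Lint `[a, b] f ->
  \int[mu]_(s in `]a, b]) f s = \I_[a, b] f.
Proof.
move=> lf; rewrite /Rintegral.
have ma : measurable ([set a] : set T) by rewrite -set_itv1; exact: lebesgue_itv.
have mab : measurable (`[a, b]%classic : set T) by exact: lebesgue_itv.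
rewrite [in RHS](negligible_integral ma mab lf (clm_set1 a)).
congr (fine (integral _ _ _)); apply/seteqP; split => x /=; rewrite !in_itv/=.
  by move=> /andP[ax xb]; split; [rewrite xb ltW|move=> xa; rewrite xa ltxx in ax].
move=> [/andP[ax xb] /eqP xa]; rewrite xb andbT lt_neqAle ax andbT.
by rewrite eq_sym.
Qed.

Lemma Rint_cat (a b c : R) f : a <= b -> b <= c -> Lint `[a, c] f ->
  \I_[a, c] f = \I_[a, b] f + \I_[b, c] f.
Proof.
move=> ab bc lf.
have E : `[a, c]%classic = `[a, b] `|` `]b, c].
  by apply: itv_bndbnd_setU; rewrite bnd_simp.
rewrite [in LHS]E Rintegral_setU.
- by rewrite Rint_itv_oc//; apply: lint_itvS lf.
- exact: lebesgue_itv.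
- exact: lebesgue_itv.
- by rewrite -E.
- apply/disj_setPS => x /= []; rewrite !in_itv/= => /andP[_ xb] /andP[bx _].
  by move: bx; rewrite ltNge xb.
Qed.

Lemma Rint_itv_ge0 (a b : R) f : (forall s, a <= s -> s <= b -> 0 <= f s) ->
  0 <= \I_[a, b] f.
Proof. by move=> f0; apply: Rintegral_ge0 => x /=; rewrite in_itv/= => /andP[]; exact: f0. Qed.

Lemma le_Rint_itv (a b : R) f g : Lint `[a, b] f -> Lint `[a, b] g ->
  (forall s, a <= s -> s <= b -> f s <= g s) -> \I_[a, b] f <= \I_[a, b] g.
Proof.
move=> lf lg fg; apply: le_Rintegral => //; first exact: lebesgue_itv.
by move=> x /=; rewrite in_itv/= => /andP[]; exact: fg.
Qed.

Lemma le_Rint_itv_ae (a b : R) f g : Lint `[a, b] f -> Lint `[a, b] g ->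
  {ae mu, forall s, a <= s -> s <= b -> f s <= g s} -> \I_[a, b] f <= \I_[a, b] g.
Proof.
move=> lf lg fg; apply: le_Rint_ae => //; [exact: clm_complete|exact: lebesgue_itv|].
by apply: filterS fg => x fg /=; rewrite in_itv/= => /andP[]; exact: fg.
Qed.

Lemma le_Rint_itvS (a b c e : R) f : a <= c -> e <= b -> Lint `[a, b] f ->
  (forall s, a <= s -> s <= b -> 0 <= f s) -> \I_[c, e] f <= \I_[a, b] f.
Proof.
move=> ac eb lf f0.
have [ce|ec] := leP c e; last first.
  by rewrite (Rint_itv_pt _ (ltW ec)); apply: Rint_itv_ge0 => s; exact: f0.
have lf' : Lint `[c, b] f by apply: lint_itvS lf.
rewrite (Rint_cat ac (le_trans ce eb) lf) (Rint_cat ce eb lf').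
rewrite addrCA lerDl addr_ge0//; apply: Rint_itv_ge0 => s h1 h2; apply: f0 => //.
- by rewrite (le_trans h2)// (le_trans ce).
- by rewrite (le_trans ac)// (le_trans ce).
Qed.

(** Absolute continuity of the integral: [|g|] is at most [n] plus its excess over [n]. The excess
    has small integral, and [n] contributes in proportion to the length. *)
Lemma Rint_itv_small (a b e : R) g : Lint `[a, b] g -> 0 < e ->
  exists2 dl, 0 < dl & forall r s, a <= r -> r <= s -> s <= b -> s - r < dl ->
    \I_[r, s] (fun t => `|g t|) < e.
Proof.
move=> lg e0.
have mab : measurable (`[a, b]%classic : set T) by exact: lebesgue_itv.
have lg' := lint_norm mab lg.
have [n [ln nlt]] := lint_excess_small clm_complete mab lg' (divr_gt0 e0 (ltr0n _ 2)).
exists (e / 2 / n.+1%:R); first by rewrite !divr_gt0.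
move=> r s ar rs sb srd.
set h := (fun x => Num.max _ _) in ln nlt.
have h0 x : 0 <= h x by rewrite le_max lexx orbT.
have lrs : Lint `[r, s] (fun t => h t + n%:R).
  by apply: lintD; [exact: lebesgue_itv|apply: lint_itvS ln|exact: lint_itv_cst].
apply: (@le_lt_trans _ _ (\I_[r, s] (fun t => h t + n%:R))).
  apply: le_Rint_itv => //; first by apply: lint_itvS lg'.
  by move=> t _ _; rewrite -lerBlDr le_max lexx.
rewrite RintegralD//; [|exact: lebesgue_itv|by apply: lint_itvS ln|exact: lint_itv_cst].
rewrite Rint_itv_cst// [e]splitr ltrD//.
  by apply: le_lt_trans nlt; apply: le_Rint_itvS.
rewrite ltr_pdivlMr// in srd.
rewrite (le_lt_trans _ srd)// mulrC ler_wpM2l ?subr_ge0// ler_nat//.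
Qed.

(* A Borel function equal to g off the union of the null parts of the level sets. *)
Lemma borel_version (g : R -> R) : measurable_fun (setT : set T) g ->
  exists2 h : R -> R, measurable_fun setT (h : measurableTypeR R -> measurableTypeR R) &
    {ae mu, forall s, h s = g s}.
Proof.
move=> mg.
(* [q] enumerates the rationals; an integer that codes none is sent to 0, which only repeats a
   level. *)
pose q (n : nat) : R := ratr (odflt 0 (unpickle n : option rat)).
(* A set of the completed sigma-algebra is the union of a Borel set and a null set. *)
have lev n : exists BN : set R * set R,
    [/\ measurable (BN.1 : set (measurableTypeR R)),
        lebesgue_measure.-negligible BN.2 &
        BN.1 `|` BN.2 = [set x | q n < g x]].
  have : measurable ([set x | q n < g x] : set T).
    have := mg measurableT `]q n, +oo[%classic (measurable_itv _).
    rewrite setTI; congr (measurable _).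
    by apply/seteqP; split => x /=; rewrite in_itv/= andbT.
  rewrite -[X in X -> _]/((@wlength R idfun)^*%mu.-cara.-measurable _).
  rewrite -completed_caratheodory_measurable g_sigma_completed_algebra_genE.
  by move=> [B mB [N nN BN]]; exists (B, N).
pose B n := (projT1 (cid (lev n))).1; pose N n := (projT1 (cid (lev n))).2.
have mB n : measurable (B n : set (measurableTypeR R)) by rewrite /B; case: cid => ? [].
have nN n : lebesgue_measure.-negligible (N n) by rewrite /N; case: cid => ? [].
have BNE n : B n `|` N n = [set x | q n < g x] by rewrite /B /N; case: cid => ? [].
(* [g x] is the supremum of the rationals below it, here read off the Borel parts of the level sets
   alone. *)
pose u n x : \bar R := if x \in B n then (q n)%:E else -oo%E.
pose h x := fine (esups (u^~ x) 0%N).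
exists h.
  apply: (measurableT_comp (@fine_measurable R setT measurableT)).
  apply: measurable_fun_esups => n; apply: measurable_fun_ifT => //.
  apply: (measurable_fun_bool true).
  rewrite setTI (_ : _ @^-1` _ = B n)//.
  by apply/seteqP; split => x /=; [move/set_mem|move/mem_set].
have [N' [mN' N'0 NN']] := negligible_bigcup nN.
exists N'; split=> //; first exact: borel_lebesgue.
move=> x /= hx; apply: NN'; apply: contrapT => nNx; apply: hx.
have Bx n : B n x <-> q n < g x.
  split=> [Bnx|]; first by have : (B n `|` N n) x by [left]; rewrite BNE.
  move=> qx; have : [set x | q n < g x] x by [].
  by rewrite -BNE => -[//|Nx]; exfalso; apply: nNx; exists n.
suff -> : h x = fine (g x)%:E by [].
congr fine; apply/le_anti/andP; split.
  apply: ge_ereal_sup => _ [n _ <-]; rewrite /u; case: ifPn => [/set_mem/Bx|_].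
    by rewrite lee_fin => /ltW.
  by rewrite leNye.
apply/lee_addgt0Pr => e e0.
have [|r] := @rat_in_itvoo R (g x - e) (g x); first by rewrite gtrBl.
rewrite in_itv/= => /andP[r1 r2].
have qr : q (pickle r) = ratr r by rewrite /q pickleK.
apply: (@le_trans _ _ ((ratr r)%:E + e%:E)%E).
  by rewrite -EFinD lee_fin -lerBlDr ltW.
rewrite leeD2r//; apply: ereal_sup_ubound; exists (pickle r) => //.
by rewrite /u mem_set ?qr//; apply/Bx; rewrite qr.
Qed.


(** A Lebesgue point, in a form with arbitrary intervals around [t]: [t] may be an endpoint, so
    one-sided increments are covered, and [t0 <= a] keeps the values before [t0] out. *)
Definition lpoint (t0 : R) (g : R -> R) (t : R) := forall e, 0 < e ->
  exists2 dl, 0 < dl & forall a b, t0 <= a -> a <= t -> t <= b -> b - a < dl ->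
    \I_[a, b] (fun s => `|g s - g t|) <= e * (b - a).

(** The ball of radius [r] has measure [2 * r], hence an average below [e / 2] gives the bound
    [e * r]. *)
Lemma lebesgue_pt_avg (h : R -> R) t e :
  measurable_fun setT (h : measurableTypeR R -> measurableTypeR R) ->
  lebesgue_pt h t -> 0 < e ->
  exists2 dl, 0 < dl & forall r, 0 < r -> r < dl ->
    (\int[mu]_(s in ball t r) (`|h s - h t|)%:E <= (e * r)%:E)%E.
Proof.
move=> mh; rewrite /lebesgue_pt => ht e0.
have /fine_cvgP[fin_near /cvgrPdist_lt] := ht => /(_ (e / 2)).
rewrite divr_gt0// => /(_ isT) near_lt.
have [dl /= dl0 dlP] : \forall r \near 0^'+, (davg h t r < (e / 2)%:E)%E.
  near=> r.
  have fr : davg h t r \is a fin_num by near: r.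
  rewrite -(fineK fr) lte_fin; apply: le_lt_trans (ler_norm _) _.
  rewrite -normrN -sub0r; near: r; exact: near_lt.
exists dl => // r r0 rdl.
have : (davg h t r < (e / 2)%:E)%E.
  by apply: dlP => //=; rewrite sub0r normrN gtr0_norm.
rewrite /davg /iavg (lebesgue_measure_ball _ (ltW r0)) => hlt.
rewrite -ge0_integral_clm; first last.
- by move=> y _; rewrite lee_fin.
- apply/measurable_EFinP; apply: measurableT_comp => //.
  by apply: measurable_funB => //; exact: measurable_funTS.
- exact: measurable_ball.
have r2 : 0 < r *+ 2 by rewrite pmulrn_lgt0.
move: hlt; rewrite inver gt_eqF// lte_pdivrMl// => /ltW; rewrite -EFinM.
by rewrite (_ : r *+ 2 * (e / 2) = e * r)//; rewrite -mulr_natr; field.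
Unshelve. all: by end_near. Qed.

(** The differentiation theorem is applied to Borel functions on the whole line: [g] is cut off to
    [[t0, n]] and replaced by a Borel version, and the exceptional sets for all [n] are united. *)
Lemma lpoint_ae (t0 : R) (g : R -> R) : (forall n : nat, Lint `[t0, n%:R] g) ->
  {ae mu, forall t, t0 <= t -> lpoint t0 g t}.
Proof.
move=> lg.
pose gn n := g \_ `[t0, n%:R].
have lgn n : Lint setT (gn n).
  have /(integrable_mkcond _ (lebesgue_itv _)) := lg n.
  by rewrite -restrict_EFin.
have hex n : exists f : R -> R,
    measurable_fun setT (f : measurableTypeR R -> measurableTypeR R) /\
    {ae mu, forall s, f s = gn n s}.
  by have [f f1 f2] := borel_version (lint_meas (lgn n)); exists f.
pose h n := projT1 (cid (hex n)).
have hP n : measurable_fun setT (h n : measurableTypeR R -> measurableTypeR R) /\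
    {ae mu, forall s, h n s = gn n s}.
  by rewrite /h; case: cid.
have hpt : {ae mu, forall s, forall n, lebesgue_pt (h n) s}.
  apply: ae_foralln => n; have [mh hg] := hP n.
  have lh : Lint setT (h n).
    apply: (ae_lint clm_complete measurableT _ (lgn n)).
    by apply: filterS hg => s ->.
  have [//|N [mN N0 NP]] := @lebesgue_differentiation R (h n).
    split=> //; first exact: openT.
    move=> K _ cK.
    have mK : measurable (K : set (measurableTypeR R)) by exact: compact_measurable.
    have mhK : measurable_fun (K : set (measurableTypeR R)) (fun x => (`|h n x|)%:E).
      apply/measurable_EFinP; apply: measurableT_comp => //; exact: measurable_funTS.
    rewrite ge0_integral_clm//.
    have /integrableP[_] := lh; apply: le_lt_trans.
    have mabs : measurable_fun (setT : set T) (fun x => (`|h n x|)%:E).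
      by apply/measurable_EFinP; exact: (lint_meas (lint_norm measurableT lh)).
    have abs0 x : setT x -> (0 <= (`|h n x|)%:E)%E by move=> _; rewrite lee_fin.
    exact: (@ge0_subset_integral _ _ _ mu K setT (borel_lebesgue mK) measurableT
      _ mabs abs0 (@subsetT _ K)).
  by exists N; split=> //; exact: borel_lebesgue.
have hg : {ae mu, forall s, forall n, h n s = gn n s}.
  by apply: ae_foralln => n; have [] := hP n.
apply: filterS2 hpt hg => t hpt ht t0t e e0.
pose n := (Num.truncn t).+1.
have tn : t < n%:R by exact: truncnS_gt.
have [mh hgn] := hP n.
(* [[a, b]] lies in the open ball of radius [2 * (b - a)] about [t], and [e / 2] times this radius
   is [e * (b - a)]. *)
have [dl dl0 dlP] := lebesgue_pt_avg mh (hpt n) (divr_gt0 e0 (ltr0n R 2)).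
exists (Num.min (dl / 2) (n%:R - t)).
  by rewrite lt_min divr_gt0// subr_gt0.
move=> a b a0 at_ tb; rewrite lt_min => /andP[bdl bn].
have [ba|ab] := leP b a.
  by rewrite (Rint_itv_pt _ ba) mulr_ge0 ?(ltW e0)// subr_ge0 (le_trans at_ tb).
have gE s : a <= s -> s <= b -> gn n s = g s.
  move=> as_ sb; rewrite /gn patchE mem_set//= in_itv/= (le_trans a0 as_)/=; clear -sb bn at_; lra.
have ba0 : 0 < b - a by rewrite subr_gt0.
have r0 : 0 < 2 * (b - a) by rewrite mulr_gt0.
have rdl : 2 * (b - a) < dl by move: bdl; rewrite ltr_pdivlMr// mulrC.
have := dlP _ r0 rdl.
rewrite (_ : e / 2 * (2 * (b - a)) = e * (b - a)); last by field.
rewrite -lee_fin; apply: le_trans.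
have mi : measurable (`[a, b]%classic : set T) by exact: lebesgue_itv.
have mb : measurable (ball t (2 * (b - a)) : set T).
  by apply: borel_lebesgue; exact: measurable_ball.
have mhB : measurable_fun (ball t (2 * (b - a)) : set T) (fun x => (`|h n x - h n t|)%:E).
  apply/measurable_EFinP/borel_lebesgue_fun; apply: measurableT_comp => //.
  exact: measurable_funB.
have sub : `[a, b]%classic `<=` (ball t (2 * (b - a)) : set R).
  move=> s /=; rewrite in_itv/= => /andP[as_ sb].
  rewrite /ball/= ltr_norml; clear -as_ sb at_ tb ab; apply/andP; split; lra.
apply: (@le_trans _ _ (\int[mu]_(s in `[a, b]) (`|h n s - h n t|)%:E)%E); last first.
  by apply: ge0_subset_integral.
have lgab : Lint `[a, b] (fun s => `|gn n s - g t|).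
  apply: lint_norm => //; apply: lintB => //; last exact: lint_itv_cst.
  by apply: lintS (lgn n).
have gh : {ae mu, forall s, `[a, b]%classic s -> `|g s - g t| = `|h n s - h n t|}.
  apply: filterS hgn => s -> /=; rewrite in_itv/= => /andP[as_ sb].
  by rewrite ht (gE s as_ sb) (gE t at_ tb).
have lg' : Lint `[a, b] (fun s => `|g s - g t|).
  apply: (ae_lint clm_complete mi _ lgab); apply: aeW => s /=.
  by rewrite in_itv/= => /andP[as_ sb]; rewrite (gE s as_ sb).
rewrite (ae_Rint clm_complete mi gh (lint_meas lg')) fineK//.
exact: (integrable_fin_num mi (ae_lint clm_complete mi gh lg')).
Unshelve. all: by end_near. Qed.

End LebesgueLine.

(** * Strongly measurable functions *)

Section Distance.
Context {R : realType} {E : normedModType R}.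
Implicit Types (C : set E) (x y c : E).

Lemma dist_lb C x : lbound [set `|x - c| | c in C] 0.
Proof. by move=> _ [c _ <-]. Qed.

Lemma dist_le C x c : C c -> dist_to C x <= `|x - c|.
Proof. by move=> Cc; apply: ge_inf; [exists 0; exact: dist_lb|exists c]. Qed.

Lemma dist_ge C x r : C !=set0 -> (forall c, C c -> r <= `|x - c|) -> r <= dist_to C x.
Proof.
move=> [c Cc] h; apply: lb_le_inf; first by exists `|x - c|, c.
by move=> _ [c' Cc' <-]; exact: h.
Qed.

Lemma dist_ge0 C x : C !=set0 -> 0 <= dist_to C x.
Proof. by move=> C0; exact: dist_ge. Qed.

Lemma dist_ltP C x r : C !=set0 -> dist_to C x < r -> exists2 c, C c & `|x - c| < r.
Proof.
move=> C0 dr; apply: contrapT => h.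
suff : r <= dist_to C x by rewrite leNgt dr.
by apply: dist_ge => // c Cc; rewrite leNgt; apply/negP => xc; apply: h; exists c.
Qed.

Lemma dist_lip C x y : C !=set0 -> dist_to C x <= dist_to C y + `|x - y|.
Proof.
move=> C0; rewrite -lerBlDr; apply: dist_ge => // c Cc; rewrite lerBlDr.
by apply: le_trans (dist_le x Cc) _; rewrite [leRHS]addrC ler_distD.
Qed.

Lemma dist0 C x : C x -> dist_to C x = 0.
Proof.
move=> Cx; apply/le_anti; rewrite dist_ge0 ?andbT; last by exists x.
by rewrite (le_trans (dist_le x Cx))// subrr normr0.
Qed.

Lemma dist0_closed C x : closed C -> C !=set0 -> dist_to C x <= 0 -> C x.
Proof.
move=> cC C0 d0; apply: cC => B /nbhs_ballP[e /= e0 Be].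
have [|c Cc xc] := @dist_ltP C x e C0; first exact: le_lt_trans e0.
by exists c; split => //; apply: Be; rewrite -ball_normE.
Qed.

End Distance.

Section SummableIncrements.
Context {R : realType} {E : completeNormedModType R}.

(** Absolute convergence in a complete space; the increments telescope, so [K] also bounds the total
    displacement. *)
Lemma cvg_increments (u : nat -> E) K :
  (forall n, \sum_(0 <= k < n) `|u k.+1 - u k| <= K) ->
  exists2 l, u n @[n --> \oo] --> l & `|l - u 0%N| <= K.
Proof.
move=> uK.
have sE n : series (fun k => u k.+1 - u k) n = u n - u 0%N.
  by rewrite /series/= telescope_sumr.
have : cvgn (series (fun k => u k.+1 - u k)).
  apply: normed_cvg; apply: nondecreasing_is_cvgn.
    apply/nondecreasing_seqP => n.
    rewrite -[leLHS]/(\sum_(0 <= k < n) `|u k.+1 - u k|).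
    rewrite -[leRHS]/(\sum_(0 <= k < n.+1) `|u k.+1 - u k|).
    by rewrite [leRHS]big_nat_recr//= lerDl.
  by exists K => _ [n _ <-]; exact: uK.
move=> /cvg_ex[l hl]; exists (l + u 0%N).
  have h : series (fun k => u k.+1 - u k) n + u 0%N @[n --> \oo] --> l + u 0%N.
    by apply: cvgD; [exact: hl|exact: cvg_cst].
  apply: cvg_trans h; apply: near_eq_cvg; apply: nearW => n.
  by rewrite sE subrK.
rewrite addrK.
have hn : `|series (fun k => u k.+1 - u k) n| @[n --> \oo] --> `|l| by apply: cvg_norm.
apply: (cvgr_to_le hn).
apply: nearW => n; rewrite /series/=.
by apply: le_trans (ler_norm_sum _ _ _) _.
Qed.

End SummableIncrements.

Section StrongMeasurability.
Context d {T : measurableType d} {R : realType} {E : completeNormedModType R}.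
Hypothesis Esep : separable E.
Variable D : set T.
Hypothesis mD : measurable D.
Implicit Types (f : T -> E).

(** For separable [E] this is strong measurability: the first point of a dense sequence within a
    given tolerance of [f s] provides countably valued approximations. *)
Record smeas f : Prop := Smeas {
  smeas_dist : forall c : E, measurable_fun D (fun s => `|f s - c|) }.

Lemma dense_seq : exists ds : nat -> E, forall x e, 0 < e -> exists n, `|x - ds n| < e.
Proof.
have [S cS dS] := Esep.
have S0 : S !=set0.
  by have [|x []] := dS setT _ openT; [exists 0|exists x].
move/pfcard_geP : cS => [S00|[g]]; first by move: S0; rewrite S00 => -[].
exists g => x e e0.
have [||y [xy Sy]] := dS (ball x e).
- by exists x; exact: ballxx.
- exact: ball_open.
have : (g @` setT) y by rewrite (image_eq g).
move=> [n _ gn].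
by exists n; rewrite gn; move: xy; rewrite -ball_normE.
Qed.

Lemma measurable_boolP (p : T -> bool) :
  measurable_fun D p -> measurable (D `&` [set s | p s]).
Proof. by move=> /(_ mD [set true]); exact. Qed.

(** The least admissible index is measurable, its level sets being differences of the given sets.
    Where no index exists, which can happen outside [D] only, it is set to 0. *)
Lemma first_index (P : nat -> T -> bool) :
  (forall k, measurable (D `&` [set s | P k s])) ->
  (forall s, D s -> exists k, P k s) ->
  exists idx : T -> nat, (forall s, D s -> P (idx s) s) /\
    forall k, measurable (D `&` idx @^-1` [set k]).
Proof.
move=> mP exP.
pose idx s := if pselect (exists k, P k s) is left h then ex_minn h else 0%N.
have idxP s : D s -> P (idx s) s /\ forall j, P j s -> (idx s <= j)%N.
  move=> Ds; rewrite /idx; case: pselect => [h|/(_ (exP s Ds))//].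
  by case: ex_minnP => m Pm mmin.
exists idx; split=> [s /idxP[]//|k].
rewrite (_ : _ `&` _ = (D `&` [set s | P k s]) `\`
    \bigcup_(j < k) (D `&` [set s | P j s])).
  by apply: measurableD => //; exact: bigcup_measurable.
apply/seteqP; split => s /=.
  move=> [Ds <-]; have [Pi Pm] := idxP s Ds; split=> // -[j /= ji [_ Pj]].
  by have := Pm j Pj; rewrite leqNgt ji.
move=> [[Ds Pk] nP]; have [Pi Pm] := idxP s Ds; split=> //.
apply/eqP; rewrite eqn_leq Pm//= leqNgt; apply/negP => ik.
by apply: nP; exists (idx s).
Qed.

Lemma measurable_glue (idx : T -> nat) (g : nat -> T -> R) :
  (forall k, measurable (D `&` idx @^-1` [set k])) ->
  (forall k, measurable_fun D (g k)) -> measurable_fun D (fun s => g (idx s) s).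
Proof.
move=> mi mg _ B mB.
rewrite (_ : _ `&` _ = \bigcup_k ((D `&` idx @^-1` [set k]) `&` (D `&` g k @^-1` B))).
  by apply: bigcupT_measurable => k; apply: measurableI => //; exact: mg.
apply/seteqP; split => s /=; first by move=> [Ds gB]; exists (idx s).
by move=> [k _ [[Ds <-] [_ gB]]].
Qed.

Lemma smeas_glue (idx : T -> nat) (g : nat -> T -> E) :
  (forall k, measurable (D `&` idx @^-1` [set k])) ->
  (forall k, smeas (g k)) -> smeas (fun s => g (idx s) s).
Proof.
by move=> mi mg; split=> c; apply: (measurable_glue (g := fun k s => `|g k s - c|)) => // k;
  exact: smeas_dist.
Qed.

Lemma smeas_cst (c : E) : smeas (fun=> c).
Proof. by split=> c'; exact: measurable_cst. Qed.

Lemma smeas_cvg (u : nat -> T -> E) f : (forall n, smeas (u n)) ->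
  (forall s, D s -> u n s @[n --> \oo] --> f s) -> smeas f.
Proof.
move=> mu uf; split=> c; apply: (measurable_fun_cvg (h := fun n s => `|u n s - c|)).
  by move=> n; exact: smeas_dist.
by move=> s Ds; apply: cvg_norm; apply: cvgB; [exact: uf|exact: cvg_cst].
Qed.

Lemma smeas_approx f (e : T -> R) : smeas f -> measurable_fun D e ->
  (forall s, D s -> 0 < e s) ->
  exists idx : T -> nat, exists ds : nat -> E,
  (forall k, measurable (D `&` idx @^-1` [set k])) /\
  forall s, D s -> `|f s - ds (idx s)| < e s.
Proof.
move=> mf me e0; have [ds dsP] := dense_seq.
have [||idx [h1 h2]] := @first_index (fun k s => `|f s - ds k| < e s).
- by move=> k; apply: measurable_boolP; apply: measurable_fun_ltr => //; exact: smeas_dist.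
- by move=> s Ds; exact/dsP/e0.
by exists idx, ds.
Qed.

(** Along countably valued approximations of [f] the composite is measurable by gluing, and
    continuity of [F s] passes this to the limit. Sums and multiples of measurable functions, and
    the compositions with [L] and [Gamma], rest on it. *)
Lemma caratheodory (F : T -> E -> R) f : (forall c, measurable_fun D (F ^~ c)) ->
  (forall s, D s -> continuous (F s)) -> smeas f ->
  measurable_fun D (fun s => F s (f s)).
Proof.
move=> mF cF mf.
pose e (n : nat) := n.+1%:R^-1 : R.
have ap n : exists g : T -> E, measurable_fun D (fun s => F s (g s)) /\
    forall s, D s -> `|f s - g s| < e n.
  have [|idx [ds [mi ids]]] := @smeas_approx f (fun=> e n) mf (measurable_cst _).
    by move=> s _; rewrite invr_gt0.
  exists (fun s => ds (idx s)); split=> //.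
  exact: (measurable_glue (g := fun k s => F s (ds k))).
pose g n := projT1 (cid (ap n)).
have gP n : measurable_fun D (fun s => F s (g n s)) /\
    forall s, D s -> `|f s - g n s| < e n by rewrite /g; case: cid.
apply: (measurable_fun_cvg (h := fun n s => F s (g n s))).
  by move=> n; have [] := gP n.
move=> s Ds; apply: continuous_cvg; first exact: cF.
apply/cvgrPdist_lt => r r0; near=> n.
have [_ /(_ s Ds)/lt_trans] := gP n; apply.
by near: n; exact: (near_infty_natSinv_lt (PosNum r0)).
Unshelve. all: by end_near. Qed.

Lemma smeasD f g : smeas f -> smeas g -> smeas (fun s => f s + g s).
Proof.
move=> mf mg; split=> c.
apply: (@caratheodory (fun s x => `|f s + x - c|) g) => //.
  move=> c'; rewrite (_ : (fun _ => _) = fun s => `|f s - (c - c')|); first exact: smeas_dist.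
  by apply/funext => s; congr (`|_|); rewrite opprB addrA.
move=> s _ x; apply: cvg_norm; apply: cvgB; last exact: cvg_cst.
by apply: cvgD; [exact: cvg_cst|exact: cvg_id].
Qed.

Lemma smeasZ (a : T -> R) f : measurable_fun D a -> smeas f -> smeas (fun s => a s *: f s).
Proof.
move=> ma mf; split=> c.
apply: (@caratheodory (fun s x => `|a s *: x - c|) f) => //; last first.
  move=> s _ x; apply: cvg_norm; apply: cvgB; last exact: cvg_cst.
  by apply: cvgZ; [exact: cvg_cst|exact: cvg_id].
move=> x.
have ca : continuous (fun r : R => `|r *: x - c|).
  move=> r; apply: cvg_norm; apply: cvgB; last exact: cvg_cst.
  by apply: cvgZ; [exact: cvg_id|exact: cvg_cst].
exact: (measurableT_comp (continuous_measurable_fun ca) ma).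
Qed.

Lemma smeasB f g : smeas f -> smeas g -> smeas (fun s => f s - g s).
Proof.
move=> mf mg; apply: smeasD => //.
rewrite (_ : (fun s => - g s) = (fun s => (-1 : R) *: g s)).
  by apply: smeasZ => //; exact: measurable_cst.
by apply/funext => s; rewrite scaleN1r.
Qed.

Lemma smeas_norm f : smeas f -> measurable_fun D (fun s => `|f s|).
Proof.
by move=> /smeas_dist/(_ 0); congr (measurable_fun _ _); apply/funext => s; rewrite subr0.
Qed.

Lemma smeas_dual f (q : dual E) : smeas f -> measurable_fun D (fun s => q (f s) : R).
Proof.
move=> mf; apply: (@caratheodory (fun=> q) f) => // s _.
exact: dual_continuous.
Qed.

(** Takes the first point of a dense sequence that is [b]-close to [M s] and [r]-close to [u s]. One
    exists near any point of [M s] at distance less than [r s] from [u s]. *)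
Lemma near_selection_step (M : T -> set E) (u : T -> E) (r b : T -> R) :
  (forall s, D s -> M s !=set0) ->
  (forall c, measurable_fun D (fun s => dist_to (M s) c)) -> smeas u ->
  measurable_fun D r -> measurable_fun D b -> (forall s, D s -> 0 < b s) ->
  (forall s, D s -> dist_to (M s) (u s) < r s) ->
  exists u' : T -> E, smeas u' /\ forall s, D s ->
    dist_to (M s) (u' s) < b s /\ `|u' s - u s| < r s.
Proof.
move=> M0 mM mu mr mb b0 ur; have [ds dsP] := dense_seq.
have [||idx [iP mi]] := @first_index (fun k s =>
    (dist_to (M s) (ds k) < b s) && (`|u s - ds k| < r s)).
- move=> k; apply: measurable_boolP; apply: measurable_and.
    exact: measurable_fun_ltr.
  by apply: measurable_fun_ltr => //; exact: smeas_dist.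
- move=> s Ds; have [m Mm um] := dist_ltP (M0 s Ds) (ur s Ds).
  have [|k mk] := dsP m (Num.min (b s) (r s - `|u s - m|)).
    by rewrite lt_min b0//= subr_gt0.
  move: mk; rewrite lt_min => /andP[k1 k2]; exists k; apply/andP; split.
    by apply: le_lt_trans (dist_le _ Mm) _; rewrite distrC.
  rewrite ltrBrDl in k2; apply: le_lt_trans k2.
  by rewrite ler_distD.
exists (fun s => ds (idx s)); split.
  exact: (smeas_glue (g := fun k _ => ds k) mi (fun k => smeas_cst _)).
by move=> s Ds; have /andP[h1 h2] := iP s Ds; rewrite distrC.
Qed.

(** The Kuratowski-Ryll-Nardzewski construction, started at [w] so that the selection is almost a
    nearest point of [M s] to [w s]. *)
Lemma measurable_selection (M : T -> set E) (w : T -> E) (eta : T -> R) :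
  (forall s, D s -> M s !=set0) -> (forall s, D s -> closed (M s)) ->
  (forall c, measurable_fun D (fun s => dist_to (M s) c)) ->
  smeas w -> measurable_fun D eta -> (forall s, D s -> 0 < eta s) ->
  exists2 v : T -> E, smeas v & forall s, D s ->
    M s (v s) /\ `|v s - w s| <= dist_to (M s) (w s) + eta s.
Proof.
move=> M0 cM mM mw meta eta0.
(* Tolerances [eta / 4], [eta / 8] and so on: the first jump costs the distance plus [eta / 4], and
   the later ones sum to at most [eta / 2]. *)
pose e (n : nat) s := eta s * 2^-1 ^+ n.+2.
have e0 n s : D s -> 0 < e n s by move=> Ds; rewrite mulr_gt0 ?eta0// exprn_gt0// invr_gt0.
have me n : measurable_fun D (e n) by apply: measurable_funM => //; exact: measurable_cst.
have mdw : measurable_fun D (fun s => dist_to (M s) (w s)).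
  apply: (@caratheodory (fun s => dist_to (M s))) => // s Ds x.
  apply/cvgrPdist_le => r r0; near=> y.
  have xy : `|x - y| <= r by near: y; have /cvgrPdist_le := @cvg_id E (nbhs x); apply.
  have := dist_lip x y (M0 s Ds); have := dist_lip y x (M0 s Ds).
  by rewrite (distrC y x) ler_norml => h1 h2; apply/andP; split; lra.
pose Q n (u : T -> E) := smeas u /\ forall s, D s -> dist_to (M s) (u s) < e n s.
have init : exists u : T -> E, Q 0%N u /\
    forall s, D s -> `|u s - w s| <= dist_to (M s) (w s) + e 0%N s.
  have [||||u [mu uP]] := @near_selection_step M w
    (fun s => dist_to (M s) (w s) + e 0%N s) (e 0%N) M0 mM mw.
  - exact: measurable_funD.
  - exact: me.
  - by move=> s; exact: e0.
  - by move=> s Ds; rewrite ltrDl e0.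
  by exists u; split; [split=> // s /uP[]|move=> s /uP[_ /ltW]].
have step n (u : {u | Q n u}) : exists u', Q n.+1 u' /\
    forall s, D s -> `|u' s - sval u s| <= e n s.
  case: u => u [mu uP] /=.
  have [||||u' [mu' u'P]] := @near_selection_step M u (e n) (e n.+1) M0 mM mu.
  - exact: me.
  - exact: me.
  - by move=> s; exact: e0.
  - exact: uP.
  by exists u'; split; [split=> // s /u'P[]|move=> s /u'P[_ /ltW]].
have [u0 [Qu0 u0w]] := cid init.
pose nxt n (u : {u | Q n u}) : {u | Q n.+1 u} :=
  exist _ (projT1 (cid (step n u))) (projT2 (cid (step n u))).1.
pose U := fix U n : {u | Q n u} :=
  if n is m.+1 then nxt m (U m) else exist _ u0 Qu0.
(* Shifted by one: [w] comes first, although it need not satisfy [Q], so that the bound on the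
   increments includes the first jump. *)
pose u n := if n is m.+1 then sval (U m) else w.
have u1 n s : D s -> `|u n.+2 s - u n.+1 s| <= e n s.
  exact: (projT2 (cid (step n (U n)))).2.
have sumu s n : D s -> \sum_(0 <= k < n) `|u k.+1 s - u k s| <=
    dist_to (M s) (w s) + eta s.
  move=> Ds.
  suff H m : \sum_(0 <= k < m.+1) `|u k.+1 s - u k s| <=
      dist_to (M s) (w s) + 3 * e 0%N s - 2 * e m s.
    case: n => [|n].
      by rewrite big_nil addr_ge0 ?(dist_ge0 _ (M0 s Ds))// (ltW (eta0 s Ds)).
    apply: le_trans (H n) _; have := e0 n s Ds; have := eta0 s Ds.
    by rewrite {2}/e expr2; lra.
  elim: m => [|m IH].
    by rewrite big_nat1; apply: le_trans (u0w s Ds) _; lra.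
  rewrite big_nat_recr//=; apply: le_trans (lerD IH (u1 m s Ds)) _.
  rewrite (_ : e m.+1 s = e m s / 2); first lra.
  by rewrite /e exprS mulrCA mulrC mulrA.
have lim s : exists l, D s -> u n s @[n --> \oo] --> l /\
    `|l - w s| <= dist_to (M s) (w s) + eta s.
  have [Ds|nDs] := pselect (D s); last by exists 0.
  by have [l h1 h2] := cvg_increments (fun n => sumu s n Ds); exists l.
pose v s := projT1 (cid (lim s)).
have vP s : D s -> u n s @[n --> \oo] --> v s /\
    `|v s - w s| <= dist_to (M s) (w s) + eta s by rewrite /v; case: cid.
exists v.
  apply: (@smeas_cvg u); last by move=> s /vP[].
  by case=> [|n] //=; exact: (proj1 (svalP (U n))).
move=> s Ds; have [uv vw] := vP s Ds; split=> //.
apply: dist0_closed; [exact: cM|exact: M0|].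
apply/ler_addgt0Pr => r r0; rewrite add0r.
have [n1 n1v] : exists n, `|v s - u n.+1 s| <= r / 2 /\ e n s <= r / 2.
  have r2 : 0 < r / 2 by rewrite divr_gt0.
  have c1 : u n.+1 s @[n --> \oo] --> v s by rewrite (cvg_shiftS (fun n => u n s)).
  have c2 : e n s @[n --> \oo] --> 0.
    have c3 : (2^-1 : R) ^+ n @[n --> \oo] --> (0 : R).
      by apply: cvg_expr; rewrite ger0_norm ?invr_ge0// invf_lt1// ltr1n.
    have c4 : (2^-1 : R) ^+ n.+2 @[n --> \oo] --> (0 : R).
      by move: c3; rewrite -(cvg_shiftS (fun n => (2^-1 : R) ^+ n)) -(cvg_shiftS (fun n => (2^-1 : R) ^+ n.+1)).
    by rewrite -(mulr0 (eta s)); apply: cvgM; [exact: cvg_cst|exact: c4].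
  near \oo => n; exists n; split.
    by near: n; move/cvgrPdist_le : c1; exact.
  rewrite (le_trans (ler_norm _))// -normrN -sub0r; near: n.
  by move/cvgrPdist_le : c2; exact.
have := dist_lip (v s) (u n1.+1 s) (M0 s Ds).
have := proj2 (svalP (U n1)) s Ds; rewrite -/(u n1.+1 s) => h1.
by case: n1v => h2 h3 h4; move: h1 h2 h3 h4 => /=; lra.
Unshelve. all: by end_near. Qed.

End StrongMeasurability.

(** * Bochner integrals *)

Section BochnerDuality.
Context {R : realType} {E : completeNormedModType R}.
Hypothesis Esep : separable E.
Local Notation mu := (@completed_lebesgue_measure R).
Local Notation T := (lebesgue_type R).
Local Notation Lint D f := (mu.-integrable (D : set T) (EFin \o (f : R -> R))).
Variable D : set R.
Hypothesis mD : measurable (D : set T).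
Hypothesis muD : (mu D < +oo)%E.
Local Notation smeasD_ f := (@smeas _ T R E D f).
Local Notation cmu := (@clm_complete R).

Lemma Rint_sum (I : Type) (l : seq I) (f : I -> R -> R) :
  (forall i, Lint D (f i)) -> Lint D (fun s => \sum_(i <- l) f i s) /\
  \int[mu]_(s in D) (\sum_(i <- l) f i s) = \sum_(i <- l) \int[mu]_(s in D) f i s.
Proof.
move=> lf; elim: l => [|i l [IH1 IH2]].
  rewrite big_nil; have E0 : (fun s : R => \sum_(i <- [::]) f i s) = fun=> 0.
    by apply/funext => s; rewrite big_nil.
  rewrite E0; split; first exact: integrable0.
  by rewrite /Rintegral integral0.
have E1 : (fun s => \sum_(j <- i :: l) f j s) = fun s => f i s + \sum_(j <- l) f j s.
  by apply/funext => s; rewrite big_cons.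
rewrite E1; split; first exact: lintD.
by rewrite RintegralD// IH2 big_cons.
Qed.

Lemma simple_on_comp (h : {fimfun R >-> E}) d' (U : measurableType d') (G : E -> U) :
  simple_on D h -> measurable_fun (D : set T) (G \o h).
Proof.
move=> sh _ B mB.
rewrite (_ : _ `&` _ = \bigcup_(y in range h `&` G @^-1` B) (D `&` h @^-1` [set y])).
  apply: fin_bigcup_measurable; first by apply: finite_setIl; exact: fimfunP.
  by move=> y _; have [] := sh y.
apply/seteqP; split => s /=.
  by move=> [Ds GB]; exists (h s) => //; split => //; exists s.
by move=> [y [_ yB] [Ds hy]]; split=> //; rewrite /preimage/= hy.
Qed.

Lemma simple_on_smeas (h : {fimfun R >-> E}) : simple_on D h -> smeasD_ h.
Proof. by move=> sh; split=> c; exact: (simple_on_comp (fun x => `|x - c|)). Qed.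

Lemma fimfun_bounded (h : {fimfun R >-> E}) : exists M, forall s, `|h s| <= M.
Proof.
have fr : finite_set (range h) by exact: fimfunP.
exists (\sum_(y <- finmap.enum_fset (fset_set (range h))) `|y|) => s.
have hs : h s \in finmap.enum_fset (fset_set (range h)) by rewrite in_fset_set// mem_set//; exists s.
by rewrite (big_rem _ hs)/= lerDl sumr_ge0.
Qed.

Lemma simple_on_lint (h : {fimfun R >-> E}) : simple_on D h -> Lint D (fun s => `|h s|).
Proof.
move=> sh; have [M hM] := fimfun_bounded h.
apply: (lint_le mD _ (lint_cst M mD muD)); first exact: (simple_on_comp (fun x => `|x|)).
by move=> s _; rewrite normr_id.
Qed.

(** [q (h s)] is the finite sum of [q y] times the indicators of the level sets, which is integrated
    term by term. *)
Lemma simple_integral_dual (h : {fimfun R >-> E}) (q : dual E) : simple_on D h ->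
  q (simple_integral D h) = \int[mu]_(s in D) q (h s).
Proof.
move=> sh; have fr : finite_set (range h) by exact: fimfunP.
have mh y : measurable (D `&` h @^-1` [set y] : set T) by have [] := sh y.
have lin y : Lint D (\1_(D `&` h @^-1` [set y])).
  apply: (lint_le mD _ (lint_cst 1 mD muD)); first exact: measurable_indic.
  by move=> s _; rewrite indicE; case: (_ \in _); rewrite ?normr1 ?normr0.
rewrite /simple_integral fsbig_finite//= linear_sum/=.
have [_ ] := @Rint_sum E (finmap.enum_fset (fset_set (range h)))
  (fun y s => q y * \1_(D `&` h @^-1` [set y]) s) (fun y => lintZ (q y) mD (lin y)).
rewrite (_ : \int[mu]_(s in D) q (h s) = \int[mu]_(s in D)
    (\sum_(y <- finmap.enum_fset (fset_set (range h))) q y * \1_(D `&` h @^-1` [set y]) s)); last first.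
  apply: eq_Rintegral => s /set_mem Ds.
  have hs : h s \in finmap.enum_fset (fset_set (range h)) by rewrite in_fset_set// mem_set//; exists s.
  rewrite (bigD1_seq _ hs)/=; last exact: finmap.fset_uniq.
  rewrite big1 ?addr0 => [|y yh]; rewrite indicE; last first.
    by rewrite memNset ?mulr0// => -[_ hy]; rewrite -hy eqxx in yh.
  by rewrite mem_set ?mulr1.
move=> ->; apply: eq_bigr => y _; rewrite linearZ/= RintegralZl//.
rewrite /GRing.scale/= mulrC; congr (_ * _); rewrite /Rintegral integral_indic//.
by congr fine; congr (mu _); rewrite setIAC setIid.
Qed.

Lemma dual_lint (f : R -> E) (q : dual E) : smeasD_ f -> Lint D (fun s => `|f s|) ->
  Lint D (fun s => q (f s)).
Proof.
move=> mf lf; apply: (lint_le mD _ (lintZ `|q| mD lf)).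
  exact: smeas_dual.
by move=> s _; exact: dual_le_norm.
Qed.

Lemma smeas_ae (f g : R -> E) : {ae mu, forall s, D s -> f s = g s} ->
  smeasD_ f -> smeasD_ g.
Proof.
move=> fg mf; split=> c; apply: (ae_meas cmu _ (smeas_dist mf c)).
by apply: filterS fg => s fg Ds; rewrite fg.
Qed.

Lemma smeas_lintB (f g : R -> E) : smeasD_ f -> smeasD_ g ->
  Lint D (fun s => `|f s|) -> Lint D (fun s => `|g s|) -> Lint D (fun s => `|f s - g s|).
Proof.
move=> mf mg lf lg; apply: (lint_le mD _ (lintD mD lf lg)).
  exact: (smeas_norm (smeasB Esep mD mf mg)).
by move=> s _; rewrite normr_id ler_normB.
Qed.

Lemma bochner_approx_cvg (f : R -> E) hn : smeasD_ f -> Lint D (fun s => `|f s|) ->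
  (forall n, simple_on D (hn n)) ->
  (\int[mu]_(s in D) `|f s - hn n s|%:E)%E @[n --> \oo] --> 0%E <->
  \int[mu]_(s in D) `|f s - hn n s| @[n --> \oo] --> 0.
Proof.
move=> mf lf sh.
have fn n : (\int[mu]_(s in D) `|f s - hn n s|%:E)%E \is a fin_num.
  apply: integrable_fin_num => //.
  exact: (smeas_lintB mf (simple_on_smeas (sh n)) lf (simple_on_lint (sh n))).
split=> [/fine_cvg//|h].
by apply/fine_cvgP; split; [exact: nearW|exact: h].
Qed.

Lemma bochner_integrableW (f : R -> E) : bochner_integrable D f ->
  smeasD_ f /\ Lint D (fun s => `|f s|).
Proof.
move=> [hn [sh aeh inth]].
have mf : smeasD_ f.
  split=> c; apply: (ae_cvg_meas cmu mD (f_ := fun n s => `|hn n s - c|)).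
    by move=> n; exact: smeas_dist (simple_on_smeas (sh n)) c.
  apply: filterS aeh => s hs Ds.
  by apply: cvg_norm; apply: cvgB; [exact: hs|exact: cvg_cst].
split=> //.
have /fine_cvgP[[n _ /(_ n (leqnn _)) fn] _] := inth.
have mfn : measurable_fun (D : set T) (fun s => `|f s - hn n s|).
  exact: (smeas_norm (smeasB Esep mD mf (simple_on_smeas (sh n)))).
have lfn : Lint D (fun s => `|f s - hn n s|).
  apply/integrableP; split; first exact/measurable_EFinP.
  under eq_integral do rewrite /= normr_id.
  by rewrite ltey_eq fn.
apply: (lint_le mD _ (lintD mD lfn (simple_on_lint (sh n)))); first exact: smeas_norm.
by move=> s _; rewrite normr_id -{1}[f s](subrK (hn n s)) ler_normD.
Qed.

Lemma norm_simple_integralB (f : R -> E) w (h : {fimfun R >-> E}) :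
  smeasD_ f -> Lint D (fun s => `|f s|) -> simple_on D h ->
  (forall q : dual E, q w = \int[mu]_(s in D) q (f s)) ->
  `|w - simple_integral D h| <= \int[mu]_(s in D) `|f s - h s|.
Proof.
move=> mf lf sh qw; apply: norm_le_dual => q q1.
have mh := simple_on_smeas sh; have lh := simple_on_lint sh.
rewrite linearB/= qw simple_integral_dual// -RintegralB//; try exact: dual_lint.
apply: le_Rintegral => //.
- by apply: lintB => //; exact: dual_lint.
- exact: smeas_lintB.
by move=> s _; rewrite -linearB/= (le_trans (ler_norm _)).
Qed.

(** Forwards, [q] is continuous and commutes with simple integrals. Backwards, a vector with the
    right pairings is within the integral of [|f - hn n|] of the simple integrals, by testing
    against functionals of norm at most 1. *)
Lemma is_bochner_integralP (f : R -> E) w : bochner_integrable D f ->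
  is_bochner_integral D f w <-> forall q : dual E, q w = \int[mu]_(s in D) q (f s).
Proof.
move=> bf; have [mf lf] := bochner_integrableW bf; split=> [[hn [sh _ inth] hw] q|qw].
  have /bochner_approx_cvg h0 := inth; have {h0} := h0 mf lf sh => h0.
  have h1 : q (simple_integral D (hn n)) @[n --> \oo] --> q w.
    by apply: continuous_cvg => //; exact: dual_continuous.
  apply/esym; apply: (@cvg_unique _ (@norm_hausdorff _ R) (q (simple_integral D (hn n)) @[n --> \oo])) => //.
  apply/cvgrPdist_le => e e0.
  have q1 : 0 < `|q| + 1 by rewrite ltr_wpDl.
  have /cvgrPdist_le/(_ _ (divr_gt0 e0 q1)) := h0; apply: filterS => n.
  rewrite sub0r normrN ger0_norm; last exact: Rintegral_ge0.
  have mh := simple_on_smeas (sh n); have lh := simple_on_lint (sh n).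
  rewrite ler_pdivlMr// => hle; apply: le_trans hle.
  rewrite simple_integral_dual// -RintegralB//; try exact: dual_lint.
  have lB : Lint D (fun s => q (f s) - q (hn n s)).
    by apply: lintB => //; exact: dual_lint.
  apply: le_trans (le_normr_Rintegral mD lB) _.
  rewrite -RintegralZr//; last exact: smeas_lintB.
  apply: le_Rintegral => //; first exact: lint_norm.
    have := lintZ (`|q| + 1) mD (smeas_lintB mf mh lf lh).
    by congr (_.-integrable _ _); apply/funext => s /=; rewrite mulrC.
  move=> s _; rewrite -linearB/= (le_trans (dual_le_norm _ _))// mulrC ler_wpM2l//.
  by rewrite lerDl.
have [hn hP] := bf; exists hn => //.
have [sh _ /bochner_approx_cvg inth] := hP; have {inth} := inth mf lf sh => inth.
apply/cvgrPdist_le => e e0.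
have /cvgrPdist_le/(_ _ e0) := inth; apply: filterS => n.
rewrite sub0r normrN ger0_norm; last exact: Rintegral_ge0.
by apply: le_trans; exact: norm_simple_integralB.
Qed.

(** The same test shows that the simple integrals are Cauchy, and completeness of [E] provides the
    limit. *)
Lemma bochner_integral_exists (f : R -> E) : bochner_integrable D f ->
  exists w : E, forall q : dual E, q w = \int[mu]_(s in D) q (f s).
Proof.
move=> bf; have [mf lf] := bochner_integrableW bf.
suff [w hw] : exists w, is_bochner_integral D f w by exists w; exact/is_bochner_integralP.
have [hn hP] := bf.
have [sh _ /bochner_approx_cvg inth] := hP; have {inth} := inth mf lf sh => inth.
suff : cvgn (fun n => simple_integral D (hn n)).
  by move=> /cvg_ex[w hw]; exists w; exists hn.
apply/cauchy_cvgP/cauchy_ballP => e e0.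
have /cvgrPdist_lt/(_ _ (divr_gt0 e0 (ltr0n R 2)))[N _ hN] := inth.
exists ([set simple_integral D (hn n) | n in [set n | (N <= n)%N]],
        [set simple_integral D (hn n) | n in [set n | (N <= n)%N]]).
  by split; exists N => // n Nn; exists n.
move=> [_ _] [/= [n Nn <-] [m Nm <-]]; rewrite -ball_normE/=.
have lt2 k : (N <= k)%N -> \int[mu]_(s in D) `|f s - hn k s| < e / 2.
  move=> /hN; rewrite /= sub0r normrN ger0_norm//; exact: Rintegral_ge0.
have mh k := simple_on_smeas (sh k); have lh k := simple_on_lint (sh k).
rewrite [e]splitr; apply: le_lt_trans (ltrD (lt2 n Nn) (lt2 m Nm)).
apply: norm_le_dual => q q1.
rewrite linearB/= !simple_integral_dual// -RintegralB//; try exact: dual_lint.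
rewrite -RintegralD//; try exact: smeas_lintB.
apply: le_Rintegral => //.
- by apply: lintB => //; exact: dual_lint.
- by apply: lintD => //; exact: smeas_lintB.
move=> s _; rewrite -linearB/= (le_trans (ler_norm _))// (le_trans (q1 _))//.
by rewrite (le_trans (ler_distD (f s) _ _))// (distrC (hn n s)).
Qed.

(* [hn n s] is the point of {0, ds 0, ..., ds (n-1)} that is nearest to [f s],
   so that |f - hn| decreases pointwise from |f| to 0. *)
Lemma bochner_integrableP (f : R -> E) : smeasD_ f -> Lint D (fun s => `|f s|) ->
  bochner_integrable D f.
Proof.
move=> mf lf; have [ds dsP] := dense_seq Esep.
pose h := fix h n : R -> E := if n is m.+1 then
  (fun s => if `|f s - ds m| < `|f s - h m s| then ds m else h m s) else fun=> 0.
have fh n : h n \in fimfun.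
  apply: (@mem_set _ [set f | finite_set (range f)]); elim: n => [|n IH].
    apply: (sub_finite_set (B := [set 0])); last exact: finite_set1.
    by move=> _ [s _ <-].
  apply: (sub_finite_set (B := [set ds n] `|` range (h n))).
    by move=> _ [s _ <-] /=; case: ifPn => _; [left|right; exists s].
  by rewrite finite_setU; split => //; exact: finite_set1.
(* Both properties are proved together: the next function changes its value exactly where [ds n] is
   strictly nearer, a set that is measurable because [h n] is. *)
have hm n : smeasD_ (h n) /\ forall y, measurable (D `&` h n @^-1` [set y] : set T).
  elim: n => [|n [IH1 IH2]].
    split; first exact: smeas_cst.
    move=> y; have [->|y0] := eqVneq y 0.
      by rewrite (_ : _ @^-1` _ = setT) ?setIT//; apply/seteqP; split.
    rewrite (_ : _ `&` _ = set0)//; apply/seteqP; split => // s [_ /= hy].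
    by rewrite -hy eqxx in y0.
  have mlt : measurable (D `&` [set s | `|f s - ds n| < `|f s - h n s|] : set T).
    have m1 : measurable_fun (D : set T) (fun s => `|f s - ds n|) := smeas_dist mf _.
    have m2 := smeas_norm (smeasB Esep mD mf IH1).
    exact: (measurable_boolP mD (measurable_fun_ltr m1 m2)).
  have mge : measurable (D `\` [set s | `|f s - ds n| < `|f s - h n s|] : set T).
    rewrite (_ : _ `\` _ = D `\` (D `&` [set s | `|f s - ds n| < `|f s - h n s|])).
      exact: measurableD.
    by rewrite setDIr setDv set0U.
  pose idx s := if `|f s - ds n| < `|f s - h n s| then 1%N else 0%N.
  have midx k : measurable (D `&` idx @^-1` [set k] : set T).
    case: k => [|[|k]].
    - congr measurable : mge; apply/seteqP; split => s [Ds /= hs]; split=> //.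
        by rewrite /idx; case: ifPn hs.
      by move: hs; rewrite /idx; case: ifPn.
    - congr measurable : mlt; apply/seteqP; split => s [Ds /= hs]; split=> //.
        by rewrite /idx hs.
      by move: hs; rewrite /idx; case: ifPn.
    - rewrite (_ : _ `&` _ = set0)//; apply/seteqP; split => // s [_ /=].
      by rewrite /idx; case: ifPn.
  split.
    rewrite (_ : h n.+1 = fun s => (fun k => if k is 1%N then fun=> ds n else h n) (idx s) s).
      apply: (smeas_glue mD (g := fun k => if k is 1%N then fun=> ds n else h n) midx).
      by case=> [|[|k]] //; exact: smeas_cst.
    by apply/funext => s; rewrite /idx /=; case: ifPn.
  move=> y; have -> : D `&` h n.+1 @^-1` [set y] =
      ((D `&` idx @^-1` [set 0%N]) `&` (D `&` h n @^-1` [set y])) `|`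
      ((D `&` idx @^-1` [set 1%N]) `&` [set s | ds n = y]).
    apply/seteqP; split => s /=.
      by rewrite /idx; case: ifPn => _ [Ds hy]; [right|left].
    by rewrite /idx; case: ifPn => _; [move=> [[[]]|[[]]]|move=> [[[_ _] []]|[[]]]].
  apply: measurableU; apply: measurableI => //.
  have [ny|ny] := pselect (ds n = y).
    by rewrite (_ : mkset _ = setT)//; apply/seteqP; split.
  by rewrite (_ : mkset _ = set0)//; apply/seteqP; split.
pose hn n : {fimfun R >-> E} := fimfun_Sub (fh n).
have sh n : simple_on D (hn n).
  move=> y; have [_ /(_ y) m] := hm n; split=> // _.
  by apply: le_lt_trans muD; apply: le_measure; [exact: mem_set|exact: mem_set|exact: subIsetl].
have hdec n s : `|f s - h n.+1 s| <= `|f s - h n s| /\ `|f s - h n.+1 s| <= `|f s - ds n|.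
  by rewrite /=; case: ltP => [/ltW|].
have hmono n m s : (n <= m)%N -> `|f s - h m s| <= `|f s - h n s|.
  move=> /subnK <-; elim: (m - n)%N => // k IH.
  by rewrite addSn (le_trans (hdec _ _).1).
have hcvg s : h n s @[n --> \oo] --> f s.
  apply/cvgrPdist_lt => e e0; have [k fk] := dsP (f s) e e0.
  exists k.+1 => // n /= kn.
  by rewrite (le_lt_trans (hmono _ _ _ kn))// (le_lt_trans (hdec _ _).2).
exists hn; split=> //; first by apply: aeW => s _; exact: hcvg.
apply/bochner_approx_cvg => //.
have [|||||_] := @lint_dominated _ T R mu cmu D (fun n s => `|f s - h n s|) (fun=> 0)
  (fun s => `|f s|).
- exact: mD.
- by move=> n; exact: (smeas_norm (smeasB Esep mD mf (proj1 (hm n)))).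
- apply: aeW => s _; rewrite -(@normr0 R E) -(subrr (f s)).
  by apply: cvg_norm; apply: cvgB; [exact: cvg_cst|exact: hcvg].
- exact: lf.
- by apply: aeW => s _ n; rewrite normr_id (le_trans (hmono 0%N n s _))// subr0.
by rewrite {2}/Rintegral integral0.
Qed.

Lemma bochner_integrable_ae (f g : R -> E) : {ae mu, forall s, D s -> f s = g s} ->
  bochner_integrable D f -> bochner_integrable D g.
Proof.
move=> fg /bochner_integrableW[mf lf]; apply: bochner_integrableP.
  exact: smeas_ae fg mf.
by apply: (ae_lint cmu mD _ lf); apply: filterS fg => s fg Ds; rewrite fg.
Qed.

End BochnerDuality.

(** * Trajectories *)

Lemma max_dist_le (R : realDomainType) (t r s : R) :
  `|Num.max t r - Num.max t s| <= `|r - s|.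
Proof.
by rewrite /Num.max; case: ltP => h1; case: ltP => h2; rewrite ?subrr ?normr0//;
  rewrite !ler_norml; apply/andP; split; have := ler_norm (r - s);
  have := ler_norm (s - r); rewrite (distrC s r); lra.
Qed.

Section Trajectories.
Context {R : realType} {E : completeNormedModType R}.
Hypothesis Esep : separable E.
Local Notation mu := (@completed_lebesgue_measure R).
Local Notation T := (lebesgue_type R).
Local Notation Lint D f := (mu.-integrable (D : set T) (EFin \o (f : R -> R))).
Local Notation smeasD D f := (@smeas _ T R E D f).
Implicit Types (t : R) (x v : R -> E).

Lemma smeasS (A D : set R) (f : R -> E) : measurable (D : set T) -> A `<=` D ->
  smeasD D f -> smeasD A f.
Proof.
by move=> mD AD mf; split=> c; exact: measurable_funS (smeas_dist mf c).
Qed.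

(* v is the velocity of x on [t, +oo[; the integral formula is tested against
   the dual, which determines vectors by Hahn-Banach. *)
Record velocity t x v : Prop := Velocity {
  vel_meas : smeasD `[t, +oo[ v;
  vel_int : forall s, t <= s -> Lint `[t, s] (fun r => `|v r|);
  vel_ftc : forall s (q : dual E), t <= s -> q (x s - x t) = \I_[t, s] (fun r => q (v r)) }.

Lemma itvcc_itvcy (t r s : R) : t <= r -> `[r, s]%classic `<=` `[t, +oo[.
Proof.
by move=> tr u /=; rewrite !in_itv/= => /andP[ru _]; rewrite (le_trans tr ru).
Qed.

Section Velocity.
Variables (t : R) (x v : R -> E).
Hypothesis hv : velocity t x v.

Lemma vel_meas_itv r s : t <= r -> smeasD `[r, s] v.
Proof.
move=> tr; apply: (smeasS (D := `[t, +oo[)); last exact: vel_meas hv.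
  exact: lebesgue_itv.
exact: itvcc_itvcy.
Qed.

Lemma vel_int_itv r s : t <= r -> Lint `[r, s] (fun u => `|v u|).
Proof.
move=> tr; have [rs|sr] := leP r s; last first.
  rewrite set_itv_ge ?bnd_simp -?ltNge//; exact: integrable_set0.
by apply: lint_itvS (vel_int hv (le_trans tr rs)).
Qed.

Lemma vel_dual_int r s (q : dual E) : t <= r -> Lint `[r, s] (fun u => q (v u)).
Proof.
move=> tr; apply: dual_lint; [exact: Esep|exact: lebesgue_itv|exact: vel_meas_itv|
  exact: vel_int_itv].
Qed.

Lemma vel_dual r s (q : dual E) : t <= r -> r <= s ->
  q (x s - x r) = \I_[r, s] (fun u => q (v u)).
Proof.
move=> tr rs; have ts := le_trans tr rs.
have := Rint_cat tr rs (vel_dual_int s q (lexx t)).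
rewrite -(vel_ftc hv q tr) -(vel_ftc hv q ts) !linearB/=; lra.
Qed.

Lemma vel_norm r s : t <= r -> r <= s -> `|x s - x r| <= \I_[r, s] (fun u => `|v u|).
Proof.
move=> tr rs; apply: norm_le_dual => q q1; rewrite vel_dual//.
apply: le_Rint_itv; [exact: vel_dual_int|exact: vel_int_itv|].
by move=> u _ _; rewrite (le_trans (ler_norm _)).
Qed.

Lemma vel_modulus S e : t <= S -> 0 < e -> exists2 dl, 0 < dl &
  forall r s, t <= r -> r <= s -> s <= S -> s - r < dl -> `|x s - x r| < e.
Proof.
move=> tS e0; have [dl dl0 h] := Rint_itv_small (vel_int hv tS) e0.
exists dl => // r s tr rs sS srd; apply: le_lt_trans (vel_norm tr rs) _.
have := h r s tr rs sS srd; congr (_ < _); apply: eq_Rintegral => u _.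
by rewrite normr_id.
Qed.

(** [x] is arbitrary before [t]; clamping time at [t] gives a continuous total function, from which
    measurability of [x] follows. *)
Lemma vel_extend_continuous : continuous (fun s => x (Num.max t s)).
Proof.
move=> s; apply/cvgrPdist_lt => e e0.
have tS : t <= Num.max t s + 1 by rewrite ler_wpDr// le_max lexx.
have [dl dl0 h] := vel_modulus tS e0.
near=> r.
have rs : `|r - s| < Num.min dl 1.
  near: r; have /cvgrPdist_lt/(_ (Num.min dl 1)) := @cvg_id _ (nbhs s).
  by rewrite lt_min dl0 ltr01 => /(_ isT); apply: filterS => r; rewrite distrC.
have tm u : t <= Num.max t u by rewrite le_max lexx.
have lip := max_dist_le t r s.
move: rs; rewrite lt_min => /andP[rsd rs1].
have [mm|mm] := leP (Num.max t r) (Num.max t s).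
  apply: h => //; first by rewrite ler_wpDr.
  apply: le_lt_trans rsd; apply: le_trans lip.
  by rewrite distrC ler_norm.
rewrite distrC; apply: h => //; first exact: ltW.
  have := ler_norm (Num.max t r - Num.max t s); lra.
by apply: le_lt_trans rsd; apply: le_trans lip; rewrite ler_norm.
Unshelve. all: by end_near. Qed.

Lemma vel_traj_meas : smeasD `[t, +oo[ x.
Proof.
split=> c; have mt : measurable (`[t, +oo[%classic : set T) by exact: lebesgue_itv.
have cc : continuous (fun s => `|x (Num.max t s) - c|).
  move=> s; apply: cvg_norm; apply: cvgB; last exact: cvg_cst.
  exact: vel_extend_continuous.
have := continuous_lebesgue (D := `[t, +oo[%classic) cc; apply: eq_measurable_fun.
by move=> s /set_mem /=; rewrite in_itv/= andbT => ts; rewrite (max_idPr ts).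
Qed.

Lemma vel_traj_int r s : t <= r -> Lint `[r, s] (fun u => `|x u|).
Proof.
move=> tr; have [rs|sr] := leP r s; last first.
  rewrite set_itv_ge ?bnd_simp -?ltNge//; exact: integrable_set0.
have mi : measurable (`[r, s]%classic : set T) by exact: lebesgue_itv.
apply: (lint_le mi _ (lint_itv_cst r s (`|x r| + \I_[r, s] (fun u => `|v u|)))).
  apply: smeas_norm; apply: smeasS vel_traj_meas; first exact: lebesgue_itv.
  exact: itvcc_itvcy.
move=> u /=; rewrite in_itv/= => /andP[ru us]; rewrite normr_id.
rewrite -[x u](subrK (x r)) addrC (le_trans (ler_normD _ _))// lerD2l.
apply: le_trans (vel_norm tr ru) _.
by apply: le_Rint_itvS => //; exact: vel_int_itv.
Qed.

End Velocity.

Definition strong_derivative_at t x v s := forall e, 0 < e -> exists2 dl, 0 < dl &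
  forall a b, t <= a -> a <= s -> s <= b -> b - a < dl ->
    `|x b - x a - (b - a) *: v s| <= e * (b - a).

(* At a common Lebesgue point of the functions |v - c|, c in a dense sequence. *)
Lemma vel_strong_derivative t x v : velocity t x v ->
  {ae mu, forall s, t <= s -> strong_derivative_at t x v s}.
Proof.
move=> hv; have [ds dsP] := dense_seq Esep.
have lvB (r s : R) c : t <= r -> Lint `[r, s] (fun u => `|v u - c|).
  move=> tr; have mi : measurable (`[r, s]%classic : set T) by exact: lebesgue_itv.
  apply: (lint_le mi _ (lintD mi (vel_int_itv hv s tr) (lint_itv_cst r s `|c|))).
    exact: (smeas_dist (vel_meas_itv hv s tr) c).
  by move=> u _; rewrite normr_id ler_normB.
have lp k : {ae mu, forall s, t <= s -> lpoint t (fun u => `|v u - ds k|) s}.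
  exact: (lpoint_ae (fun n => lvB t n%:R (ds k) (lexx t))).
apply: filterS (ae_foralln lp) => s hs ts e e0.
(* [|v u - v s|] exceeds [|v u - ds k| - |v s - ds k|] by at most twice [|v s - ds k|]: hence
   [e / 4] here and [e / 2] for the Lebesgue point. *)
have [k vk] := dsP (v s) (e / 4) (divr_gt0 e0 (ltr0n R 4)).
have [dl dl0 hdl] := hs k ts (e / 2) (divr_gt0 e0 (ltr0n R 2)).
exists dl => // a b ta as_ sb bad; have ab := le_trans as_ sb.
have lq (q : dual E) := vel_dual_int hv b q ta.
have lk := lvB a b (ds k) ta; have ls := lvB a b (v s) ta.
apply: (@le_trans _ _ (\I_[a, b] (fun u => `|v u - v s|))).
  apply: norm_le_dual => q q1; rewrite linearB/= linearZ/= (vel_dual hv)//.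
  rewrite /GRing.scale/= mulrC -Rint_itv_cst//.
  rewrite -(RintegralB (lebesgue_itv _) (lq q) (lint_itv_cst _ _ _)).
  apply: le_Rint_itv => //.
    by apply: lintB; [exact: lebesgue_itv|exact: lq|exact: lint_itv_cst].
  by move=> u _ _; rewrite -linearB/= (le_trans (ler_norm _)).
have := hdl a b ta as_ sb bad => h.
have lB : Lint `[a, b] (fun u => `| `|v u - ds k| - `|v s - ds k| |).
  apply: lint_norm; first exact: lebesgue_itv.
  by apply: lintB; [exact: lebesgue_itv|exact: lk|exact: lint_itv_cst].
apply: (@le_trans _ _ (\I_[a, b] (fun u => `| `|v u - ds k| - `|v s - ds k| | + e / 2))).
  apply: le_Rint_itv => //.
    by apply: lintD; [exact: lebesgue_itv|exact: lB|exact: lint_itv_cst].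
  move=> u _ _; have := ler_distD (ds k) (v u) (v s); rewrite (distrC (ds k)).
  by have := ler_norm (`|v u - ds k| - `|v s - ds k|); lra.
rewrite (RintegralD (lebesgue_itv _) lB (lint_itv_cst _ _ _)) Rint_itv_cst//.
by clear -h; lra.
Qed.

Lemma strong_derivative_derive1 t x v s : t < s -> strong_derivative_at t x v s ->
  derivable x s 1 /\ derive1 x s = v s.
Proof.
move=> ts hs.
have h : h^-1 *: (x (h + s) - x s) @[h --> 0^'] --> v s.
  apply/cvgrPdist_le => e e0; have [dl dl0 hdl] := hs e e0.
  have m0 : 0 < Num.min dl (s - t) by rewrite lt_min dl0 subr_gt0.
  near=> h.
  have h0 : h != 0 by near: h; exact: nbhs_dnbhs_neq.
  have hd : `|h| < Num.min dl (s - t) by near: h; exact: dnbhs0_lt.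
  move: hd; rewrite lt_min => /andP[hd1 hd2].
  suff : `|x (h + s) - x s - h *: v s| <= e * `|h|.
    rewrite -ler_pdivrMr ?normr_gt0// -normfV mulrC -normrZ scalerBr scalerA.
    by rewrite mulVf// scale1r distrC.
  have [hp|hn] := ltP 0 h.
    have hE := gtr0_norm hp; rewrite hE in hd1 hd2 *.
    have := hdl s (h + s); rewrite addrK; apply => //; lra.
  have hn' : h < 0 by rewrite lt_neqAle h0.
  have hE := ltr0_norm hn'; rewrite hE in hd1 hd2 *.
  have sE : s - (h + s) = - h by rewrite opprD addrCA subrr addr0.
  have := hdl (h + s) s; rewrite sE scaleNr opprK.
  have -> : x s - x (h + s) + h *: v s = - (x (h + s) - x s - h *: v s).
    by rewrite !opprB addrC.
  rewrite normrN; apply => //; lra.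
split; last exact: (cvg_lim (@norm_hausdorff _ _)).
rewrite /derivable; apply/cvg_ex; exists (v s).
apply: cvg_trans h; apply: near_eq_cvg; apply: nearW => h /=.
by rewrite /GRing.scale/= mulr1.
Unshelve. all: by end_near. Qed.

(** With its converse [W11_velocity], this allows trajectories to be handled through an explicit
    velocity, which agrees with [derive1 x] almost everywhere. *)
Lemma velocity_W11 t x v : velocity t x v ->
  W11loc t x /\ {ae mu, forall s, t <= s -> derive1 x s = v s}.
Proof.
move=> hv.
have aeD : {ae mu, forall s, t <= s -> derivable x s 1 /\ derive1 x s = v s}.
  apply: filterS2 (vel_strong_derivative hv) (ae_neq t) => s hs st ts.
  apply: (strong_derivative_derive1 (t := t)); last exact: hs.
  by rewrite lt_neqAle ts andbT; apply/eqP => ts'; apply: st.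
have ae' : {ae mu, forall s, t <= s -> derive1 x s = v s}.
  by apply: filterS aeD => s h /h[].
split=> //.
have mi r : measurable (`[t, r]%classic : set T) by exact: lebesgue_itv.
have ae_itv r : {ae mu, forall s, `[t, r]%classic s -> v s = derive1 x s}.
  by apply: filterS ae' => s h /=; rewrite in_itv/= => /andP[/h->].
have bd r : t <= r -> bochner_integrable `[t, r] (derive1 x).
  move=> tr; apply: (bochner_integrable_ae Esep (mi r) (clm_itv_fin _ _) (ae_itv r)).
  apply: (bochner_integrableP Esep (mi r) (clm_itv_fin _ _)).
    exact: vel_meas_itv hv _ _ (lexx t).
  exact: vel_int_itv hv _ _ (lexx t).
split=> //.
- move=> r tr; apply: (bochner_integrableP Esep (mi r) (clm_itv_fin _ _)).
    apply: smeasS (vel_traj_meas hv); first exact: lebesgue_itv.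
    exact: itvcc_itvcy.
  exact: (vel_traj_int hv _ (lexx t)).
- by apply: filterS aeD => s h /h[].
- move=> s ts; apply/(is_bochner_integralP Esep (mi s) (clm_itv_fin _ _)); first exact: bd.
  move=> q; rewrite (vel_ftc hv q ts).
  apply: (ae_Rint (@clm_complete R) (mi s)); last first.
    exact: lint_meas (vel_dual_int hv s q (lexx t)).
  by apply: filterS (ae_itv s) => r h tr; rewrite h.
Qed.

Lemma itv_exhaust_meas t (v : R -> E) : (forall s, t <= s -> smeasD `[t, s] v) ->
  smeasD `[t, +oo[ v.
Proof.
move=> mv; split=> c mD B mB.
rewrite (_ : _ `&` _ = \bigcup_n (`[t, t + n%:R] `&` (fun s => `|v s - c|) @^-1` B)).
  apply: bigcupT_measurable => n; apply: (smeas_dist (mv _ _) c) => //.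
    by rewrite lerDl.
  exact: lebesgue_itv.
apply/seteqP; split => s /=; rewrite in_itv/=.
  rewrite andbT => -[ts Bs]; exists (Num.truncn (s - t)).+1 => //; split => //.
  by rewrite /= in_itv/= ts/= -lerBlDl ltW// truncnS_gt.
by move=> [n _ [/=]]; rewrite in_itv/= => /andP[-> _].
Qed.

Lemma W11_velocity t x : W11loc t x -> velocity t x (derive1 x).
Proof.
move=> [_ _ bd ftc].
have mi r : measurable (`[t, r]%classic : set T) by exact: lebesgue_itv.
split.
- apply: itv_exhaust_meas => s ts.
  by have [] := bochner_integrableW Esep (mi s) (clm_itv_fin _ _) (bd s ts).
- move=> s ts.
  by have [] := bochner_integrableW Esep (mi s) (clm_itv_fin _ _) (bd s ts).
- move=> s q ts.
  exact: (is_bochner_integralP Esep (mi s) (clm_itv_fin _ _) _ (bd s ts)).1 (ftc s ts) q.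
Qed.

Lemma velocity_exists t a (v : R -> E) : smeasD `[t, +oo[ v ->
  (forall s, t <= s -> Lint `[t, s] (fun r => `|v r|)) ->
  exists2 x, x t = a & velocity t x v.
Proof.
move=> mv lv.
have mi r : measurable (`[t, r]%classic : set T) by exact: lebesgue_itv.
have ex s : exists w : E, t <= s -> forall q : dual E, q w = \I_[t, s] (fun r => q (v r)).
  have [ts|ts] := leP t s; last by exists 0.
  have [|w hw] := @bochner_integral_exists _ _ Esep _ (mi s) (clm_itv_fin _ _) v.
    apply: (bochner_integrableP Esep (mi s) (clm_itv_fin _ _)); last exact: lv.
    apply: smeasS mv; first exact: lebesgue_itv.
    exact: itvcc_itvcy.
  by exists w.
have [w hw] := choice ex.
have wt : w t = 0.
  apply/eqP; rewrite -normr_le0; apply: norm_le_dual => q _.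
  by rewrite hw// Rint_itv_pt.
exists (fun s => a + w s); first by rewrite wt addr0.
by split=> // s q ts; rewrite wt addr0 addrAC subrr add0r hw.
Qed.

Lemma velocity_ae t x v v' : {ae mu, forall s, t <= s -> v s = v' s} ->
  velocity t x v -> velocity t x v'.
Proof.
move=> vv' hv.
have aei s : {ae mu, forall r, `[t, s]%classic r -> v r = v' r}.
  by apply: filterS vv' => r h /=; rewrite in_itv/= => /andP[/h].
split.
- apply: smeas_ae (vel_meas hv); apply: filterS vv' => s h /=.
  by rewrite in_itv/= andbT.
- move=> s ts; apply: (ae_lint (@clm_complete R) (lebesgue_itv _) _ (vel_int hv ts)).
  by apply: filterS (aei s) => r h tr; rewrite h.
- move=> s q ts; rewrite (vel_ftc hv q ts).
  apply: (ae_Rint (@clm_complete R) (lebesgue_itv _)).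
    by apply: filterS (aei s) => r h tr; rewrite h.
  exact: lint_meas (vel_dual_int hv s q (lexx t)).
Qed.

Lemma velocity_restrict t r x v : t <= r -> velocity t x v -> velocity r x v.
Proof.
move=> tr hv; split.
- apply: smeasS (vel_meas hv); first exact: lebesgue_itv.
  by move=> s /=; rewrite !in_itv/= !andbT; exact: le_trans.
- by move=> s rs; exact: vel_int_itv hv _ _ tr.
- by move=> s q rs; exact: vel_dual hv _ _ _ tr rs.
Qed.

Lemma velocity_translate t x v a : velocity t x v -> velocity t (fun s => x s + a) v.
Proof.
move=> hv; split=> [||s q ts]; [exact: vel_meas hv|exact: vel_int hv|].
by rewrite opprD addrACA subrr addr0; exact: vel_ftc hv _ _ ts.
Qed.

Lemma velocity_concat t r x v y w : t <= r -> x r = y r ->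
  velocity t x v -> velocity r y w ->
  velocity t (fun s => if s <= r then x s else y s) (fun s => if s <= r then v s else w s).
Proof.
move=> tr xy hv hw; set z := fun s => _; set u := fun s => _.
have mi a b : measurable (`[a, b]%classic : set T) by exact: lebesgue_itv.
(* At [r] itself [u] takes the value of [v], which may differ from that of [w]; a single point is
   negligible. *)
have aeu : {ae mu, forall s, r <= s -> w s = u s}.
  apply: filterS (ae_neq r) => s sr rs; rewrite /u; case: ifPn => // sr'.
  by exfalso; apply: sr; apply/le_anti; rewrite rs sr'.
have uv s : s <= r -> u s = v s by rewrite /u => ->.
have hu : velocity r y u := velocity_ae aeu hw.
have lu s : t <= s -> Lint `[t, s] (fun p => `|u p|).
  move=> ts.
  have l1 b : b <= r -> Lint `[t, b] (fun p => `|u p|).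
    move=> br; apply: (@eq_integrable _ _ _ mu _ (mi t b) (EFin \o (fun p => `|v p|))).
      move=> p /set_mem /=; rewrite in_itv/= => /andP[_ pb].
      by rewrite uv// (le_trans pb).
    exact: vel_int_itv hv _ _ (lexx t).
  have [sr|rs] := leP s r; first exact: l1.
  have E1 : `[t, s]%classic = `[t, r] `|` `]r, s].
    by apply: itv_bndbnd_setU; rewrite bnd_simp// ltW.
  have lr := l1 r (lexx r); have ls := vel_int_itv hu s (lexx r).
  have loc : Lint `]r, s] (fun p => `|u p|).
    have sub : `]r, s]%classic `<=` `[r, s] by apply: subset_itvr; rewrite bnd_simp.
    exact: (lintS (mi r s) (lebesgue_itv _) sub ls).
  have mU : measurable_fun (`[t, r] `|` `]r, s] : set T) (EFin \o (fun p => `|u p|)).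
    apply/measurable_funU; [exact: mi|exact: lebesgue_itv|].
    by split; [exact: measurable_int lr|exact: measurable_int loc].
  have dj : [disjoint `[t, r] & `]r, s]]%classic.
    apply/disj_setPS => p []; rewrite /= !in_itv/= => /andP[_ pr] /andP[rp _].
    by move: rp; rewrite ltNge pr.
  apply/integrableP; split; first by rewrite E1.
  rewrite E1 (@ge0_integral_setU _ _ _ mu _ _ (mi t r) (lebesgue_itv _) _
    (measurableT_comp (@abse_measurable R setT) mU) (fun p _ => abse_ge0 _) dj).
  move/integrableP : lr => [_ lr]; move/integrableP : loc => [_ loc].
  exact: lte_add_pinfty.
have tE : `[t, +oo[%classic = `[t, r] `|` `]r, +oo[.
  by apply: itv_bndbnd_setU; rewrite bnd_simp.
have mu_ : smeasD `[t, +oo[ u.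
  split=> c; rewrite tE; apply/measurable_funU; [exact: mi|exact: lebesgue_itv|split].
    have := smeas_dist (vel_meas_itv hv r (lexx t)) c; apply: eq_measurable_fun.
    by move=> s /set_mem /=; rewrite in_itv/= => /andP[_ sr]; rewrite uv.
  apply: (measurable_funS (lebesgue_itv `[r, +oo[)) (smeas_dist (vel_meas hu) c).
  by move=> s /=; rewrite !in_itv/= !andbT => /ltW.
have zu s : t <= s -> s <= r -> velocity t x v -> forall q : dual E,
    q (z s - z t) = \I_[t, s] (fun p => q (u p)).
  move=> ts sr _ q; rewrite /z sr tr (vel_ftc hv q ts); apply: eq_Rintegral => p /set_mem /=.
  by rewrite in_itv/= => /andP[_ ps]; rewrite uv// (le_trans ps).
split=> // s q ts; have [sr|rs] := leP s r; first exact: zu.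
have lq : Lint `[t, s] (fun p => q (u p)).
  apply: (dual_lint Esep (mi t s)); last exact: lu.
  by apply: smeasS mu_; [exact: lebesgue_itv|exact: itvcc_itvcy].
rewrite (Rint_cat tr (ltW rs) lq) -(zu r tr (lexx r) hv).
have -> : \I_[r, s] (fun p => q (u p)) = q (y s - y r).
  by rewrite (vel_ftc hu q (ltW rs)).
by rewrite -linearD/= /z lexx tr (leNgt s) rs/= -xy [in RHS]addrC subrKA.
Qed.

End Trajectories.

(** * Gronwall's inequality *)

Section Gronwall.
Context {R : realType}.
Local Notation mu := (@completed_lebesgue_measure R).
Local Notation T := (lebesgue_type R).
Local Notation Lint D f := (mu.-integrable (D : set T) (EFin \o (f : R -> R))).
Implicit Types (t S a : R) (f g u : R -> R).

(** The inequality [1 + y <= expR y] at [y = d / (1 - d)], whose left side is the inverse of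
    [1 - d]. *)
Lemma inv_expR_bound (d eta : R) : 0 <= d -> d <= eta -> eta < 1 ->
  (1 - d)^-1 <= expR (d / (1 - eta)).
Proof.
move=> d0 de e1; have d1 : 0 < 1 - d by lra.
apply: (@le_trans _ _ (expR (d / (1 - d)))).
  apply: le_trans (expR_ge1Dx _).
  by rewrite le_eqVlt; apply/orP; left; apply/eqP; field; lra.
rewrite ler_expR ler_wpM2l// lef_pV2 ?posrE//; lra.
Qed.

(** As [g] is only integrable, differentiation is avoided: the interval is cut into pieces on which
    [g] has integral at most [eta], each multiplying the bound by an exponential. The price is the
    factor [1 / (1 - eta)] in the exponent. *)
Lemma gronwall_grid t S a g u eta : t <= S -> 0 <= a -> 0 < eta -> eta < 1 ->
  Lint `[t, S] g -> (forall s, t <= s -> s <= S -> 0 <= g s) ->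
  (forall s, t <= s -> s <= S -> 0 <= u s) -> Lint `[t, S] (fun s => g s * u s) ->
  (forall s, t <= s -> s <= S -> u s <= a + \I_[t, s] (fun r => g r * u r)) ->
  a + \I_[t, S] (fun r => g r * u r) <= a * expR (\I_[t, S] g / (1 - eta)).
Proof.
move=> tS a0 e0 e1 lg g0 u0 lgu ule.
pose A s := a + \I_[t, s] (fun r => g r * u r).
have lg' r s : t <= r -> s <= S -> Lint `[r, s] g by move=> tr sS; exact: lint_itvS lg.
have lgu' r s : t <= r -> s <= S -> Lint `[r, s] (fun s => g s * u s).
  by move=> tr sS; exact: lint_itvS lgu.
have Acat r s : t <= r -> r <= s -> s <= S -> A s = A r + \I_[r, s] (fun r => g r * u r).
  by move=> tr rs sS; rewrite /A (Rint_cat tr rs) ?addrA//; apply: lgu'.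
have gu0 r s : t <= r -> s <= S -> 0 <= \I_[r, s] (fun r => g r * u r).
  move=> tr sS; apply: Rint_itv_ge0 => p rp ps.
  by rewrite mulr_ge0 ?g0 ?u0 ?(le_trans tr rp) ?(le_trans ps sS).
have A0 s : s <= S -> 0 <= A s by move=> sS; rewrite addr_ge0// gu0.
have step r s : t <= r -> r <= s -> s <= S -> \I_[r, s] g <= eta ->
    A s <= A r * expR (\I_[r, s] g / (1 - eta)).
  move=> tr rs sS de; set d := \I_[r, s] g in de *.
  have d0 : 0 <= d.
    by apply: Rint_itv_ge0 => p rp ps; rewrite g0 ?(le_trans tr rp) ?(le_trans ps sS).
  (* [u <= A] and [A] is nondecreasing, so its increment over [[r, s]] is at most [d * A s]. *)
  have h : A s * (1 - d) <= A r.
    rewrite mulrBr mulr1 lerBlDr {1}(Acat r s)// lerD2l.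
    rewrite -RintegralZl; [|exact: lebesgue_itv|exact: lg'].
    apply: le_Rint_itv; [exact: lgu'|by apply: lintZ; [exact: lebesgue_itv|exact: lg']|].
    move=> p rp ps; have tp := le_trans tr rp; have pS := le_trans ps sS.
    rewrite mulrC ler_wpM2r ?g0//; apply: le_trans (ule p tp pS) _.
    by rewrite -/(A p) (Acat p s)// lerDl gu0.
  have d1 : 0 < 1 - d by rewrite subr_gt0 (le_lt_trans de).
  rewrite -ler_pdivlMr// in h.
  apply: le_trans h _; rewrite ler_wpM2l ?A0 ?(le_trans rs)//.
  exact: inv_expR_bound.
have [dl dl0 hdl] := Rint_itv_small lg e0.
have small r s : t <= r -> r <= s -> s <= S -> s - r < dl -> \I_[r, s] g <= eta.
  move=> tr rs sS srd; apply: le_trans (ltW (hdl r s tr rs sS srd)).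
  apply: le_Rint_itv; [exact: lg'|by apply: lint_norm; [exact: lebesgue_itv|exact: lg']|].
  by move=> p _ _; exact: ler_norm.
(* Induction on the number of pieces of length at most [dl / 2]. *)
have chain n s : t <= s -> s <= S -> s - t <= n%:R * (dl / 2) ->
    A s <= a * expR (\I_[t, s] g / (1 - eta)).
  elim: n s => [|n IH] s ts sS sn.
    have -> : s = t by apply/le_anti; rewrite ts andbT -subr_le0 (le_trans sn)// mul0r.
    by rewrite /A !Rint_itv_pt// addr0 mul0r expR0 mulr1.
  pose r := Num.max t (s - dl / 2).
  have tr : t <= r by rewrite le_max lexx.
  have rs : r <= s by rewrite ge_max ts/= gerBl ltW// divr_gt0.
  have rn : r - t <= n%:R * (dl / 2).
    rewrite lerBlDr ge_max; apply/andP; split.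
      by rewrite lerDr mulr_ge0// ltW// divr_gt0.
    by move: sn; rewrite -natr1 mulrDl mul1r; clear; lra.
  have srd : s - r < dl.
    have : s - dl / 2 <= r by rewrite le_max lexx orbT.
    by clear -dl0; lra.
  apply: le_trans (step r s tr rs sS (small r s tr rs sS srd)) _.
  have -> : \I_[t, s] g / (1 - eta) = \I_[t, r] g / (1 - eta) + \I_[r, s] g / (1 - eta).
    by rewrite -mulrDl -(Rint_cat tr rs) //; exact: lg'.
  rewrite expRD mulrA ler_wpM2r ?expR_ge0//.
  by apply: IH => //; exact: le_trans rs sS.
have dl2 : 0 < dl / 2 by rewrite divr_gt0.
apply: (chain (Num.truncn ((S - t) / (dl / 2))).+1 S tS (lexx S)).
by rewrite -ler_pdivrMr// ltW// truncnS_gt.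
Qed.

Lemma gronwall t S a g u : t <= S -> 0 <= a ->
  Lint `[t, S] g -> (forall s, t <= s -> s <= S -> 0 <= g s) ->
  (forall s, t <= s -> s <= S -> 0 <= u s) -> Lint `[t, S] (fun s => g s * u s) ->
  (forall s, t <= s -> s <= S -> u s <= a + \I_[t, s] (fun r => g r * u r)) ->
  u S <= a * expR (\I_[t, S] g).
Proof.
move=> tS a0 lg g0 u0 lgu ule; apply: le_trans (ule S tS (lexx S)) _.
set A := _ + _; set G := \I_[t, S] g.
(* [eta = 1 / (n + 2)] is below 1 for every [n] and tends to 0, which removes the loss in the
   exponent. *)
have h : a * expR (G / (1 - n.+2%:R^-1)) @[n --> \oo] --> a * expR G.
  apply: cvgM; first exact: cvg_cst.
  apply: continuous_cvg; first exact: continuous_expR.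
  rewrite -[X in _ --> X]divr1; apply: cvgM; first exact: cvg_cst.
  apply: cvgV; first exact: oner_neq0.
  rewrite -[X in _ --> X]subr0; apply: cvgB; first exact: cvg_cst.
  have c0 : (n.+1%:R^-1 : R) @[n --> \oo] --> (0 : R) by exact: cvg_harmonic.
  by move: c0; rewrite -(cvg_shiftS (fun n => n.+1%:R^-1 : R)).
apply: (cvgr_to_ge h); apply: nearW => n; apply: (gronwall_grid (u := u)) => //.
by rewrite invf_lt1// ltr1n.
Qed.

Lemma cumulative_meas t g : (forall s, 0 <= g s) -> (forall s, Lint `[t, s] g) ->
  measurable_fun (setT : set T) (fun s => \I_[t, s] g).
Proof.
move=> g0 lg; apply: borel_lebesgue_fun; apply: nondecreasing_measurable => //.
move=> r s rs; exact: (le_Rint_itvS (lexx t) rs (lg s) (fun p _ _ => g0 p)).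
Qed.

End Gronwall.

(** * Filippov's theorem *)

Section Filippov.
Context {R : realType} {E : completeNormedModType R}.
Hypothesis Esep : separable E.
Local Notation mu := (@completed_lebesgue_measure R).
Local Notation T := (lebesgue_type R).
Local Notation Lint D f := (mu.-integrable (D : set T) (EFin \o (f : R -> R))).
Local Notation smeasD D f := (@smeas _ T R E D f).
Variables (Gamma : R -> E -> set E) (gamma : R -> R).
Hypothesis Gamma_closed : forall t x, 0 <= t -> Gamma t x !=set0 /\ closed (Gamma t x).
Hypothesis Gamma_lsc : forall x, lsc_multifunction (fun t => Gamma t x).
Hypothesis gamma_ge0 : forall t, 0 <= t -> 0 <= gamma t.
Hypothesis gamma_int : forall S, 0 <= S -> Lint `[0, S] gamma.
Hypothesis Gamma_lip : forall t x x', 0 <= t ->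
  Gamma t x `<=` [set y + (gamma t * `|x - x'|) *: v |
                   y in Gamma t x' & v in [set v | `|v| < 1]].

Lemma Gamma_neq0 t x : 0 <= t -> Gamma t x !=set0.
Proof. by move=> /(Gamma_closed x)[]. Qed.

Lemma Gamma_near t x x' y : 0 <= t -> Gamma t x y ->
  exists2 y', Gamma t x' y' & `|y - y'| <= gamma t * `|x - x'|.
Proof.
move=> t0 /(Gamma_lip x' t0)[y' Gy' [v /= v1 <-]]; exists y' => //.
rewrite addrAC subrr add0r normrZ ger0_norm ?mulr_ge0 ?gamma_ge0//.
by rewrite ler_piMr ?(ltW v1)// mulr_ge0 ?gamma_ge0.
Qed.

Lemma dist_Gamma_lip t x x' c : 0 <= t ->
  dist_to (Gamma t x) c <= dist_to (Gamma t x') c + gamma t * `|x - x'|.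
Proof.
move=> t0; rewrite -lerBlDr; apply: dist_ge; first exact: Gamma_neq0.
move=> y Gy; rewrite lerBlDr; have [y' Gy' yy'] := Gamma_near x t0 Gy.
apply: le_trans (dist_le c Gy') _; apply: le_trans (ler_distD y _ _) _.
by rewrite lerD2l (distrC x).
Qed.

(** The distance from [c] is below [r] exactly when [Gamma t x] meets the open ball of radius [r]
    about [c], so lower semicontinuity makes the strict sublevel sets relatively open. *)
Lemma dist_Gamma_meas0 x c :
  measurable_fun (`[0, +oo[ : set T) (fun t => dist_to (Gamma t x) c).
Proof.
have m0 : measurable (`[0, +oo[%classic : set T) by exact: lebesgue_itv.
apply: (measurability _ (RGenInftyO.measurableE R)) => // _ [_ [r ->] <-].
have [U oU UE] := Gamma_lsc x (ball_open c r).
rewrite (_ : _ `&` _ = `[0, +oo[ `&` U).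
  by apply: measurableI => //; apply: borel_lebesgue; exact: open_measurable.
rewrite -UE; apply/seteqP; split => t /=; rewrite !in_itv/= ?andbT.
  move=> [t0 /(dist_ltP (Gamma_neq0 x t0))[y Gy cy]]; split=> //; exists y; split=> //.
  by rewrite -ball_normE.
move=> [t0 [y [Gy]]]; rewrite -ball_normE/= => cy; split=> //.
exact: le_lt_trans (dist_le c Gy) cy.
Qed.

Lemma itvcy_sub (t : R) : 0 <= t -> `[t, +oo[%classic `<=` `[0, +oo[.
Proof. by move=> t0 s /=; rewrite !in_itv/= !andbT; exact: le_trans. Qed.

Lemma lip_continuous (F : E -> R) k : (forall x y, F x <= F y + k * `|x - y|) ->
  continuous F.
Proof.
move=> Fk x; apply/cvgrPdist_le => r r0.
have k1 : 0 < `|k| + 1 by rewrite ltr_wpDl.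
near=> y.
have xy : `|x - y| <= r / (`|k| + 1).
  near: y; have /cvgrPdist_le := @cvg_id E (nbhs x); apply.
  by rewrite divr_gt0.
have kxy : k * `|x - y| <= r.
  rewrite ler_pdivlMr// mulrC in xy; apply: le_trans xy.
  by rewrite ler_wpM2r// (le_trans (ler_norm k))// lerDl.
have := Fk x y; have := Fk y x; rewrite (distrC y x) => h1 h2.
by rewrite ler_norml;  apply/andP; split; lra.
Unshelve. all: by end_near. Qed.

Lemma dist_Gamma_meas t x (c : E) : 0 <= t -> smeasD `[t, +oo[ x ->
  measurable_fun (`[t, +oo[ : set T) (fun s => dist_to (Gamma s (x s)) c).
Proof.
move=> t0 mx; apply: (caratheodory Esep (lebesgue_itv _)
  (F := fun s y => dist_to (Gamma s y) c)); last exact: mx.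
- move=> y; apply: measurable_funS (dist_Gamma_meas0 y c); first exact: lebesgue_itv.
  exact: itvcy_sub.
- move=> s /=; rewrite in_itv/= andbT => ts.
  apply: (@lip_continuous _ (gamma s)) => y y'; apply: dist_Gamma_lip.
  exact: le_trans ts.
Qed.

Lemma dist_Gamma_meas2 t x v : 0 <= t -> smeasD `[t, +oo[ x -> smeasD `[t, +oo[ v ->
  measurable_fun (`[t, +oo[ : set T) (fun s => dist_to (Gamma s (x s)) (v s)).
Proof.
move=> t0 mx mv; apply: (caratheodory Esep (lebesgue_itv _)
  (F := fun s y => dist_to (Gamma s (x s)) y)); last exact: mv.
- by move=> y; exact: dist_Gamma_meas.
- move=> s /=; rewrite in_itv/= andbT => ts.
  apply: (@lip_continuous _ 1) => y y'; rewrite mul1r; apply: dist_lip.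
  by apply: Gamma_neq0; exact: le_trans ts.
Qed.

Lemma dist_Gamma_lip2 t x x' y y' : 0 <= t ->
  dist_to (Gamma t x) y <= dist_to (Gamma t x') y' + gamma t * `|x - x'| + `|y - y'|.
Proof.
move=> t0; apply: le_trans (dist_lip y y' (Gamma_neq0 x t0)) _.
by rewrite lerD2r dist_Gamma_lip.
Qed.

Lemma gamma_itv t s : 0 <= t -> Lint `[t, s] gamma.
Proof.
move=> t0; have [ts|st] := leP t s.
  by apply: lint_itvS (gamma_int (le_trans t0 ts)).
by rewrite set_itv_ge ?bnd_simp -?ltNge//; exact: integrable_set0.
Qed.

Section FilippovTheorem.
Variables (t : R) (a : E) (z w : R -> E) (e : R -> R).
Hypothesis t0 : 0 <= t.
Hypothesis zw : velocity t z w.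
Hypothesis e0 : forall s, t <= s -> 0 < e s.
Hypothesis em : measurable_fun (`[t, +oo[ : set T) e.
Hypothesis ei : forall s, t <= s -> Lint `[t, s] e.
Let rho s := dist_to (Gamma s (z s)) (w s).
Hypothesis rho_int : forall s, t <= s -> Lint `[t, s] rho.

Let mi r s : measurable (`[r, s]%classic : set T). Proof. exact: lebesgue_itv. Qed.
Let mt : measurable (`[t, +oo[%classic : set T). Proof. exact: lebesgue_itv. Qed.
Let itv_sub s : `[t, s]%classic `<=` `[t, +oo[. Proof. exact: itvcc_itvcy. Qed.
Let ge0t s : t <= s -> 0 <= s. Proof. exact: le_trans. Qed.

(** Bookkeeping for the induction on velocity increments, with [c] the new tolerance and [2 * c] the
    previous one. *)
Lemma increment_sum (r c b g i j k : R) :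
  r + (1 - 2 * c) * b + g * (i + j) + (g * k + c * b) =
  r + (1 - c) * b + g * (i + (j + k)).
Proof. by ring. Qed.

(** One iteration: the new velocity is a measurable, almost nearest selection of [Gamma] along the
    old trajectory, and its primitive starts at [a]. It is integrable by comparison with [z] and
    [w]. *)
Lemma filippov_step x v k : velocity t x v -> 0 < k -> k <= 1 ->
  exists x' v', [/\ x' t = a, velocity t x' v' & forall s, t <= s ->
    Gamma s (x s) (v' s) /\
    `|v' s - v s| <= dist_to (Gamma s (x s)) (v s) + k * e s].
Proof.
move=> xv k0 k1.
have mx := vel_traj_meas Esep xv.
have [||||||v' mv' v'P] := @measurable_selection _ T R E Esep `[t, +oo[ mt
    (fun s => Gamma s (x s)) v (fun s => k * e s).
- by move=> s /=; rewrite in_itv/= andbT => /ge0t s0; exact: Gamma_neq0.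
- by move=> s /=; rewrite in_itv/= andbT => /ge0t s0; have [] := Gamma_closed (x s) s0.
- by move=> c; exact: dist_Gamma_meas.
- exact: vel_meas xv.
- by apply: measurable_funM => //; exact: measurable_cst.
- by move=> s /=; rewrite in_itv/= andbT => ts; rewrite mulr_gt0 ?e0.
have v'P' s : t <= s -> Gamma s (x s) (v' s) /\
    `|v' s - v s| <= dist_to (Gamma s (x s)) (v s) + k * e s.
  by move=> ts; apply: v'P; rewrite /= in_itv/= ts.
have lv' s : t <= s -> Lint `[t, s] (fun r => `|v' r|).
  move=> ts.
  (* Bounds [|x - z|] on all of [[t, s]]: the gap at [t] plus the two path lengths. *)
  pose M := `|x t - z t| + \I_[t, s] (fun r => `|v r|) + \I_[t, s] (fun r => `|w r|).
  have lb : Lint `[t, s] (fun r => rho r + M * gamma r + `|w r| + 2 * `|v r| + e r).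
    apply: lintD; [exact: mi| |exact: ei].
    apply: lintD; [exact: mi| |by apply: lintZ; [exact: mi|exact: vel_int xv _ ts]].
    apply: lintD; [exact: mi| |exact: vel_int zw _ ts].
    apply: lintD; [exact: mi|exact: rho_int|].
    by apply: lintZ; [exact: mi|exact: gamma_itv].
  apply: (lint_le (mi t s) _ lb).
    exact: measurable_funS mt (@itv_sub s) (smeas_norm mv').
  move=> r /=; rewrite in_itv/= => /andP[tr rs]; rewrite normr_id.
  have [_ h] := v'P' r tr.
  have h1 := dist_Gamma_lip2 (x r) (z r) (v r) (w r) (ge0t tr).
  have xz : `|x r - z r| <= M.
    have -> : x r - z r = (x t - z t) + (x r - x t) - (z r - z t).
      by rewrite opprB [(x t - z t) + _]addrC !subrKA.
    apply: le_trans (ler_normB _ _) _; apply: lerD; last first.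
      apply: le_trans (vel_norm Esep zw (lexx t) tr) _.
      by apply: le_Rint_itvS => //; exact: vel_int zw _ ts.
    apply: le_trans (ler_normD _ _) _; rewrite lerD2l.
    apply: le_trans (vel_norm Esep xv (lexx t) tr) _.
    by apply: le_Rint_itvS => //; exact: vel_int xv _ ts.
  have h2 : gamma r * `|x r - z r| <= M * gamma r.
    by rewrite mulrC ler_wpM2r// gamma_ge0// ge0t.
  have h3 : k * e r <= e r by rewrite ler_piMl// ltW// e0.
  have h4 := ler_normB (v r) (w r).
  have h5 : `|v' r| <= `|v' r - v r| + `|v r|.
    by rewrite -{1}[v' r](subrK (v r)) ler_normD.
  by move: h h1; rewrite -/(rho r) => h h1;  lra.
have [x' x't x'v'] := velocity_exists Esep a mv' lv'.
by exists x', v'; split.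
Qed.

Let alpha := `|a - z t|.
Let alpha_ge0 : 0 <= alpha. Proof. exact: normr_ge0. Qed.

(* Gronwall's inequality bounds the sums of the increments of the iterates
   uniformly in the number of steps, by K on the trajectories and by B on the
   velocities. *)
Let K s := expR (\I_[t, s] gamma) * (alpha + \I_[t, s] (fun r => rho r + e r)).
Let B s := rho s + e s + gamma s * K s.

Let rho_ge0 s : t <= s -> 0 <= rho s.
Proof. by move=> ts; apply: dist_ge0; apply: Gamma_neq0; exact: ge0t. Qed.

Let re_int s : t <= s -> Lint `[t, s] (fun r => rho r + e r).
Proof. by move=> ts; apply: lintD; [exact: mi|exact: rho_int|exact: ei]. Qed.

Let re_ge0 s : t <= s -> 0 <= rho s + e s.
Proof. by move=> ts; rewrite addr_ge0 ?rho_ge0// ltW// e0. Qed.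

Let K_mono r s : t <= r -> r <= s -> K r <= K s.
Proof.
move=> tr rs; have ts := le_trans tr rs.
have h1 : \I_[t, r] gamma <= \I_[t, s] gamma.
  apply: le_Rint_itvS => //; first exact: gamma_itv.
  by move=> p tp _; rewrite gamma_ge0// ge0t.
have h2 : \I_[t, r] (fun r => rho r + e r) <= \I_[t, s] (fun r => rho r + e r).
  apply: le_Rint_itvS => //; first exact: re_int.
  by move=> p tp _; exact: re_ge0.
apply: ler_pM; rewrite ?expR_ge0 ?ler_expR ?lerD2l//.
by rewrite addr_ge0//; apply: Rint_itv_ge0 => p tp _; exact: re_ge0.
Qed.

(** Picard iteration. Since [v n.+1] lies in [Gamma] along [x n], its distance to [Gamma] along
    [x n.+1] is at most [gamma] times [|x n.+1 - x n|]. The increments are thus controlled by their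
    own integrals. *)
Lemma filippov : exists x v, [/\ x t = a, velocity t x v,
  forall s, t <= s -> Gamma s (x s) (v s),
  forall s, t <= s -> `|x s - z s| <= K s &
  forall s, t <= s -> `|v s - w s| <= B s].
Proof.
pose st := {xv : (R -> E) * (R -> E) | xv.1 t = a /\ velocity t xv.1 xv.2}.
(* Selection errors [e / 2], [e / 4] and so on, with total at most [e]. *)
pose c (n : nat) : R := 2^-1 ^+ n.+1.
have c0 n : 0 < c n by rewrite exprn_gt0// invr_gt0.
have c1 n : c n <= 1 by rewrite exprn_ile1// ?invr_ge0// invf_le1// ler1n.
have stepP n (u : st) : exists u' : st, forall s, t <= s ->
    Gamma s ((sval u).1 s) ((sval u').2 s) /\
    `|(sval u').2 s - (sval u).2 s| <=
      dist_to (Gamma s ((sval u).1 s)) ((sval u).2 s) + c n * e s.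
  case: u => -[x v] /= [xt xv].
  have [x' [v' [x't xv' h]]] := filippov_step xv (c0 n) (c1 n).
  by exists (exist _ (x', v') (conj x't xv')).
have [nxt nxtP] : exists nxt : nat -> st -> st, forall n u s, t <= s ->
    Gamma s ((sval u).1 s) ((sval (nxt n u)).2 s) /\
    `|(sval (nxt n u)).2 s - (sval u).2 s| <=
      dist_to (Gamma s ((sval u).1 s)) ((sval u).2 s) + c n * e s.
  exists (fun n u => projT1 (cid (stepP n u))) => n u.
  exact: projT2 (cid (stepP n u)).
have u0P : (z t + (a - z t) = a) /\ velocity t (fun s => z s + (a - z t)) w.
  by split; [rewrite addrC subrK|exact: velocity_translate].
(* The iteration starts from [z] translated to begin at [a], with the velocity [w]; this curve stays
   at distance [alpha] from [z]. *)
pose U := fix U n : st := if n is m.+1 then nxt m (U m) else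
  exist _ ((fun s => z s + (a - z t)), w) u0P.
pose x n := (sval (U n)).1; pose v n := (sval (U n)).2.
have xt n : x n t = a by have [] := svalP (U n).
have xv n : velocity t (x n) (v n) by have [] := svalP (U n).
have x0E s : x 0%N s = z s + (a - z t) by [].
have v0E s : v 0%N s = w s by [].
have Gv n s : t <= s -> Gamma s (x n s) (v n.+1 s) by move=> /(nxtP n (U n))[].
have vd n s : t <= s -> `|v n.+1 s - v n s| <=
    dist_to (Gamma s (x n s)) (v n s) + c n * e s by move=> /(nxtP n (U n))[].
clearbody x v.
pose dl n s := `|v n.+1 s - v n s|.
pose S n s := \sum_(0 <= k < n) dl k s.
have S_ge0 n s : 0 <= S n s by apply: sumr_ge0 => k _; exact: normr_ge0.
have SS n s : S n.+1 s = S n s + dl n s by rewrite /S big_nat_recr.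
have ldl n s : Lint `[t, s] (dl n).
  exact: (smeas_lintB Esep (mi t s) (vel_meas_itv (xv n.+1) s (lexx t))
    (vel_meas_itv (xv n) s (lexx t)) (vel_int_itv (xv n.+1) s (lexx t))
    (vel_int_itv (xv n) s (lexx t))).
have lS n s : Lint `[t, s] (S n).
  exact: (Rint_sum (mi t s) (index_iota 0 n) (fun k => ldl k s)).1.
have ISS n s : \I_[t, s] (S n.+1) = \I_[t, s] (S n) + \I_[t, s] (dl n).
  rewrite -(RintegralD (mi t s) (lS n s) (ldl n s)).
  by apply: eq_Rintegral => r _; exact: SS.
have xd n s : t <= s -> `|x n.+1 s - x n s| <= \I_[t, s] (dl n).
  move=> ts; apply: norm_le_dual => q q1.
  have -> : x n.+1 s - x n s = (x n.+1 s - x n.+1 t) - (x n s - x n t).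
    by rewrite !xt opprB addrA subrK.
  rewrite linearB/= (vel_ftc (xv _) q ts) (vel_ftc (xv n) q ts).
  have l1 := vel_dual_int Esep (xv n.+1) s q (lexx t).
  have l2 := vel_dual_int Esep (xv n) s q (lexx t).
  rewrite -(RintegralB (mi t s) l1 l2).
  apply: le_Rint_itv; [exact: lintB (mi t s) l1 l2|exact: ldl|].
  by move=> r _ _; rewrite -linearB/= (le_trans (ler_norm _)).
(* The coefficient [1 - c n] is the share of the tolerance spent by the first [n + 1] selections. *)
have Sbound n s : t <= s -> S n.+1 s <=
    rho s + (1 - c n) * e s + gamma s * (alpha + \I_[t, s] (S n)).
  move=> ts; elim: n => [|n IH].
    rewrite SS /S big_nil add0r.
    have -> : \I_[t, s] (fun s => \sum_(0 <= k < 0) dl k s) = 0.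
      rewrite (_ : (fun s => _) = fun=> 0); last by apply/funext => r; rewrite big_nil.
      by rewrite Rint_itv_cst// mul0r.
    rewrite addr0; apply: le_trans (vd 0%N s ts) _.
    have := dist_Gamma_lip (x 0%N s) (z s) (v 0%N s) (ge0t ts).
    rewrite x0E v0E addrAC subrr add0r -/alpha -/(rho s) /c expr1.
    have -> : 1 - 2^-1 = 2^-1 :> R by field.
    by move=> h; rewrite addrAC lerD2r.
  rewrite SS ISS.
  have h1 : dl n.+1 s <= gamma s * \I_[t, s] (dl n) + c n.+1 * e s.
    apply: le_trans (vd n.+1 s ts) _; rewrite lerD2r.
    apply: le_trans (dist_Gamma_lip (x n.+1 s) (x n s) (v n.+1 s) (ge0t ts)) _.
    rewrite (dist0 (Gv n s ts)) add0r.
    by rewrite ler_wpM2l ?gamma_ge0 ?ge0t// xd.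
  have h2 : c n = 2 * c n.+1 by rewrite /c [in RHS]exprS mulrA mulfV ?mul1r.
  by apply: le_trans (lerD IH h1) _; rewrite h2 increment_sum.
have cume n : measurable_fun (setT : set T) (fun s => \I_[t, s] (S n)).
  by apply: cumulative_meas => // s; exact: S_ge0.
(* [S n <= S n.+1] turns [Sbound] into an integral inequality for [S n] alone, so that Gronwall
   gives a bound independent of [n]. *)
have Ibound n s : t <= s -> alpha + \I_[t, s] (S n) <= K s.
  move=> ts; pose u r := alpha + \I_[t, r] (S n).
  have u0 r : 0 <= u r by rewrite addr_ge0//; apply: Rint_itv_ge0.
  have um r : r <= s -> u r <= u s.
    by move=> rs; rewrite lerD2l; apply: le_Rint_itvS.
  have lgu r : r <= s -> Lint `[t, r] (fun p => gamma p * u p).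
    move=> rs; apply: (lint_le (mi t r) _ (lintZ (u s) (mi t r) (gamma_itv r t0))).
      apply: measurable_funM; first exact: lint_meas (gamma_itv r t0).
      apply: measurable_funD; first exact: measurable_cst.
      exact: measurable_funTS (cume n).
    move=> p /=; rewrite in_itv/= => /andP[tp pr].
    have gp := gamma_ge0 (ge0t tp).
    by rewrite ger0_norm ?mulr_ge0// mulrC ler_wpM2r// um// (le_trans pr).
  rewrite -/(u s) /K mulrC.
  apply: (gronwall (g := gamma) (u := u)) => //.
  - by rewrite addr_ge0//; apply: Rint_itv_ge0 => p tp _; exact: re_ge0.
  - exact: gamma_itv.
  - by move=> r tr _; rewrite gamma_ge0// ge0t.
  - exact: lgu.
  move=> r tr rs; rewrite /u -addrA lerD2l.
  apply: (@le_trans _ _ (\I_[t, r] (fun p => (rho p + e p) + gamma p * u p))).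
    apply: le_Rint_itv; first exact: lS.
      by apply: lintD; [exact: mi|exact: re_int|exact: lgu].
    move=> p tp pr; apply: (@le_trans _ _ (S n.+1 p)).
      by rewrite SS lerDl normr_ge0.
    apply: le_trans (Sbound n p tp) _; rewrite lerD2r lerD2l.
    by rewrite ler_piMl ?(ltW (e0 tp))// gerBl ltW.
  rewrite (RintegralD (mi t r) (re_int tr) (lgu r rs)) lerD2r.
  apply: le_Rint_itvS => //; first exact: re_int.
  by move=> p tp _; exact: re_ge0.
have SB n s : t <= s -> S n s <= B s.
  move=> ts; apply: (@le_trans _ _ (S n.+1 s)); first by rewrite SS lerDl normr_ge0.
  apply: le_trans (Sbound n s ts) _; apply: lerD.
    by rewrite lerD2l ler_piMl ?(ltW (e0 ts))// gerBl ltW.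
  by rewrite ler_wpM2l ?gamma_ge0 ?ge0t// Ibound.
have limv s : exists l, t <= s -> v n s @[n --> \oo] --> l /\ `|l - w s| <= B s.
  have [ts|nts] := leP t s; last by exists 0.
  have [l h1 h2] := cvg_increments (fun n => SB n s ts).
  by exists l => _; split; [exact: h1|rewrite -v0E].
have [vl vlP] := choice limv.
have limx s : exists l, t <= s -> x n s @[n --> \oo] --> l /\ `|l - z s| <= K s.
  have [ts|nts] := leP t s; last by exists 0.
  (* The displacement from [z] includes the initial translation, so only [K s - alpha] is left for
     the increments. *)
  have sumx n : \sum_(0 <= k < n) `|x k.+1 s - x k s| <= K s - alpha.
    apply: (@le_trans _ _ (\I_[t, s] (S n))); last first.
      by have := Ibound n s ts; rewrite lerBrDl.
    have [_ ->] := Rint_sum (mi t s) (index_iota 0 n) (fun k => ldl k s).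
    by apply: ler_sum => k _; exact: xd.
  have [l h1 h2] := cvg_increments sumx.
  exists l => _; split=> //.
  have -> : l - z s = (l - x 0%N s) + (a - z t) by rewrite x0E; move: (a - z t) => b; rewrite opprD addrA subrK.
  by apply: le_trans (ler_normD _ _) _; rewrite -lerBrDr.
have [xl xlP] := choice limx.
have mvl : smeasD `[t, +oo[ vl.
  apply: (@smeas_cvg _ T R E _ v); first by move=> n; exact: vel_meas (xv n).
  by move=> s /=; rewrite in_itv/= andbT => /vlP[].
have lB s : t <= s -> Lint `[t, s] (fun r => `|w r| + (rho r + e r + K s * gamma r)).
  move=> ts; apply: lintD; [exact: mi|exact: vel_int zw _ ts|].
  apply: lintD; [exact: mi|exact: re_int|].
  by apply: lintZ; [exact: mi|exact: gamma_itv].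
have BK r s : t <= r -> r <= s -> B r <= rho r + e r + K s * gamma r.
  by move=> tr rs; rewrite lerD2l mulrC ler_wpM2r ?gamma_ge0 ?ge0t// K_mono.
have vnB n r s : t <= r -> r <= s -> `|v n r| <= `|w r| + (rho r + e r + K s * gamma r).
  move=> tr rs; rewrite -[v n r](subrK (w r)) addrC (le_trans (ler_normD _ _))// lerD2l.
  apply: le_trans (BK r s tr rs); apply: le_trans (SB n r tr).
  rewrite -v0E -(telescope_sumr (fun k => v k r))//.
  exact: ler_norm_sum.
have lvl s : t <= s -> Lint `[t, s] (fun r => `|vl r|).
  move=> ts; apply: (lint_le (mi t s) _ (lB s ts)).
    exact: measurable_funS mt (@itv_sub s) (smeas_norm mvl).
  move=> r /=; rewrite in_itv/= => /andP[tr rs]; rewrite normr_id.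
  rewrite -[vl r](subrK (w r)) addrC (le_trans (ler_normD _ _))// lerD2l.
  exact: le_trans (vlP r tr).2 (BK r s tr rs).
exists xl, vl; split=> //.
- have [h _] := xlP t (lexx t).
  apply: (@cvg_unique _ (@norm_hausdorff _ E) (x n t @[n --> \oo])); first exact: h.
  by rewrite /=; under eq_cvg do rewrite xt; exact: cvg_cst.
- split=> // s q ts.
  have h1 : q (x n s - x n t) @[n --> \oo] --> q (xl s - xl t).
    apply: continuous_cvg; first exact: dual_continuous.
    by apply: cvgB; [have [] := xlP s ts|have [] := xlP t (lexx t)].
  have [||_ h2] := @lint_dominated _ T R mu (@clm_complete R) `[t, s]%classic
    (fun n r => q (v n r)) (fun r => q (vl r)) _ (mi t s)
    (fun n => lint_meas (vel_dual_int Esep (xv n) s q (lexx t))) _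
    (lintZ `|q| (mi t s) (lB s ts)).
  - apply: aeW => r /=; rewrite in_itv/= => /andP[tr _].
    apply: continuous_cvg; first exact: dual_continuous.
    by have [] := vlP r tr.
  - apply: aeW => r /=; rewrite in_itv/= => /andP[tr rs] n.
    apply: le_trans (dual_le_norm q _) _.
    by rewrite ler_wpM2l// vnB.
  apply: (@cvg_unique _ (@norm_hausdorff _ R) (q (x n s - x n t) @[n --> \oo])) => //.
  by rewrite /=; under eq_cvg do rewrite (vel_ftc (xv _) q ts).
(* [v n.+1] is in [Gamma] along [x n], both sequences converge at every [s], and the distance to
   [Gamma] is Lipschitz in both arguments; closedness gives the inclusion at every time. *)
- move=> s ts.
  have s0 := ge0t ts; have [cv _] := vlP s ts; have [cx _] := xlP s ts.
  apply: dist0_closed; [by have [] := Gamma_closed (xl s) s0|exact: Gamma_neq0|].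
  have h1 : gamma s * `|xl s - x n s| + `|vl s - v n.+1 s| @[n --> \oo] --> (0 : R).
    rewrite -[X in _ --> X](addr0 0); apply: cvgD.
      rewrite -[X in _ --> X](mulr0 (gamma s)) -[X in _ * X](@normr0 _ E) -(subrr (xl s)).
      apply: cvgM; first exact: cvg_cst.
      by apply: cvg_norm; apply: cvgB; [exact: cvg_cst|exact: cx].
    rewrite -[X in _ --> X](@normr0 _ E) -(subrr (vl s)).
    apply: cvg_norm; apply: cvgB; first exact: cvg_cst.
    by rewrite (cvg_shiftS (fun n => v n s)).
  apply: (cvgr_to_ge h1); apply: nearW => n.
  have := dist_Gamma_lip2 (xl s) (x n s) (vl s) (v n.+1 s) s0.
  by rewrite (dist0 (Gv n s ts)) add0r.
- by move=> s /xlP[].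
- by move=> s /vlP[].
Qed.

End FilippovTheorem.
End Filippov.

Notation "\J_ t f" := (\int[completed_lebesgue_measure]_(s in `[t, +oo[) (f s))
  (at level 36, f at level 36, t at level 8) : ring_scope.

(** * Integrals over half-lines *)

Section HalfLine.
Context {R : realType}.
Local Notation mu := (@completed_lebesgue_measure R).
Local Notation T := (lebesgue_type R).
Local Notation Lint D f := (mu.-integrable (D : set T) (EFin \o (f : R -> R))).
Implicit Types (t r s : R) (f g : R -> R).

Let mcy t : measurable (`[t, +oo[%classic : set T). Proof. exact: lebesgue_itv. Qed.
Let mi r s : measurable (`[r, s]%classic : set T). Proof. exact: lebesgue_itv. Qed.

Lemma itvcy_subS t r : t <= r -> `[r, +oo[%classic `<=` `[t, +oo[.
Proof. by move=> tr s /=; rewrite !in_itv/= !andbT; exact: le_trans. Qed.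

Lemma lint_cyS t r f : t <= r -> Lint `[t, +oo[ f -> Lint `[r, +oo[ f.
Proof. by move=> tr; exact: (lintS (mcy t) (mcy r) (itvcy_subS tr)). Qed.

Lemma lint_cy_itv t r s f : t <= r -> Lint `[t, +oo[ f -> Lint `[r, s] f.
Proof. by move=> tr; exact: (lintS (mcy t) (mi r s) (itvcc_itvcy tr)). Qed.

Lemma Rint_cy_cat t r f : t <= r -> Lint `[t, +oo[ f ->
  \J_ t f = \I_[t, r] f + \J_ r f.
Proof.
move=> tr lf; have rE : `[r, +oo[%classic = [set r] `|` `]r, +oo[.
  by rewrite (@itv_bndbnd_setU _ _ _ (BRight r)) ?bnd_simp// set_itv1.
have tE : `[t, +oo[%classic = `[t, r] `|` `]r, +oo[.
  by apply: itv_bndbnd_setU; rewrite bnd_simp.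
have moc : measurable (`]r, +oo[%classic : set T) by exact: lebesgue_itv.
have m1 : measurable ([set r] : set T) by rewrite -set_itv1; exact: mi.
have d1 : [disjoint `[t, r] & `]r, +oo[]%classic.
  apply/disj_setPS => p []; rewrite /= !in_itv/= andbT => /andP[_ pr] rp.
  by move: rp; rewrite ltNge pr.
have d2 : [disjoint [set r] & `]r, +oo[]%classic.
  by apply/disj_setPS => p [/= ->]; rewrite in_itv/= ltxx.
have lt_ : Lint (`[t, r] `|` `]r, +oo[) f by rewrite -tE.
have lr_ : Lint ([set r] `|` `]r, +oo[) f by rewrite -rE; exact: lint_cyS lf.
rewrite tE (Rintegral_setU (mi t r) moc lt_ d1) [in RHS]rE.
by rewrite (Rintegral_setU m1 moc lr_ d2) Rint_set1 add0r.
Qed.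

Lemma le_Rint_cy t f g : Lint `[t, +oo[ f -> Lint `[t, +oo[ g ->
  {ae mu, forall s, t <= s -> f s <= g s} -> \J_ t f <= \J_ t g.
Proof.
move=> lf lg fg; apply: (le_Rint_ae (@clm_complete R) (mcy t) lf lg).
by apply: filterS fg => s h /=; rewrite in_itv/= andbT.
Qed.

Lemma lint_cy_le t f g : measurable_fun (`[t, +oo[ : set T) f -> Lint `[t, +oo[ g ->
  {ae mu, forall s, t <= s -> `|f s| <= g s} -> Lint `[t, +oo[ f.
Proof.
move=> mf lg fg; apply: (lint_le_ae (@clm_complete R) (mcy t) mf lg).
by apply: filterS fg => s h /=; rewrite in_itv/= andbT.
Qed.

Lemma Rint_cy_ge0 t f : (forall s, t <= s -> 0 <= f s) -> 0 <= \J_ t f.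
Proof. by move=> f0; apply: Rintegral_ge0 => s /=; rewrite in_itv/= andbT; exact: f0. Qed.

(** Dominated convergence for the restrictions of [|f|] to [[n, +oo[], which vanish eventually at
    each point. *)
Lemma Rint_cy_tail t f e : Lint `[t, +oo[ f -> 0 < e ->
  exists2 T0, t <= T0 & forall S, T0 <= S -> \J_ S (fun s => `|f s|) < e.
Proof.
move=> lf e0; have ln := lint_norm (mcy t) lf.
have mn := lint_meas ln.
pose fn (n : nat) := (fun s => `|f s|) \_ `[n%:R, +oo[.
have [|||_ /cvgrPdist_lt/(_ e e0)[N _ hN]] := @lint_dominated _ T R mu (@clm_complete R)
   `[t, +oo[%classic fn (fun=> 0) _ (mcy t) _ _ ln.
- move=> n; apply/(measurable_restrict _ (mcy n%:R) (mcy t)).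
  exact: (measurable_funS (mcy t) (@subIsetl _ _ _) mn).
- apply: aeW => s _; apply: cvg_near_cst; near=> n.
  rewrite /fn patchE memNset//= in_itv/= andbT; apply/negP; rewrite -ltNge.
  near: n; exact: nbhs_infty_gtr.
- by apply: aeW => s _ n; rewrite /fn patchE; case: ifPn => _; rewrite ?normr0 ?normr_id.
pose n := maxn N (Num.truncn t).+1.
have tn : t <= n%:R.
  by apply/ltW/(lt_le_trans (truncnS_gt t)); rewrite ler_nat leq_maxr.
exists n%:R => // S nS.
have := hN n (leq_maxl _ _); rewrite {1}/Rintegral integral0 sub0r normrN ger0_norm; last first.
  apply: Rintegral_ge0 => s _; rewrite /fn patchE; case: ifPn => //.
apply: le_lt_trans; rewrite /fn -Rintegral_mkcondr.
have -> : `[t, +oo[ `&` `[n%:R, +oo[ = `[n%:R, +oo[%classic.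
  by apply/setIidPr; exact: itvcy_subS.
rewrite (Rint_cy_cat nS (lint_cyS tn ln)) lerDr.
by apply: Rint_itv_ge0.
Unshelve. all: by end_near. Qed.

Lemma Rint_cy_cvg t f : Lint `[t, +oo[ f -> \I_[t, S] f @[S --> +oo] --> \J_ t f.
Proof.
move=> lf; apply/cvgrPdist_lt => e e0.
have [T0 tT0 h] := Rint_cy_tail lf e0.
near=> S; have TS : T0 <= S by near: S; apply: nbhs_pinfty_ge; exact: num_real.
have tS := le_trans tT0 TS.
rewrite (Rint_cy_cat tS lf) addrAC subrr add0r.
apply: le_lt_trans (h S TS); apply: le_normr_Rintegral; first exact: mcy.
exact: lint_cyS lf.
Unshelve. all: by end_near. Qed.

(** The exponential density scaled by [d]: it supplies the strictly positive tolerance that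
    Filippov's theorem demands, with small total mass and small supremum at once. *)
Lemma positive_integrable (d : R) : 0 < d -> exists e : R -> R,
  [/\ forall s, 0 <= s -> 0 < e s, measurable_fun setT (e : T -> R),
      Lint `[0, +oo[ e, \J_ 0 e <= d & forall s, 0 <= s -> e s <= d].
Proof.
move=> d0; pose p : R -> R := exponential_pdf 1.
have mp : measurable_fun (setT : set (measurableTypeR R)) p by exact: measurable_exponential_pdf.
have p0 s : 0 <= p s by exact: exponential_pdf_ge0.
have mpT : measurable_fun (setT : set T) p by exact: borel_lebesgue_fun.
have Ip : (\int[mu]_s (p s)%:E = 1)%E.
  have mpE : measurable_fun (setT : set (measurableTypeR R)) (EFin \o p).
    exact/measurable_EFinP.
  have pE0 s : setT s -> (0 <= (p s)%:E)%E by move=> _; rewrite lee_fin.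
  rewrite -(ge0_integral_clm measurableT mpE pE0).
  exact: integral_exponential_pdf.
have lp : Lint setT p.
  apply/integrableP; split; first exact/measurable_EFinP.
  under eq_integral do rewrite /= ger0_norm//.
  by rewrite Ip ltry.
have lp0 : Lint `[0, +oo[ p by exact: lintS measurableT (mcy 0) (@subsetT _ _) lp.
have Jp : \J_ 0 p <= 1.
  rewrite -[leRHS]/(fine 1%:E) -Ip; apply: fine_le.
  - exact: integrable_fin_num lp0.
  - exact: integrable_fin_num lp.
  - have mpE : measurable_fun (setT : set T) (EFin \o p) by exact/measurable_EFinP.
    have pE0 s : setT s -> (0 <= (EFin \o p) s)%E by move=> _; rewrite lee_fin.
    exact: (@ge0_subset_integral _ _ _ mu _ _ (mcy 0) measurableT _ mpE pE0 (@subsetT _ _)).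
exists (fun s => d * p s); split.
- move=> s s0; rewrite mulr_gt0// /p exponential_pdfE//.
  by rewrite mul1r expR_gt0.
- by apply: measurable_funM => //; exact: measurable_cst.
- exact: lintZ.
- by rewrite RintegralZl// ler_piMr// ltW.
- move=> s s0; rewrite ler_piMr ?(ltW d0)// /p exponential_pdfE//.
  rewrite mul1r mulN1r.
  by rewrite -[leRHS]expR0 ler_expR oppr_le0.
Qed.

End HalfLine.

(** * The value function *)

(** Hypotheses (a) to (g) without the local bound on [l2]; that bound and (h) are assumed in the
    sections where they enter. *)
Record standing {R : realType} {E : completeNormedModType R}
    (L : R -> E -> E -> \bar R) (Gamma : R -> E -> set E) (l1 l2 gamma : R -> R)
    : Prop := Standing {
  st_adm : forall t xi, 0 <= t -> admissible Gamma t xi !=set0;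
  st_meas : forall x y : E,
    measurable_fun (`[0, +oo[%classic : set (lebesgue_type R)) (fun t => L t x y);
  st_l1_ge0 : forall t, 0 <= t -> 0 <= l1 t;
  st_l1_int : completed_lebesgue_measure.-integrable `[0, +oo[ (fun t => (l1 t)%:E);
  st_l2_ge0 : forall t, 0 <= t -> 0 <= l2 t;
  st_l2_int : completed_lebesgue_measure.-integrable `[0, +oo[ (fun t => (l2 t)%:E);
  st_L0 : forall t, 0 <= t -> (`|L t 0%R 0%R| <= (l1 t)%:E)%E;
  st_Llip : forall t x y x' y', 0 <= t ->
    (`|L t x y - L t x' y'| <= (l1 t * `|x - x'| + l2 t * `|y - y'|)%R%:E)%E;
  st_closed : forall t x, 0 <= t -> Gamma t x !=set0 /\ closed (Gamma t x);
  st_lsc : forall x, lsc_multifunction (fun t => Gamma t x);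
  st_gamma_ge0 : forall t, 0 <= t -> 0 <= gamma t;
  st_gamma_int : forall T, 0 <= T ->
    completed_lebesgue_measure.-integrable `[0, T] (fun t => (gamma t)%:E);
  st_Gamma0 : forall t, 0 <= t ->
    Gamma t 0 `<=` [set gamma t *: v | v in [set v | `|v| < 1]];
  st_Glip : forall t x x', 0 <= t ->
    Gamma t x `<=` [set y + (gamma t * `|x - x'|) *: v |
                     y in Gamma t x' & v in [set v | `|v| < 1]];
  st_growth : (\int[completed_lebesgue_measure]_(s in `[0%R, +oo[)
     (let G := (\int[completed_lebesgue_measure]_(tau in `[0%R, s]) gamma tau)%R in
      (expR G * (1 + G) * (l1 s + l2 s * gamma s))%:E) < +oo)%E }.

Lemma ler_norm_base {R : realType} {E : normedModType R} (a b : E) :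
  `|b| <= `|a| + `|b - a|.
Proof. by rewrite -{1}[b](subrK a) addrC ler_normD. Qed.

Section ValueFunction.
Context {R : realType} {E : completeNormedModType R}.
Hypothesis Esep : separable E.
Local Notation mu := (@completed_lebesgue_measure R).
Local Notation T := (lebesgue_type R).
Local Notation Lint D f := (mu.-integrable (D : set T) (EFin \o (f : R -> R))).
Local Notation smeasD D f := (@smeas _ T R E D f).
Variables (L : R -> E -> E -> \bar R) (Gamma : R -> E -> set E) (l1 l2 gamma : R -> R).
Hypothesis hP : standing L Gamma l1 l2 gamma.

Let mcy t : measurable (`[t, +oo[%classic : set T). Proof. exact: lebesgue_itv. Qed.
Let mi r s : measurable (`[r, s]%classic : set T). Proof. exact: lebesgue_itv. Qed.

Definition ell t x y : R := fine (L t x y).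

(** [L t 0 0] is finite by its bound, and the Lipschitz estimate excludes infinite values
    elsewhere. *)
Lemma L_fin t x y : 0 <= t -> L t x y = (ell t x y)%:E.
Proof.
move=> t0; rewrite /ell fineK//.
have h0 : L t 0 0 \is a fin_num.
  by rewrite fin_num_abs; apply: le_lt_trans (st_L0 hP t0) _; rewrite ltry.
have := st_Llip hP x y 0 0 t0; rewrite -(fineK h0).
by case: (L t x y) => [r||] //=; rewrite leye_eq.
Qed.

Lemma ell_lip t x y x' y' : 0 <= t ->
  `|ell t x y - ell t x' y'| <= l1 t * `|x - x'| + l2 t * `|y - y'|.
Proof.
by move=> t0; have := st_Llip hP x y x' y' t0; rewrite !L_fin// -EFinB lee_fin.
Qed.

Lemma ell_00 t : 0 <= t -> `|ell t 0 0| <= l1 t.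
Proof. by move=> t0; have := st_L0 hP t0; rewrite L_fin// lee_fin. Qed.

Lemma ell_bound t x y : 0 <= t -> `|ell t x y| <= l1 t * (1 + `|x|) + l2 t * `|y|.
Proof.
move=> t0; have h1 := ell_lip x y 0 0 t0; have h2 := ell_00 t0.
rewrite !subr0 in h1; rewrite -[ell t x y](subrK (ell t 0 0)).
apply: le_trans (ler_normD _ _) _; rewrite mulrDr mulr1 -addrA addrC.
exact: lerD.
Qed.

(** Two applications of [caratheodory]: in the state with the velocity frozen, then in the
    velocity. *)
Lemma ell_meas t x v : 0 <= t -> smeasD `[t, +oo[ x -> smeasD `[t, +oo[ v ->
  measurable_fun (`[t, +oo[ : set T) (fun s => ell s (x s) (v s)).
Proof.
move=> t0 mx mv.
have mc a b : measurable_fun (`[t, +oo[ : set T) (fun s => ell s a b).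
  have h := measurable_funS (mcy 0) (itvcy_sub t0) (st_meas hP a b).
  exact: (measurableT_comp (@fine_measurable R setT measurableT) h).
apply: (caratheodory Esep (mcy t) (F := fun s y => ell s (x s) y)); last exact: mv.
- move=> b; apply: (caratheodory Esep (mcy t) (F := fun s y => ell s y b)); last exact: mx.
    by move=> a; exact: mc.
  move=> s /=; rewrite in_itv/= andbT => /(le_trans t0) s0.
  apply: (@lip_continuous _ _ _ (l1 s)) => y y'.
  have := ell_lip y b y' b s0; rewrite subrr normr0 mulr0 addr0.
  by move=> /(le_trans (ler_norm _)); rewrite lerBlDl.
- move=> s /=; rewrite in_itv/= andbT => /(le_trans t0) s0.
  apply: (@lip_continuous _ _ _ (l2 s)) => y y'.
  have := ell_lip (x s) y (x s) y' s0; rewrite subrr normr0 mulr0 add0r.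
  by move=> /(le_trans (ler_norm _)); rewrite lerBlDl.
Qed.

Definition cumul s := \I_[0, s] gamma.
Definition weight s := expR (cumul s) * (1 + cumul s) * (l1 s + l2 s * gamma s).

Lemma gamma_int_itv t s : 0 <= t -> Lint `[t, s] gamma.
Proof. exact: (gamma_itv (st_gamma_int hP)). Qed.

Lemma gamma_Rint_ge0 t s : 0 <= t -> 0 <= \I_[t, s] gamma.
Proof.
move=> t0; apply: Rint_itv_ge0 => r tr _; apply: st_gamma_ge0 hP _ _.
exact: le_trans tr.
Qed.

Lemma cumul_ge0 s : 0 <= cumul s.
Proof. exact: gamma_Rint_ge0. Qed.

Lemma le_cumul t s : 0 <= t -> \I_[t, s] gamma <= cumul s.
Proof.
move=> t0; apply: le_Rint_itvS => //; first exact: gamma_int_itv.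
by move=> r r0 _; exact: st_gamma_ge0 hP _ r0.
Qed.

Lemma cumul_meas : measurable_fun (setT : set T) cumul.
Proof.
(* The sign of [gamma] is known at nonnegative times only. *)
pose g := gamma \_ `[0, +oo[.
have gE r : 0 <= r -> g r = gamma r by move=> r0; rewrite /g patchE mem_set//= in_itv/= r0.
rewrite (_ : cumul = fun s => \I_[0, s] g); last first.
  apply/funext => s; apply: eq_Rintegral => r /set_mem /=.
  by rewrite in_itv/= => /andP[r0 _]; rewrite gE.
apply: cumulative_meas => [s|s].
  rewrite /g patchE; case: ifPn => // /set_mem /=; rewrite in_itv/= andbT.
  exact: st_gamma_ge0 hP _.
apply: eq_integrable (gamma_int_itv s (lexx 0)); first exact: mi.
by move=> r /set_mem /=; rewrite in_itv/= => /andP[r0 _]; rewrite gE.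
Qed.

Lemma gamma_meas : measurable_fun (`[0, +oo[ : set T) gamma.
Proof.
move=> mD B mB.
rewrite (_ : _ `&` _ = \bigcup_(n : nat) (`[0, n%:R] `&` gamma @^-1` B)).
  apply: bigcupT_measurable => n.
  exact: (lint_meas (gamma_int_itv n%:R (lexx 0)) (mi 0 n%:R)).
apply/seteqP; split => s /=; rewrite in_itv/=.
  rewrite andbT => -[s0 Bs]; exists (Num.truncn s).+1 => //; split => //.
  by rewrite /= in_itv/= s0/= ltW// truncnS_gt.
by move=> [n _ [/=]]; rewrite in_itv/= => /andP[-> _].
Qed.

Lemma weight_ge0 s : 0 <= s -> 0 <= weight s.
Proof.
move=> s0; rewrite !mulr_ge0 ?expR_ge0 ?addr_ge0 ?cumul_ge0//.
  exact: st_l1_ge0 hP _ s0.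
by rewrite mulr_ge0// ?(st_l2_ge0 hP s0) ?(st_gamma_ge0 hP s0).
Qed.

Lemma weight_int : Lint `[0, +oo[ weight.
Proof.
have mw : measurable_fun (`[0, +oo[ : set T) weight.
  have mG : measurable_fun (`[0, +oo[ : set T) cumul by exact: measurable_funTS cumul_meas.
  apply: measurable_funM; last first.
    apply: measurable_funD; first exact: lint_meas (st_l1_int hP).
    by apply: measurable_funM; [exact: lint_meas (st_l2_int hP)|exact: gamma_meas].
  apply: measurable_funM.
    exact: (measurableT_comp (@measurable_expR R) mG).
  by apply: measurable_funD => //; exact: measurable_cst.
apply/integrableP; split; first exact/measurable_EFinP.
apply: le_lt_trans (st_growth hP).
rewrite le_eqVlt; apply/orP; left; apply/eqP; apply: eq_integral => s /set_mem /=.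
by rewrite in_itv/= andbT => s0; rewrite ger0_norm// weight_ge0.
Qed.

Lemma exp_le_weight s : 0 <= s -> expR (cumul s) * (l1 s + l2 s * gamma s) <= weight s.
Proof.
move=> s0; rewrite /weight ler_wpM2r//.
  by rewrite addr_ge0// ?(st_l1_ge0 hP s0)// mulr_ge0// ?(st_l2_ge0 hP s0) ?(st_gamma_ge0 hP s0).
by rewrite ler_peMr ?expR_ge0// lerDl cumul_ge0.
Qed.

Record atraj t x v : Prop := Atraj {
  at_vel : velocity t x v;
  at_incl : {ae mu, forall s, t <= s -> Gamma s (x s) (v s)} }.

Lemma atraj_restrict t r x v : t <= r -> atraj t x v -> atraj r x v.
Proof.
move=> tr [hv hG]; split; first exact: velocity_restrict hv.
by apply: filterS hG => s h rs; apply: h; exact: le_trans rs.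
Qed.

Lemma Gamma_growth t x y : 0 <= t -> Gamma t x y -> `|y| <= gamma t * (1 + `|x|).
Proof.
move=> t0 Gy; have g0 := st_gamma_ge0 hP t0.
have [y' Gy' yy'] := Gamma_near (st_gamma_ge0 hP) (st_Glip hP) 0 t0 Gy.
rewrite subr0 in yy'.
have [v /= v1 y'E] := st_Gamma0 hP t0 Gy'.
have hy' : `|y'| <= gamma t.
  by rewrite -y'E normrZ ger0_norm// ler_piMr// ltW.
rewrite mulrDr mulr1; apply: le_trans (ler_norm_base y' y) _.
exact: lerD.
Qed.

(** Gronwall's inequality for [1 + |x|], the velocity being dominated by [gamma] times this
    quantity. *)
Lemma atraj_growth t x v s : 0 <= t -> t <= s -> atraj t x v ->
  1 + `|x s| <= (1 + `|x t|) * expR (\I_[t, s] gamma).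
Proof.
move=> t0 ts [hv hG].
have lgu r : t <= r -> Lint `[t, r] (fun p => gamma p * (1 + `|x p|)).
  move=> tr.
  pose M := 1 + `|x t| + \I_[t, r] (fun p => `|v p|).
  apply: (lint_le (mi t r) _ (lintZ M (mi t r) (gamma_int_itv r t0))).
    apply: measurable_funM; first exact: lint_meas (gamma_int_itv r t0).
    apply: measurable_funD; first exact: measurable_cst.
    apply: smeas_norm; apply: (smeasS (mcy t) _ (vel_traj_meas Esep hv)).
    exact: itvcc_itvcy.
  move=> p /=; rewrite in_itv/= => /andP[tp pr].
  have g0 : 0 <= gamma p by apply: st_gamma_ge0 hP _ _; exact: le_trans tp.
  rewrite ger0_norm ?mulr_ge0 ?addr_ge0// mulrC ler_wpM2r// /M -addrA lerD2l.
  apply: le_trans (ler_norm_base (x t) (x p)) _; rewrite lerD2l.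
  apply: le_trans (vel_norm Esep hv (lexx t) tp) _.
  by apply: le_Rint_itvS => //; exact: vel_int hv _ tr.
apply: (gronwall (g := gamma) (u := fun p => 1 + `|x p|)) => //.
- exact: gamma_int_itv.
- by move=> r tr _; apply: st_gamma_ge0 hP _ _; exact: le_trans tr.
- exact: lgu.
move=> r tr rs; rewrite -addrA lerD2l.
apply: le_trans (ler_norm_base (x t) (x r)) _; rewrite lerD2l.
apply: le_trans (vel_norm Esep hv (lexx t) tr) _.
apply: le_Rint_itv_ae; [exact: vel_int hv _ tr|exact: lgu|].
apply: filterS hG => p h tp pr; apply: Gamma_growth; last exact: h.
exact: le_trans tp.
Qed.

(** The running cost is at most [l1 + l2 * gamma] times [1 + |x s|], and the exponential growth of
    the latter is absorbed in [weight]. By (g) every admissible cost is then absolutely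
    integrable. *)
Lemma atraj_cost_bound t x v : 0 <= t -> atraj t x v ->
  {ae mu, forall s, t <= s -> `|ell s (x s) (v s)| <= (1 + `|x t|) * weight s}.
Proof.
move=> t0 h; have [hv hG] := h; apply: filterS hG => s hs ts.
have s0 := le_trans t0 ts.
have a1 := st_l1_ge0 hP s0; have a2 := st_l2_ge0 hP s0; have a3 := st_gamma_ge0 hP s0.
apply: le_trans (ell_bound (x s) (v s) s0) _.
apply: (@le_trans _ _ ((l1 s + l2 s * gamma s) * (1 + `|x s|))).
  rewrite mulrDl lerD2l -mulrA ler_wpM2l//.
  exact: Gamma_growth s0 (hs ts).
apply: (@le_trans _ _ ((1 + `|x t|) * (expR (cumul s) * (l1 s + l2 s * gamma s)))).
  rewrite [leRHS]mulrA [leLHS]mulrC ler_wpM2r ?addr_ge0 ?mulr_ge0//.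
  apply: le_trans (atraj_growth t0 ts h) _.
  have x1 : 0 <= 1 + `|x t| by rewrite addr_ge0.
  by apply: (ler_wpM2l x1); rewrite ler_expR; exact: (le_cumul s t0).
by rewrite ler_wpM2l ?addr_ge0// exp_le_weight.
Qed.

Lemma atraj_cost_int t x v : 0 <= t -> atraj t x v ->
  Lint `[t, +oo[ (fun s => ell s (x s) (v s)).
Proof.
move=> t0 h; have [hv hG] := h.
apply: (lint_cy_le _ (lintZ (1 + `|x t|) (mcy t) (lint_cyS t0 weight_int))).
  exact: (ell_meas t0 (vel_traj_meas Esep hv) (vel_meas hv)).
exact: atraj_cost_bound.
Qed.

Definition cost t x v : R := \J_ t (fun s => ell s (x s) (v s)).

Lemma atraj_cost_le t x v : 0 <= t -> atraj t x v ->
  `|cost t x v| <= (1 + `|x t|) * \J_ t weight.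
Proof.
move=> t0 h; have lc := atraj_cost_int t0 h; have lw := lint_cyS t0 weight_int.
apply: le_trans (le_normr_Rintegral (mcy t) lc) _.
rewrite -(RintegralZl _ (mcy t) lw); apply: le_Rint_cy.
- exact: lint_norm.
- exact: lintZ.
- exact: atraj_cost_bound.
Qed.

Lemma admissible_atraj t xi x : admissible Gamma t xi x -> atraj t x (derive1 x).
Proof. by move=> [hW hG _]; split; [exact: (W11_velocity Esep hW)|exact: hG]. Qed.

Lemma atraj_admissible t x v : atraj t x v ->
  admissible Gamma t (x t) x /\ {ae mu, forall s, t <= s -> derive1 x s = v s}.
Proof.
move=> [hv hG]; have [hW hd] := velocity_W11 Esep hv.
split; last exact: hd; split; [exact: hW| |by []].
by apply: filterS2 hG hd => s h1 h2 ts; rewrite (h2 ts); exact: h1.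
Qed.

Lemma cost_ae t x v w : 0 <= t -> atraj t x v ->
  {ae mu, forall s, t <= s -> w s = v s} -> cost t x w = cost t x v.
Proof.
move=> t0 h vw; apply/esym; apply: (ae_Rint (@clm_complete R) (mcy t)).
  by apply: filterS vw => s vw /=; rewrite in_itv/= andbT => ts; rewrite vw.
exact: lint_meas (atraj_cost_int t0 h).
Qed.

(** The integrand is integrable over the half-line, so the improper integral exists, is unique and
    equals the Lebesgue integral; from here on costs are real numbers. *)
Lemma is_costP t xi x c : 0 <= t -> admissible Gamma t xi x ->
  is_cost L t x c <-> c = (cost t x (derive1 x))%:E.
Proof.
move=> t0 hx; have hat := admissible_atraj hx.
pose g s := ell s (x s) (derive1 x s).
have lg : Lint `[t, +oo[ g by exact: atraj_cost_int.
have LE S : {in `[t, S]%classic, (fun s => L s (x s) (derive1 x s)) =1 EFin \o g}.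
  move=> s /set_mem /=; rewrite in_itv/= => /andP[ts _].
  by rewrite L_fin// (le_trans t0 ts).
have liL S : mu.-integrable (`[t, S]%classic : set T) (fun s => L s (x s) (derive1 x s)).
  apply: eq_integrable (lint_cy_itv S (lexx t) lg); first exact: mi.
  by move=> s /LE ->.
have IE S : (\int[mu]_(s in `[t, S]) L s (x s) (derive1 x s) = (\I_[t, S] g)%:E)%E.
  transitivity (\int[mu]_(s in `[t, S]) (EFin \o g) s)%E.
    by apply: eq_integral => s /LE.
  rewrite fineK//.
  exact: integrable_fin_num (lint_cy_itv S (lexx t) lg).
have cv : (\int[mu]_(s in `[t, S]) L s (x s) (derive1 x s))%E @[S --> +oo] -->
    (cost t x (derive1 x))%:E.
  under eq_cvg do rewrite IE.
  by apply: cvg_EFin; [exact: nearW|exact: Rint_cy_cvg].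
split=> [[_ h]|->].
  exact: (cvg_unique _ h cv).
split; last exact: cv.
move=> S tS; split; first exact: measurable_int (liL S).
by left; apply: (integral_funepos_lt_pinfty (mi t S)); exact: (liL S).
Qed.

End ValueFunction.

(** * Lipschitz continuity of the value function and dynamic programming *)

Section Lipschitz.
Context {R : realType} {E : completeNormedModType R}.
Hypothesis Esep : separable E.
Local Notation mu := (@completed_lebesgue_measure R).
Local Notation T := (lebesgue_type R).
Local Notation Lint D f := (mu.-integrable (D : set T) (EFin \o (f : R -> R))).
Variables (L : R -> E -> E -> \bar R) (Gamma : R -> E -> set E) (l1 l2 gamma : R -> R).
Hypothesis hP : standing L Gamma l1 l2 gamma.

Let mcy t : measurable (`[t, +oo[%classic : set T). Proof. exact: lebesgue_itv. Qed.
Let mi r s : measurable (`[r, s]%classic : set T). Proof. exact: lebesgue_itv. Qed.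

Implicit Types (t r s : R) (xi : E) (x v : R -> E).

Lemma standing_filippov t (a : E) (z w : R -> E) (e : R -> R) : 0 <= t -> velocity t z w ->
  (forall s, t <= s -> 0 < e s) -> measurable_fun (`[t, +oo[ : set T) e ->
  (forall s, t <= s -> Lint `[t, s] e) ->
  (forall s, t <= s -> Lint `[t, s] (fun r => dist_to (Gamma r (z r)) (w r))) ->
  exists x v, [/\ x t = a, atraj Gamma t x v,
    forall s, t <= s -> `|x s - z s| <= expR (\I_[t, s] gamma) * (`|a - z t| +
      \I_[t, s] (fun r => dist_to (Gamma r (z r)) (w r) + e r)) &
    forall s, t <= s -> `|v s - w s| <= dist_to (Gamma s (z s)) (w s) + e s +
      gamma s * (expR (\I_[t, s] gamma) * (`|a - z t| +
      \I_[t, s] (fun r => dist_to (Gamma r (z r)) (w r) + e r)))].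
Proof.
move=> t0 zw e0 me le lr.
have [x [v [h1 h2 h3 h4 h5]]] := filippov Esep (st_closed hP) (st_lsc hP)
  (st_gamma_ge0 hP) (st_gamma_int hP) (st_Glip hP) a t0 zw e0 me le lr.
exists x, v; split=> //; split; first exact: h2.
by apply: aeW => s; exact: h3.
Qed.

Definition V t xi : R := fine (value L Gamma t xi).

Let bound t (xi : E) := (1 + `|xi|) * \J_ t (weight l1 l2 gamma).

Let value_lb t xi : 0 <= t -> ((- bound t xi)%:E <= value L Gamma t xi)%E.
Proof.
move=> t0; apply: le_ereal_inf_tmp => _ [x hx /(is_costP Esep hP _ t0 hx)->].
have hat := admissible_atraj Esep hx; have [_ _ xE] := hx.
have := atraj_cost_le Esep hP t0 hat; rewrite xE ler_norml => /andP[h _].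
by rewrite lee_fin.
Qed.

Let value_le t x v : 0 <= t -> atraj Gamma t x v ->
  (value L Gamma t (x t) <= (cost L t x v)%:E)%E.
Proof.
move=> t0 hx; have [ha hd] := atraj_admissible Esep hx.
apply: ereal_inf_lbound; exists x; first exact: ha.
by apply/(is_costP Esep hP _ t0 ha); rewrite (cost_ae Esep hP t0 hx hd).
Qed.

Lemma atraj_exists t xi : 0 <= t -> exists x v, x t = xi /\ atraj Gamma t x v.
Proof.
move=> t0; have [x hx] := st_adm hP xi t0; exists x, (derive1 x).
by have [_ _ xE] := hx; split; [exact: xE|exact: (admissible_atraj Esep hx)].
Qed.

(** Bounded below by the uniform cost estimate, and above by the cost of any admissible
    trajectory. *)
Lemma value_fin t xi : 0 <= t -> value L Gamma t xi = (V t xi)%:E.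
Proof.
move=> t0; rewrite /V fineK// fin_numE.
have h1 := value_lb xi t0; have [x [v [xE hx]]] := atraj_exists xi t0.
have h2 := value_le t0 hx; rewrite xE in h2.
by move: h1 h2; case: (value L Gamma t xi).
Qed.

Lemma V_le t x v : 0 <= t -> atraj Gamma t x v -> V t (x t) <= cost L t x v.
Proof.
by move=> t0 hx; have := value_le t0 hx; rewrite (value_fin _ t0) lee_fin.
Qed.

Lemma V_near t xi e : 0 <= t -> 0 < e -> exists x v, [/\ x t = xi, atraj Gamma t x v &
  cost L t x v < V t xi + e].
Proof.
move=> t0 e0; have fv : value L Gamma t xi \is a fin_num by rewrite (value_fin _ t0).
have [_ [x hx /(is_costP Esep hP _ t0 hx)->]] := lb_ereal_inf_adherent e0 fv.
rewrite -/(value L Gamma t xi) (value_fin _ t0) -EFinD lte_fin => h.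
exists x, (derive1 x); split; [by have [_ _] := hx|exact: (admissible_atraj Esep hx)|exact: h].
Qed.

Definition lipV t := \J_ t (weight l1 l2 gamma).

Lemma lipV_ge0 t : 0 <= t -> 0 <= lipV t.
Proof.
move=> t0; apply: Rint_cy_ge0 => s ts; apply: (weight_ge0 hP).
exact: le_trans ts.
Qed.

Lemma lipV_cvg0 e : 0 < e -> exists2 T0, 0 <= T0 & forall t, T0 <= t -> lipV t < e.
Proof.
move=> e0; have [T0 T00 h] := Rint_cy_tail (weight_int hP) e0.
exists T0 => // t Tt; apply: le_lt_trans (h t Tt).
apply: le_trans (ler_norm _) (le_normr_Rintegral (mcy t) _).
exact: lint_cyS (le_trans T00 Tt) (weight_int hP).
Qed.

(* Changing the initial point moves a trajectory and its velocity by at most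
   the bounds of Filippov's theorem, which the weight integrates. *)
Lemma V_lip t xi xi' : 0 <= t -> V t xi <= V t xi' + lipV t * `|xi - xi'|.
Proof.
move=> t0; apply/ler_addgt0Pr => eps eps0.
pose a := `|xi - xi'|; pose l2J := \J_ t l2.
have l2J0 : 0 <= l2J.
  by apply: Rint_cy_ge0 => s ts; apply: st_l2_ge0 hP _ _; exact: le_trans ts.
have lK0 := lipV_ge0 t0.
have den0 : 0 < 1 + lipV t + l2J by rewrite -addrA ltr_pwDl// addr_ge0.
(* [d] is at once the near-optimality of [z], the total Filippov tolerance and its pointwise bound;
   the errors are [d], [d * lipV t] and [d * l2J]. *)
pose d := eps / (1 + lipV t + l2J).
have d0 : 0 < d by rewrite divr_gt0.
have [z [w [zE hzw hnear]]] := V_near xi' t0 d0.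
have [e [e0 me le le1 ed]] := positive_integrable d0.
have [hz hG] := hzw.
have rho0 : {ae mu, forall s, t <= s -> dist_to (Gamma s (z s)) (w s) = 0}.
  by apply: filterS hG => s h ts; exact: dist0 (h ts).
have aei s : {ae mu, forall r, `[t, s]%classic r -> 0 = dist_to (Gamma r (z r)) (w r)}.
  by apply: filterS rho0 => r h /=; rewrite in_itv/= => /andP[/h].
have l0 s : Lint `[t, s] (fun=> 0) by exact: lint_itv_cst.
have lrho s : Lint `[t, s] (fun r => dist_to (Gamma r (z r)) (w r)).
  exact: (ae_lint (@clm_complete R) (mi t s) (aei s) (l0 s)).
have le_s s : Lint `[t, s] e by apply: lint_cy_itv le.
have [x [v [xE hx xz vw]]] := standing_filippov xi t0 hz
  (fun s ts => e0 s (le_trans t0 ts)) (measurable_funTS me) (fun s _ => le_s s)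
  (fun s _ => lrho s).
have Ire s : t <= s -> \I_[t, s] (fun r => dist_to (Gamma r (z r)) (w r) + e r) <= d.
  move=> ts; rewrite (RintegralD (mi t s) (lrho s) (le_s s)).
  rewrite -(ae_Rint (@clm_complete R) (mi t s) (aei s) (lint_meas (l0 s))).
  rewrite Rint_itv_cst// mul0r add0r; apply: le_trans le1.
  rewrite (Rint_cy_cat (le_trans t0 ts) le).
  apply: (@le_trans _ _ (\I_[0, s] e)).
    apply: le_Rint_itvS => //; first exact: lint_cy_itv le.
    by move=> r r0 _; rewrite ltW// e0.
  by rewrite lerDl; apply: Rint_cy_ge0 => r sr; rewrite ltW// e0// (le_trans t0)// (le_trans ts).
(* Filippov's bound with the integral of [gamma] enlarged to start at 0, as in [weight]. *)
pose N s := expR (cumul gamma s) * (a + d).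
have NP s : t <= s -> expR (\I_[t, s] gamma) * (`|xi - z t| +
      \I_[t, s] (fun r => dist_to (Gamma r (z r)) (w r) + e r)) <= N s.
  move=> ts; rewrite zE; apply: ler_pM; [exact: expR_ge0| | |].
  - rewrite addr_ge0//; apply: Rint_itv_ge0 => r tr _; rewrite addr_ge0//.
      by apply: dist_ge0; apply: (Gamma_neq0 (st_closed hP)); exact: le_trans tr.
    by rewrite ltW// e0// (le_trans t0 tr).
  - by rewrite ler_expR; exact: (le_cumul hP s t0).
  - by rewrite lerD2l Ire.
have lcx := atraj_cost_int Esep hP t0 hx; have lcz := atraj_cost_int Esep hP t0 hzw.
have lw := lint_cyS t0 (weight_int hP).
have ll2 : Lint `[t, +oo[ l2 := lint_cyS t0 (st_l2_int hP).
have lwl := lintD (mcy t) (lintZ (a + d) (mcy t) lw) (lintZ d (mcy t) ll2).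
have : cost L t x v <= \J_ t (fun s => ell L s (z s) (w s) +
    ((a + d) * weight l1 l2 gamma s + d * l2 s)).
  apply: le_Rint_cy; [exact: lcx|exact: (lintD (mcy t) lcz lwl)|].
  apply: filterS rho0 => s r0 ts; have s0 := le_trans t0 ts.
  have a1 := st_l1_ge0 hP s0; have a2 := st_l2_ge0 hP s0; have a3 := st_gamma_ge0 hP s0.
  have h1 := le_trans (xz s ts) (NP s ts).
  have h2 : `|v s - w s| <= d + gamma s * N s.
    apply: le_trans (vw s ts) _; rewrite (r0 ts) add0r; apply: lerD; first exact: ed.
    by apply: (ler_wpM2l a3); exact: NP.
  have h3 := ell_lip hP (x s) (v s) (z s) (w s) s0.
  have h4 : l1 s * `|x s - z s| + l2 s * `|v s - w s| <=
      (a + d) * weight l1 l2 gamma s + d * l2 s.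
    apply: (@le_trans _ _ (l1 s * N s + l2 s * (d + gamma s * N s))).
      by apply: lerD; [exact: ler_wpM2l|exact: ler_wpM2l].
    have -> : l1 s * N s + l2 s * (d + gamma s * N s) =
        (a + d) * (expR (cumul gamma s) * (l1 s + l2 s * gamma s)) + d * l2 s.
      by rewrite /N; ring.
    rewrite lerD2r; apply: ler_wpM2l; first by apply: addr_ge0; [exact: normr_ge0|exact: ltW].
    exact: (exp_le_weight hP s0).
  by rewrite -lerBlDl; apply: le_trans (ler_norm _) (le_trans h3 h4).
rewrite (RintegralD (mcy t) lcz lwl).
rewrite (RintegralD (mcy t) (lintZ _ (mcy t) lw) (lintZ _ (mcy t) ll2)).
rewrite (RintegralZl _ (mcy t) lw) (RintegralZl _ (mcy t) ll2) -/(lipV t) -/l2J => hc.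
have hV := V_le t0 hx; rewrite xE in hV.
have E1 : eps = d * (1 + lipV t + l2J) by rewrite /d mulfVK// gt_eqF.
rewrite E1; apply: le_trans hV _; apply: le_trans hc _.
have -> : V t xi' + lipV t * `|xi - xi'| + d * (1 + lipV t + l2J) =
   (V t xi' + d) + ((a + d) * lipV t + d * l2J) by rewrite -/a; ring.
by rewrite lerD2r; exact: ltW hnear.
Qed.

(** The given arc is followed up to [r] and continued by a nearly optimal trajectory from [x r]. The
    inclusion is asked on [[t, r]] only, which is what (h) gives for translates of [x0]. *)
Lemma dynamic_programming t r x v : 0 <= t -> t <= r -> velocity t x v ->
  {ae mu, forall s, t <= s -> s <= r -> Gamma s (x s) (v s)} ->
  V t (x t) <= \I_[t, r] (fun s => ell L s (x s) (v s)) + V r (x r).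
Proof.
move=> t0 tr hv hG; have r0 := le_trans t0 tr.
apply/ler_addgt0Pr => eps eps0.
have [y [w [yE hyw hnear]]] := V_near (x r) r0 eps0.
have [hw hGw] := hyw.
have hz := velocity_concat Esep tr (esym yE) hv hw.
pose z s := if s <= r then x s else y s; pose u s := if s <= r then v s else w s.
have zt : z t = x t by rewrite /z tr.
have hzu : atraj Gamma t z u.
  split; first exact: hz.
  apply: filterS2 hG hGw => s h1 h2 ts; rewrite /z /u.
  by case: leP => sr; [exact: h1|apply: h2; exact: ltW].
have lz := atraj_cost_int Esep hP t0 hzu.
have := V_le t0 hzu; rewrite zt => /le_trans; apply.
rewrite -addrA /cost (Rint_cy_cat tr lz); apply: lerD.
  rewrite le_eqVlt; apply/orP; left; apply/eqP; apply: eq_Rintegral => s /set_mem /=.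
  by rewrite in_itv/= /z /u => /andP[_ ->].
apply: le_trans (ltW hnear).
rewrite le_eqVlt; apply/orP; left; apply/eqP.
apply: (ae_Rint (@clm_complete R) (mcy r)); last exact: lint_meas (lint_cyS tr lz).
apply: filterS (ae_neq r) => s sr /=; rewrite in_itv/= andbT /z /u => rs.
by case: leP => // sr'; exfalso; apply: sr; apply/le_anti; rewrite rs sr'.
Qed.

Section Optimal.
Variables (xi : E) (x0 : R -> E).
Hypothesis x0_opt : optimal L Gamma xi x0.
Let v0 := derive1 x0.

Lemma optimal_atraj t : 0 <= t -> atraj Gamma t x0 v0.
Proof.
move=> t0; have [h _ _] := x0_opt.
exact: (atraj_restrict Esep t0 (admissible_atraj Esep h)).
Qed.

(** One inequality is dynamic programming along [x0]; for the other, the tail of [x0] is a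
    competitor from time [t]. *)
Lemma optimal_V t : 0 <= t ->
  V 0 (x0 0) = \I_[0, t] (fun s => ell L s (x0 s) (v0 s)) + V t (x0 t).
Proof.
move=> t0; have [ha hc _] := x0_opt; have [_ _ xE] := ha.
have /(is_costP Esep hP _ (lexx 0) ha) := hc.
rewrite (value_fin _ (lexx 0)) => -[V0]; rewrite xE V0.
have hat := optimal_atraj (lexx 0).
apply/le_anti/andP; split.
  rewrite -V0 -xE; apply: (dynamic_programming (lexx 0) t0 (at_vel hat)).
  by apply: filterS (at_incl hat) => s h s0 _; exact: h.
rewrite /cost (Rint_cy_cat t0 (atraj_cost_int Esep hP (lexx 0) hat)) lerD2l.
exact: (V_le t0 (optimal_atraj t0)).
Qed.

End Optimal.
End Lipschitz.

(** * Dini and Clarke derivatives of Lipschitz functions *)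

Section LimSup.
Context {R : realType}.

Lemma limf_esup_ge {X : choiceType} {Y : filteredType X} (F : set (set Y))
    (f : Y -> \bar R) r :
  (forall A, F A -> exists2 z, A z & (r%:E <= f z)%E) -> (r%:E <= limf_esup f F)%E.
Proof.
move=> h; rewrite limf_esupE; apply: le_ereal_inf_tmp => _ [A FA <-].
have [z Az fz] := h A FA; apply: le_trans fz _.
by apply: ereal_sup_ubound; exists z.
Qed.

Lemma limf_esup_le {X : choiceType} {Y : filteredType X} (F : set (set Y))
    (f : Y -> \bar R) r A :
  F A -> (forall z, A z -> (f z <= r%:E)%E) -> (limf_esup f F <= r%:E)%E.
Proof.
move=> FA h; rewrite limf_esupE; apply: (@le_trans _ _ (ereal_sup (f @` A))).
  by apply: ereal_inf_lbound; exists A.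
by apply: ge_ereal_sup => _ [z Az <-]; exact: h.
Qed.

Lemma limf_esup_near {X : choiceType} {Y : filteredType X} (F : set (set Y))
    (f : Y -> \bar R) r e :
  (limf_esup f F <= r%:E)%E -> 0 < e ->
  exists2 A, F A & forall z, A z -> (f z <= (r + e)%:E)%E.
Proof.
move=> fr e0; have : (limf_esup f F < (r + e)%:E)%E.
  by apply: le_lt_trans fr _; rewrite lte_fin ltrDl.
rewrite limf_esupE => /ereal_inf_lt[_ [A FA <-] h]; exists A => // z Az.
by apply: le_trans (ltW h); apply: ereal_sup_ubound; exists z.
Qed.

Context {E : normedModType R}.

Lemma filter_prod_rightP (v : E) (A : set (E * R)) :
  filter_prod (nbhs v) 0^'+ A <-> exists2 dl, 0 < dl &
    forall u th, `|u - v| < dl -> 0 < th -> th < dl -> A (u, th).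
Proof.
split=> [[[U W] /= [/nbhs_ballP[d1 /= d10 U1] [d2 /= d20 W2]] UW]|[dl dl0 h]].
  exists (Num.min d1 d2); first by rewrite lt_min d10 d20.
  move=> u th; rewrite !lt_min => /andP[u1 _] th0 /andP[_ th2].
  apply: (UW (u, th)); split => /=.
    by apply: U1; rewrite -ball_normE/= distrC.
  by apply: W2 => //=; rewrite sub0r normrN gtr0_norm.
exists ([set u | `|u - v| < dl], [set th | 0 < th /\ th < dl]) => /=.
  split=> /=.
    apply/nbhs_ballP; exists dl => //= u; rewrite -ball_normE/= distrC; exact.
  exists dl => //= th /=; rewrite sub0r normrN => h1 h2; split=> //.
  by rewrite gtr0_norm in h1.
by move=> [u th] /= [h1 [h2 h3]]; exact: h.
Qed.

End LimSup.

Section LipschitzDini.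
Context {R : realType} {E : normedModType R}.
Variables (phi : E -> R) (k : R).
Hypothesis k0 : 0 <= k.
Hypothesis phi_lip : forall x y, phi x <= phi y + k * `|x - y|.
Implicit Types (x v : E) (q : dual E).

Lemma lip_dist x y : `|phi x - phi y| <= k * `|x - y|.
Proof.
have := phi_lip x y; have := phi_lip y x; rewrite (distrC y x) => h1 h2.
by rewrite ler_norml; apply/andP; split; lra.
Qed.

Lemma dini_superdiff_near x q v e : dini_superdiff (EFin \o phi) x q -> 0 < e ->
  exists2 dl, 0 < dl & forall th, 0 < th -> th < dl ->
    phi (x + th *: v) - phi x <= th * (q v + e).
Proof.
move=> [_ /(_ v)] /limf_esup_near/[apply] -[A /filter_prod_rightP[dl dl0 h] hA].
exists dl => // th th0 thdl.
have := hA (v, th); rewrite /diff_quotient/= lee_fin ler_pdivrMr// mulrC; apply.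
by apply: h => //; rewrite subrr normr0.
Qed.

(** The difference quotients in direction [u] are at least [- k * |u|], which bounds [q] from below;
    the upper bound is the same fact at [- v]. *)
Lemma dini_superdiff_bound x q v : dini_superdiff (EFin \o phi) x q ->
  `|q v| <= k * `|v|.
Proof.
move=> hq.
have lb u : - (k * `|u|) <= q u.
  apply/ler_addgt0Pr => e e0.
  have [dl dl0 h] := dini_superdiff_near u hq e0.
  have d2 : 0 < dl / 2 by rewrite divr_gt0.
  have := h (dl / 2) d2; rewrite ltr_pdivrMr// ltr_pMr// ltr1n => /(_ isT) h1.
  have h2 := lip_dist (x + (dl / 2) *: u) x.
  rewrite addrAC subrr add0r normrZ gtr0_norm// in h2.
  have h3 : - (k * (dl / 2 * `|u|)) <= dl / 2 * (q u + e).
    by apply: le_trans h1; move: h2; rewrite ler_norml => /andP[].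
  rewrite mulrCA -mulrN in h3.
  by move: h3; rewrite (ler_pM2l d2).
rewrite ler_norml lb/=; have := lb (- v).
by rewrite linearN/= normrN lerN2.
Qed.

(** For a Lipschitz function the direction may be frozen at [v]: replacing it by [u] changes the
    quotient by at most [k * |u - v|]. *)
Lemma dini_subdiffP x q : dini_subdiff (EFin \o phi) x q <->
  forall v e, 0 < e -> exists2 dl, 0 < dl & forall th, 0 < th -> th < dl ->
    th * (q v - e) <= phi (x + th *: v) - phi x.
Proof.
have negP v r : ((q v)%:E <= - r)%E <-> (r <= (- q v)%:E)%E.
  by rewrite leeNr -EFinN.
split=> [[_ hq] v e e0|h].
  have := hq v; rewrite /dini_lower /limf_einf => /negP hv.
  have [A /filter_prod_rightP[dl dl0 h] hA] := limf_esup_near hv e0.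
  exists dl => // th th0 thdl.
  have := hA (v, th); rewrite /diff_quotient/= => /(_ (h _ _ _ th0 thdl)).
  rewrite subrr normr0 => /(_ dl0).
  rewrite -?EFinN lee_fin lerNl opprD opprK ler_pdivlMr// mulrC.
  by rewrite addrC.
split=> // v; rewrite /dini_lower /limf_einf; apply/negP.
apply/lee_addgt0Pr => e e0; rewrite -EFinD.
have e2 : 0 < e / 2 by rewrite divr_gt0.
have [dl dl0 hdl] := h v (e / 2) e2.
have k1 : 0 < k + 1 by rewrite ltr_wpDl.
apply: (limf_esup_le (A := [set z | `|z.1 - v| < e / 2 / (k + 1) /\ 0 < z.2 /\ z.2 < dl])).
  apply/filter_prod_rightP; exists (Num.min dl (e / 2 / (k + 1))).
    by rewrite lt_min dl0 divr_gt0.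
  by move=> u th; rewrite !lt_min => /andP[_ h1] h2 /andP[h3 _].
move=> [u th] /= [h1 [h2 h3]].
rewrite /diff_quotient/= lee_fin lerNl opprD opprK ler_pdivlMr// mulrC.
have h4 := hdl th h2 h3.
have h5 := lip_dist (x + th *: v) (x + th *: u).
rewrite opprD addrACA subrr add0r -scalerBr normrZ gtr0_norm// (distrC v) in h5.
have h6 : k * (th * `|u - v|) <= th * (e / 2).
  rewrite mulrCA ler_pM2l//; rewrite ltr_pdivlMr// in h1.
  apply: le_trans (ltW h1); rewrite mulrC ler_wpM2l// lerDl ler01//.
have h7 := le_trans (ler_norm _) h5.
have -> : th * (q v - e) = th * (q v - e / 2) - th * (e / 2) by field.
by move: h4 h6 h7; lra.
Qed.

End LipschitzDini.

Section LipschitzClarke.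
Context {R : realType} {E : normedModType R}.
Variables (phi : E -> R) (k : R).
Hypothesis phi_lip : forall x y, phi x <= phi y + k * `|x - y|.
Variable x : E.

Let D v := clarke_derivative (EFin \o phi) x v.

Definition clarke_real v : R := fine (D v).

Lemma clarke_derivative_le v : (D v <= (k * `|v|)%:E)%E.
Proof.
apply: (limf_esup_le (A := [set z : E * R | 0 < z.2])).
  by apply/filter_prod_rightP; exists 1.
move=> [y th] /= th0; rewrite /diff_quotient/= lee_fin ler_pdivrMr//.
have := phi_lip (y + th *: v) y; rewrite addrAC subrr add0r normrZ gtr0_norm//.
by rewrite lerBlDl [th * _]mulrC mulrA.
Qed.

Lemma clarke_derivative_ge v : ((- (k * `|v|))%:E <= D v)%E.
Proof.
apply: limf_esup_ge => A /filter_prod_rightP[dl dl0 h].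
have d2 : 0 < dl / 2 by rewrite divr_gt0.
exists (x, dl / 2).
  by apply: h => //; [rewrite subrr normr0|rewrite ltr_pdivrMr// ltr_pMr// ltr1n].
rewrite /diff_quotient/= lee_fin ler_pdivlMr// mulNr lerNl opprB.
have := phi_lip x (x + (dl / 2) *: v).
rewrite opprD addrA subrr sub0r normrN normrZ (gtr0_norm d2).
by rewrite lerBlDl [dl / 2 * _]mulrC mulrA.
Qed.

Lemma clarke_derivative_fin v : D v = (clarke_real v)%:E.
Proof.
rewrite /clarke_real fineK// fin_numE.
have := clarke_derivative_le v; have := clarke_derivative_ge v.
by case: (D v).
Qed.

Lemma clarke_ub v e : 0 < e -> exists2 dl, 0 < dl & forall y th,
  `|y - x| < dl -> 0 < th -> th < dl -> phi (y + th *: v) - phi y <= th * (clarke_real v + e).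
Proof.
move=> e0; have : (D v <= (clarke_real v)%:E)%E by rewrite clarke_derivative_fin.
move=> /limf_esup_near/(_ e0)[A /filter_prod_rightP[dl dl0 h] hA].
exists dl => // y th yx th0 thdl; have := hA (y, th) (h y th yx th0 thdl).
by rewrite /diff_quotient/= lee_fin ler_pdivrMr// mulrC.
Qed.

Lemma clarke_lub v r dl : 0 < dl -> (forall y th,
  `|y - x| < dl -> 0 < th -> th < dl -> phi (y + th *: v) - phi y <= th * r) ->
  clarke_real v <= r.
Proof.
move=> dl0 h; rewrite -lee_fin -clarke_derivative_fin.
apply: (limf_esup_le (A := [set z | `|z.1 - x| < dl /\ 0 < z.2 /\ z.2 < dl])).
  by apply/filter_prod_rightP; exists dl.
move=> [y th] /= [h1 [h2 h3]]; rewrite /diff_quotient/= lee_fin ler_pdivrMr// mulrC.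
exact: h.
Qed.

Lemma clarke_real_le v : clarke_real v <= k * `|v|.
Proof. by rewrite -lee_fin -clarke_derivative_fin clarke_derivative_le. Qed.

Lemma clarke_real_sublinear : sublinear clarke_real.
Proof.
apply: sublinearW.
- move=> u v; apply/ler_addgt0Pr => e e0.
  have e2 : 0 < e / 2 by rewrite divr_gt0.
  have [d1 d10 h1] := clarke_ub u e2; have [d2 d20 h2] := clarke_ub v e2.
  have v1 : 0 < `|v| + 1 by rewrite ltr_wpDl.
  (* Chosen so that [y + th *: v], the base point of the quotient along [u], remains within [d1] of
     [x]. *)
  pose dl := Num.min (Num.min (d1 / 2) d2) (Num.min d1 (d1 / 2 / (`|v| + 1))).
  have dl0 : 0 < dl by rewrite !lt_min d20 d10 !divr_gt0.
  apply: (clarke_lub dl0) => y th; rewrite !lt_min.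
  move=> /andP[/andP[y1 y2] /andP[_ _]] th0 /andP[/andP[_ t2] /andP[t3 t4]].
  have y1' : `|y + th *: v - x| < d1.
    rewrite addrAC [d1]splitr; apply: le_lt_trans (ler_normD _ _) _.
    rewrite ltrD// normrZ gtr0_norm//; rewrite ltr_pdivlMr// in t4.
    by apply: le_lt_trans t4; rewrite ler_wpM2l ?(ltW th0)// lerDl.
  have := h1 _ _ y1' th0 t3; have := h2 _ _ y2 th0 t2.
  rewrite scalerDr [th *: u + _]addrC addrA => a1 a2.
  have -> : th * (clarke_real u + clarke_real v + e) =
    th * (clarke_real u + e / 2) + th * (clarke_real v + e / 2) by field.
  by move: a1 a2; lra.
- rewrite -lee_fin -clarke_derivative_fin.
  by have := clarke_derivative_ge 0; rewrite normr0 mulr0 oppr0.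
- by have := clarke_real_le 0; rewrite normr0 mulr0.
- move=> a v a0; apply/ler_addgt0Pr => e e0.
  have ea : 0 < e / a by rewrite divr_gt0.
  have [d1 d10 h1] := clarke_ub v ea.
  have dl0 : 0 < Num.min d1 (d1 / a) by rewrite lt_min d10 divr_gt0.
  apply: (clarke_lub dl0) => y th; rewrite !lt_min => /andP[y1 _] th0 /andP[_ t2].
  rewrite ltr_pdivlMr// in t2.
  have := h1 y (th * a) y1 (mulr_gt0 th0 a0) t2.
  rewrite -scalerA -mulrA mulrDr mulrCA mulfV ?gt_eqF// mulr1.
  by rewrite mulrDr.
Qed.

End LipschitzClarke.

(** * Variations of the optimal trajectory *)

Section Fatou.
Context {R : realType}.
Local Notation mu := (@completed_lebesgue_measure R).
Local Notation T := (lebesgue_type R).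
Local Notation Lint D f := (mu.-integrable (D : set T) (EFin \o (f : R -> R))).

(** Reverse Fatou in epsilon form: the positive parts of [g n - F] tend to 0 and are dominated by
    [h + |F|]. *)
Lemma Rint_limsup_le (a b : R) (g : nat -> R -> R) (F h : R -> R) e :
  (forall n, Lint `[a, b] (g n)) -> Lint `[a, b] F -> Lint `[a, b] h ->
  {ae mu, forall s, a <= s -> s <= b -> forall n, `|g n s| <= h s} ->
  {ae mu, forall s, a <= s -> s <= b -> forall e, 0 < e ->
    exists N, forall n, (N <= n)%N -> g n s <= F s + e} ->
  0 < e -> exists N, forall n, (N <= n)%N -> \I_[a, b] (g n) <= \I_[a, b] F + e.
Proof.
move=> lg lF lh gh gF e0.
have mi : measurable (`[a, b]%classic : set T) by exact: lebesgue_itv.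
pose d n s := Num.max (g n s - F s) 0.
have d0 n s : 0 <= d n s by rewrite le_max lexx orbT.
have md n : measurable_fun (`[a, b] : set T) (d n).
  by apply: measurable_maxr; [exact: lint_meas (lintB mi (lg n) lF)|exact: measurable_cst].
have lD : Lint `[a, b] (fun s => h s + `|F s|) := lintD mi lh (lint_norm mi lF).
have dle : {ae mu, forall s, `[a, b]%classic s -> forall n, `|d n s| <= h s + `|F s|}.
  apply: filterS gh => s hs /=; rewrite in_itv/= => /andP[as_ sb] n.
  have h1 := hs as_ sb n; rewrite (ger0_norm (d0 n s)) ge_max; apply/andP; split.
    apply: le_trans (ler_norm _) _; apply: le_trans (ler_normB _ _) _.
    by rewrite lerD2r.
  by rewrite addr_ge0// (le_trans _ h1).
have [|_ /cvgrPdist_le/(_ e e0)[N _ hN]] := lint_dominated (@clm_complete R) mi md _ lD dle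
    (f := fun=> 0).
  apply: filterS gF => s hs /=; rewrite in_itv/= => /andP[as_ sb].
  apply/cvgrPdist_le => r r0; have [N hN] := hs as_ sb r r0.
  exists N => // n /= Nn; rewrite sub0r normrN (ger0_norm (d0 n s)) ge_max.
  by rewrite lerBlDl hN//= ltW.
have ldn n : Lint `[a, b] (d n).
  apply: (lint_le_ae (@clm_complete R) mi (md n) lD).
  by apply: filterS dle => s hs /hs; exact.
exists N => n Nn; have := hN n Nn.
rewrite {1}/Rintegral integral0 sub0r normrN ger0_norm; last by apply: Rint_itv_ge0.
move=> hn; apply: (@le_trans _ _ (\I_[a, b] (fun s => F s + d n s))).
  apply: le_Rint_itv; [exact: lg|exact: (lintD mi lF (ldn n))|].
  by move=> s _ _; rewrite -lerBlDl le_max lexx.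
by rewrite (RintegralD mi lF (ldn n)) lerD2l.
Qed.

(** [g] is at most [m] plus its excess over [m]. The total length controls the first part; the
    second is integrated at most once over [[0, tau]], as the intervals are disjoint. *)
Lemma Rint_abs_cont (g : R -> R) (tau e : R) : Lint `[0, tau] g ->
  (forall s, 0 <= s -> 0 <= g s) -> 0 < e ->
  exists2 dl, 0 < dl & forall (n : nat) (a b : 'I_n -> R),
    (forall i, 0 <= a i /\ a i <= b i /\ b i <= tau) ->
    (forall i j, i != j -> `]a i, b i[ `&` `]a j, b j[ = set0) ->
    \sum_(i < n) (b i - a i) < dl ->
    \sum_(i < n) \I_[(a i), (b i)] g < e.
Proof.
move=> lg g0 e0; have mi a b : measurable (`[a, b]%classic : set T) by exact: lebesgue_itv.
have [m [lh hlt]] := lint_excess_small (@clm_complete R) (mi 0 tau) lg (divr_gt0 e0 (ltr0n R 2)).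
set h := (fun x => Num.max _ _) in lh hlt.
have h0 s : 0 <= h s by rewrite le_max lexx orbT.
exists (e / 2 / m.+1%:R); first by rewrite !divr_gt0.
move=> n a b ab dj sd.
pose k i s := h s * \1_(`]a i, b i[%classic) s.
have lk i : Lint `[0, tau] (k i).
  apply: (lint_le (mi 0 tau) _ lh).
    apply: measurable_funM; first exact: lint_meas lh.
    by apply: measurable_indic; exact: lebesgue_itv.
  move=> s _; rewrite /k indicE; case: (_ \in _); rewrite ?mulr1 ?mulr0 ?normr0//.
  by rewrite ger0_norm.
have hk i : \I_[(a i), (b i)] g <= \I_[0, tau] (k i) + m%:R * (b i - a i).
  have [a0 [aib bt]] := ab i.
  have lgi : Lint `[a i, b i] g by exact: lint_itvS lg.
  have lki : Lint `[a i, b i] (k i) by exact: lint_itvS (lk i).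
  apply: (@le_trans _ _ (\I_[(a i), (b i)] (fun s => k i s + m%:R))); last first.
    rewrite (RintegralD (mi _ _) lki (lint_itv_cst _ _ _)) Rint_itv_cst// lerD2r.
    apply: (le_Rint_itvS a0 bt (lk i)) => s _ _.
    by apply: mulr_ge0; [exact: h0|rewrite indicE; exact: ler0n].
  apply: le_Rint_itv_ae; [exact: lgi|exact: (lintD (mi _ _) lki (lint_itv_cst _ _ _))|].
  apply: filterS2 (ae_neq (a i)) (ae_neq (b i)) => s sa sb as_ sb_.
  rewrite /k indicE mem_set ?mulr1; last first.
    rewrite /= in_itv/= !lt_neqAle as_ sb_ !andbT; apply/andP; split; apply/eqP => //.
    by move=> /esym.
  by rewrite -lerBlDr le_max lexx.
have [_ sumk] := Rint_sum (mi 0 tau) (index_enum 'I_n) lk.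
apply: (@le_lt_trans _ _ (\I_[0, tau] h + m%:R * \sum_(i < n) (b i - a i))).
  apply: (@le_trans _ _ (\sum_(i < n) (\I_[0, tau] (k i) + m%:R * (b i - a i)))).
    by apply: ler_sum => i _; exact: hk.
  rewrite big_split/= -mulr_sumr lerD2r -sumk.
  apply: le_Rint_itv; [exact: (Rint_sum (mi 0 tau) _ lk).1|exact: lh|].
  move=> s _ _; have [[i si]|nsi] := pselect (exists i, `]a i, b i[%classic s).
    rewrite (bigD1 i)//= big1 ?addr0 => [|j ji].
      by rewrite /k indicE mem_set// mulr1.
    rewrite /k indicE memNset ?mulr0// => sj.
    by have := dj _ _ ji; rewrite -subset0 => /(_ s (conj sj si)).
  rewrite big1 // => i _; rewrite /k indicE memNset ?mulr0// => si.
  by apply: nsi; exists i.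
rewrite [e]splitr; apply: ltr_leD => //.
rewrite ltr_pdivlMr// in sd; apply: le_trans (ltW sd).
rewrite mulrC ler_wpM2l ?ler_nat// sumr_ge0// => i _.
by have [_ [aib _]] := ab i; rewrite subr_ge0.
Qed.

End Fatou.

Section Sensitivity.
Context {R : realType} {E : completeNormedModType R}.
Hypothesis Esep : separable E.
Local Notation mu := (@completed_lebesgue_measure R).
Local Notation T := (lebesgue_type R).
Local Notation Lint D f := (mu.-integrable (D : set T) (EFin \o (f : R -> R))).
Variables (L : R -> E -> E -> \bar R) (Gamma : R -> E -> set E) (l1 l2 gamma : R -> R).
Hypothesis hP : standing L Gamma l1 l2 gamma.

Let mcy t : measurable (`[t, +oo[%classic : set T). Proof. exact: lebesgue_itv. Qed.
Let mi r s : measurable (`[r, s]%classic : set T). Proof. exact: lebesgue_itv. Qed.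
Variables (xi : E) (x0 : R -> E).
Hypothesis x0_opt : optimal L Gamma xi x0.
Hypothesis Hh : forall S, 0 < S -> exists2 eta, 0 < eta &
  {ae mu, forall t : R, 0 <= t <= S ->
    forall v, `|v| < 1 -> Gamma t (x0 t + eta *: v) (derive1 x0 t)}.
Implicit Types (t s th : R) (v : E).
Let v0 := derive1 x0.

Let lc : Lint `[0, +oo[ (fun s => ell L s (x0 s) (v0 s)).
Proof. exact: (atraj_cost_int Esep hP (lexx 0) (optimal_atraj Esep x0_opt (lexx 0))). Qed.

Definition quotL th v s :=
  th^-1 * (ell L s (x0 s + th *: v) (v0 s) - ell L s (x0 s) (v0 s)).

Lemma quotL_bound th v s : 0 < th -> 0 <= s -> `|quotL th v s| <= l1 s * `|v|.
Proof.
move=> th0 s0; rewrite /quotL normrM (gtr0_norm (_ : 0 < th^-1)) ?invr_gt0//.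
rewrite ler_pdivrMl//; have := ell_lip hP (x0 s + th *: v) (v0 s) (x0 s) (v0 s) s0.
rewrite subrr normr0 mulr0 addr0 addrAC subrr add0r normrZ (gtr0_norm th0).
by rewrite mulrCA.
Qed.

Lemma quotL_int th v t : 0 < th -> 0 <= t -> Lint `[0, t] (quotL th v).
Proof.
move=> th0 t0; have hv := at_vel (optimal_atraj Esep x0_opt (lexx 0)).
apply: (lint_le (mi 0 t) _ (lintZ `|v| (mi 0 t) (lint_cy_itv t (lexx 0) (st_l1_int hP)))).
  apply: (measurable_funS (mcy 0) (itvcc_itvcy (lexx 0))).
  apply: measurable_funM; first exact: measurable_cst.
  apply: measurable_funB; last exact: lint_meas lc.
  exact: (ell_meas Esep hP (lexx 0)
    (vel_traj_meas Esep (velocity_translate (th *: v) hv)) (vel_meas hv)).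
move=> s /=; rewrite in_itv/= => /andP[s0 _].
by rewrite mulrC; exact: quotL_bound.
Qed.

(* By (h) the translate of the optimal trajectory by a small vector is
   admissible on [0, t]. *)
Lemma value_variation t v : 0 <= t -> exists2 dl, 0 < dl & forall th, 0 < th -> th < dl ->
  V L Gamma 0 (x0 0 + th *: v) - V L Gamma 0 (x0 0) <=
  th * \I_[0, t] (quotL th v) + (V L Gamma t (x0 t + th *: v) - V L Gamma t (x0 t)).
Proof.
(* [t + 1] is a positive horizon for (h) even when [t = 0]. *)
move=> t0; have t1 : 0 < t + 1 by rewrite ltr_wpDl.
have [eta eta0 hG] := Hh t1.
have v1 : 0 < `|v| + 1 by rewrite ltr_wpDl.
exists (eta / (`|v| + 1)); first by rewrite divr_gt0.
move=> th th0 thdl; rewrite ltr_pdivlMr// in thdl.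
have hv := at_vel (optimal_atraj Esep x0_opt (lexx 0)).
(* (h) allows [eta] times vectors of the open unit ball; writing [th *: v] in this form dictates the
   bound on [th]. *)
have thv : `|(th / eta) *: v| < 1.
  rewrite normrZ gtr0_norm ?divr_gt0// mulrAC ltr_pdivrMr// mul1r.
  by apply: le_lt_trans thdl; rewrite ler_pM2l// lerDl.
have := dynamic_programming Esep hP (lexx 0) t0 (velocity_translate (th *: v) hv).
have aeG : {ae mu, forall s, 0 <= s -> s <= t -> Gamma s (x0 s + th *: v) (v0 s)}.
  apply: filterS hG => s h s0 st; have := h _ ((th / eta) *: v) thv.
  rewrite scalerA mulrC mulfVK ?gt_eqF//; apply.
  by rewrite s0/= (le_trans st)// lerDl.
move=> /(_ aeG); rewrite (optimal_V Esep hP x0_opt t0).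
have l0 : Lint `[0, t] (fun s => ell L s (x0 s) (v0 s)) by exact: lint_cy_itv lc.
have lq := quotL_int v th0 t0.
have -> : \I_[0, t] (fun s => ell L s (x0 s + th *: v) (v0 s)) =
    th * \I_[0, t] (quotL th v) + \I_[0, t] (fun s => ell L s (x0 s) (v0 s)).
  rewrite -(RintegralZl _ (mi 0 t) lq) -(RintegralD (mi 0 t) (lintZ th (mi 0 t) lq) l0).
  apply: eq_Rintegral => s _; rewrite /quotL mulrA mulfV ?gt_eqF// mul1r subrK//.
by move: (V L Gamma t) (V L Gamma 0) => A B; lra.
Qed.

Let value0E t : 0 <= t -> value L Gamma t = EFin \o V L Gamma t.
Proof. by move=> t0; apply/funext => y; exact: (value_fin Esep hP). Qed.

Let Vlip t : 0 <= t -> forall y y', V L Gamma t y <= V L Gamma t y' +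
  lipV l1 l2 gamma t * `|y - y'|.
Proof. by move=> t0 y y'; exact: (V_lip Esep hP). Qed.

Let lipV0 t : 0 <= t -> 0 <= lipV l1 l2 gamma t.
Proof. exact: (lipV_ge0 hP). Qed.

(** Common input of both uses of Fatou: [th] is still free, so that steps adapted to [V] at time [t]
    can be inserted. *)
Lemma subdiff_value_variation t xs v e : 0 <= t ->
  dini_subdiff (value L Gamma 0) (x0 0) xs -> 0 < e ->
  exists2 dl, 0 < dl & forall th, 0 < th -> th < dl ->
    th * (xs v - e) <= th * \I_[0, t] (quotL th v) +
      (V L Gamma t (x0 t + th *: v) - V L Gamma t (x0 t)).
Proof.
move=> t0; rewrite (value0E (lexx 0)).
move=> /(dini_subdiffP (lipV0 (lexx 0)) (Vlip (lexx 0)))/(_ v e)/[apply] -[d1 d10 h1].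
have [d2 d20 h2] := value_variation v t0.
exists (Num.min d1 d2); first by rewrite lt_min d10.
move=> th th0; rewrite lt_min => /andP[t1 t2].
exact: le_trans (h1 th th0 t1) (h2 th th0 t2).
Qed.

End Sensitivity.

(** * The adjoint arc *)

Section LowerQuotient.
Context {R : realType} {E : normedModType R}.
Variables (phi : E -> R) (k : R).
Hypothesis k0 : 0 <= k.
Hypothesis phi_lip : forall x y, phi x <= phi y + k * `|x - y|.
Variable x : E.

Let freq v := [set r | forall dl, 0 < dl -> exists th,
  [/\ 0 < th, th < dl & phi (x + th *: v) - phi x <= th * r]].

(** The lower Dini derivative in the fixed direction [v], that is, the liminf of the quotients as
    [th] decreases to 0: [freq v] collects the slopes that bound the quotient from above for
    arbitrarily small [th]. *)
Definition lower_quotient v : R := inf (freq v).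

Let half (dl : R) : 0 < dl -> 0 < dl / 2 /\ dl / 2 < dl.
Proof. by move=> dl0; rewrite divr_gt0// ltr_pdivrMr// ltr_pMr// ltr1n. Qed.

Let freq_ub v : freq v (k * `|v|).
Proof.
move=> dl /half[d1 d2]; exists (dl / 2); split=> //.
have := phi_lip (x + (dl / 2) *: v) x; rewrite addrAC subrr add0r normrZ gtr0_norm//.
by rewrite lerBlDl mulrCA.
Qed.

Let freq_lb v : lbound (freq v) (- (k * `|v|)).
Proof.
move=> r /(_ 1 ltr01)[th [th0 _ h]].
have := phi_lip x (x + th *: v); rewrite opprD addrA subrr sub0r normrN normrZ gtr0_norm//.
rewrite mulrCA => h2; rewrite -(ler_pM2l th0) mulrN.
by move: h h2; set A := phi _; set B := phi x; set C := th * (k * _); lra.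
Qed.

Lemma lower_quotient_freq v e dl : 0 < e -> 0 < dl -> exists th,
  [/\ 0 < th, th < dl & phi (x + th *: v) - phi x <= th * (lower_quotient v + e)].
Proof.
move=> e0 dl0.
have hi : has_inf (freq v).
  by split; [exists (k * `|v|); exact: freq_ub|exists (- (k * `|v|)); exact: freq_lb].
have [r fr re] := inf_adherent e0 hi.
have [th [th0 thd h]] := fr dl dl0; exists th; split=> //.
by apply: le_trans h _; rewrite ler_pM2l// ltW.
Qed.

Lemma lower_quotient_near v r : r < lower_quotient v -> exists2 dl, 0 < dl &
  forall th, 0 < th -> th < dl -> th * r <= phi (x + th *: v) - phi x.
Proof.
move=> rl; apply: contrapT => h.
suff : freq v r.
  move=> fr; have : lower_quotient v <= r.
    by apply: ge_inf => //; exists (- (k * `|v|)); exact: freq_lb.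
  by rewrite leNgt rl.
move=> dl dl0; apply: contrapT => h2; apply: h; exists dl => // th th0 thd.
rewrite leNgt; apply/negP => h3; apply: h2; exists th; split=> //; exact: ltW.
Qed.

Lemma lower_quotient_le v : lower_quotient v <= k * `|v|.
Proof. by apply: ge_inf; [exists (- (k * `|v|)); exact: freq_lb|exact: freq_ub]. Qed.

Lemma lower_quotientZ a v : 0 < a -> lower_quotient (a *: v) = a * lower_quotient v.
Proof.
have le b u : 0 < b -> lower_quotient (b *: u) <= b * lower_quotient u.
  move=> b0; rewrite -ler_pdivrMl//; apply: lb_le_inf.
    by exists (k * `|u|); exact: freq_ub.
  move=> r fr; rewrite ler_pdivrMl//; apply: ge_inf.
    by exists (- (k * `|b *: u|)); exact: freq_lb.
  move=> dl dl0; have [th [th0 thd h]] := fr (dl * b) (mulr_gt0 dl0 b0).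
  exists (th / b); rewrite divr_gt0// ltr_pdivrMr//; split=> //.
  by rewrite scalerA mulfVK ?gt_eqF// mulrA mulfVK ?gt_eqF.
move=> a0; apply/le_anti; rewrite le//=.
have := le a^-1 (a *: v); rewrite invr_gt0 => /(_ a0).
by rewrite scalerA mulVf ?gt_eqF// scale1r ler_pdivlMl.
Qed.

Lemma lower_quotient_subdiff (q : dual E) : (forall v, q v <= lower_quotient v) ->
  dini_subdiff (EFin \o phi) x q.
Proof.
move=> h; apply/(dini_subdiffP k0 phi_lip) => v e e0.
apply: lower_quotient_near; apply: lt_le_trans (h v); rewrite ltrBlDr ltrDl//.
Qed.

Lemma dini_subdiff_norm (q : dual E) : dini_subdiff (EFin \o phi) x q -> `|q| <= k.
Proof.
move=> /(dini_subdiffP k0 phi_lip) hq.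
have le v : q v <= k * `|v|.
  apply/ler_addgt0Pr => e e0; have [dl dl0 h] := hq v e e0.
  have [d1 d2] := half dl0; have := h _ d1 d2.
  have := phi_lip (x + (dl / 2) *: v) x; rewrite addrAC subrr add0r normrZ gtr0_norm//.
  rewrite -lerBlDl mulrCA => a1 a2; have := le_trans a2 a1.
  by rewrite ler_pM2l// lerBlDr.
apply: dual_norm_le => v v1; apply: (@le_trans _ _ (k * `|v|)).
  rewrite ler_norml le andbT lerNl.
  by have := le (- v); rewrite linearN/= normrN.
by rewrite ler_piMr.
Qed.

End LowerQuotient.

Section Adjoint.
Context {R : realType} {E : completeNormedModType R}.
Hypothesis Esep : separable E.
Local Notation mu := (@completed_lebesgue_measure R).
Local Notation T := (lebesgue_type R).
Local Notation Lint D f := (mu.-integrable (D : set T) (EFin \o (f : R -> R))).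
Variables (L : R -> E -> E -> \bar R) (Gamma : R -> E -> set E) (l1 l2 gamma : R -> R).
Hypothesis hP : standing L Gamma l1 l2 gamma.

Let mcy t : measurable (`[t, +oo[%classic : set T). Proof. exact: lebesgue_itv. Qed.
Let mi r s : measurable (`[r, s]%classic : set T). Proof. exact: lebesgue_itv. Qed.
Variables (xi : E) (x0 : R -> E).
Hypothesis x0_opt : optimal L Gamma xi x0.
Hypothesis Hh : forall S, 0 < S -> exists2 eta, 0 < eta &
  {ae mu, forall t : R, 0 <= t <= S ->
    forall v, `|v| < 1 -> Gamma t (x0 t + eta *: v) (derive1 x0 t)}.
Implicit Types (t s th : R) (v : E).
Let v0 := derive1 x0.
Let quot := quotL L x0.

Let LE s y : 0 <= s -> (fun x => L s x y) = EFin \o (fun x => ell L s x y).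
Proof. by move=> s0; apply/funext => x; exact: (L_fin hP). Qed.

Let ell_lip1 s y : 0 <= s -> forall x x',
  ell L s x y <= ell L s x' y + l1 s * `|x - x'|.
Proof.
move=> s0 x x'; rewrite -lerBlDl; apply: le_trans (ler_norm _) _.
by have := ell_lip hP x y x' y s0; rewrite subrr normr0 mulr0 addr0.
Qed.

Lemma superdiff_norm s q v : 0 <= s ->
  dini_superdiff (fun x => L s x (v0 s)) (x0 s) q -> `|q v| <= l1 s * `|v|.
Proof.
move=> s0; rewrite (LE _ s0); apply: dini_superdiff_bound.
exact: ell_lip1.
Qed.

Lemma superdiff_quotL s q v e : 0 <= s ->
  dini_superdiff (fun x => L s x (v0 s)) (x0 s) q -> 0 < e ->
  exists2 dl, 0 < dl & forall th, 0 < th -> th < dl -> quot th v s <= q v + e.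
Proof.
move=> s0; rewrite (LE _ s0) => /dini_superdiff_near h /(h v)[dl dl0 {}h].
exists dl => // th th0 thd; rewrite /quot /quotL ler_pdivrMl//.
exact: h.
Qed.

Lemma superdiff_quotL_seq s q v e (th : nat -> R) : 0 <= s ->
  dini_superdiff (fun x => L s x (v0 s)) (x0 s) q -> 0 < e ->
  (forall n, 0 < th n /\ th n < n.+1%:R^-1) ->
  exists N, forall n, (N <= n)%N -> quot (th n) v s <= q v + e.
Proof.
move=> s0 hq e0 hth; have [dl dl0 h] := superdiff_quotL v s0 hq e0.
have [N _ hN] := near_infty_natSinv_lt (PosNum dl0).
exists N => n Nn; have [th0 thn] := hth n; apply: h => //.
exact: lt_trans thn (hN n Nn).
Qed.

Let value0E t : 0 <= t -> value L Gamma t = EFin \o V L Gamma t.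
Proof. by move=> t0; apply/funext => y; exact: (value_fin Esep hP). Qed.

Let Vlip t : 0 <= t -> forall y y', V L Gamma t y <= V L Gamma t y' +
  lipV l1 l2 gamma t * `|y - y'|.
Proof. by move=> t0 y y'; exact: (V_lip Esep hP). Qed.

Let lipV0 t : 0 <= t -> 0 <= lipV l1 l2 gamma t.
Proof. exact: (lipV_ge0 hP). Qed.

Let l1i t : Lint `[0, t] l1.
Proof. exact: (lint_cy_itv t (lexx 0) (st_l1_int hP)). Qed.

Lemma value_subdiff_norm t q : 0 <= t -> dini_subdiff (value L Gamma t) (x0 t) q ->
  `|q| <= lipV l1 l2 gamma t.
Proof.
by move=> t0; rewrite (value0E t0); apply: dini_subdiff_norm; [exact: lipV0|exact: Vlip].
Qed.

Section Selector.
Variables (xs : dual E) (f : R -> dual E).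
Hypothesis hxs : dini_subdiff (value L Gamma 0) (x0 0) xs.
Hypothesis mf : weakly_star_measurable f.
Hypothesis hf : {ae mu, forall t : R, 0 <= t ->
  dini_superdiff (fun x => L t x (v0 t)) (x0 t) (f t)}.

Lemma selector_int t v : Lint `[0, t] (fun s => f s v).
Proof.
apply: (lint_le_ae (@clm_complete R) (mi 0 t) _ (lintZ `|v| (mi 0 t) (l1i t))).
  exact: (measurable_funS (mcy 0) (itvcc_itvcy (lexx 0)) (mf v)).
apply: filterS hf => s h /=; rewrite in_itv/= => /andP[s0 _].
by rewrite mulrC; exact: superdiff_norm s0 (h s0).
Qed.

Lemma selector_increment a b v : 0 <= a -> a <= b ->
  \I_[0, b] (fun s => f s v) - \I_[0, a] (fun s => f s v) = \I_[a, b] (fun s => f s v).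
Proof.
by move=> a0 ab; rewrite (Rint_cat a0 ab (selector_int b v)) addrAC subrr add0r.
Qed.

Lemma selector_increment_le a b v : 0 <= a -> a <= b ->
  \I_[a, b] (fun s => f s v) <= \I_[a, b] l1 * `|v|.
Proof.
move=> a0 ab; have li : Lint `[a, b] l1 by apply: lint_itvS (l1i b).
have lf : Lint `[a, b] (fun s => f s v) by apply: lint_itvS (selector_int b v).
rewrite -(RintegralZr _ (mi a b) li).
have lz : Lint `[a, b] (fun s => l1 s * `|v|).
  by have := lintZ `|v| (mi a b) li; apply: eq_integrable => // s _ /=; rewrite mulrC.
apply: le_Rint_itv_ae => //.
apply: filterS hf => s h as_ _; have s0 := le_trans a0 as_.
exact: le_trans (ler_norm _) (superdiff_norm v s0 (h s0)).
Qed.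

(** The scalar integrals are linear in [v] and at most the integral of [l1] times [|v|], so they
    form a continuous functional. *)
Lemma gelfand_exists : exists Q : R -> dual E, forall t, 0 <= t ->
  forall v, Q t v = \I_[0, t] (fun s => f s v).
Proof.
have ex t : exists q : dual E, 0 <= t -> forall v, q v = \I_[0, t] (fun s => f s v).
  have [t0|t0] := leP 0 t; last by exists 0.
  have [||q qE _] := @dual_of_bounded R E (fun v => \I_[0, t] (fun s => f s v)) (\I_[0, t] l1).
  - move=> a u v.
    rewrite /GRing.scale/= -(RintegralZl a (mi 0 t) (selector_int t u)).
    rewrite -(RintegralD (mi 0 t) (lintZ a (mi 0 t) (selector_int t u)) (selector_int t v)).
    by apply: eq_Rintegral => s _; rewrite linearP.
  - by move=> v; apply: selector_increment_le.
  by exists q => _ v; rewrite qE.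
by have [Q hQ] := choice ex; exists Q.
Qed.

Variable Q : R -> dual E.
Hypothesis hQ : forall t, 0 <= t -> forall v, Q t v = \I_[0, t] (fun s => f s v).

Lemma adjoint_increment_norm a b : 0 <= a -> a <= b -> `|Q b - Q a| <= \I_[a, b] l1.
Proof.
move=> a0 ab; have b0 := le_trans a0 ab.
have I0 : 0 <= \I_[a, b] l1.
  by apply: Rint_itv_ge0 => s as_ _; apply: (st_l1_ge0 hP); exact: le_trans as_.
have le v : (Q b - Q a) v <= \I_[a, b] l1 * `|v|.
  rewrite dualB (hQ b0) (hQ a0) (selector_increment v a0 ab).
  exact: selector_increment_le.
apply: dual_norm_le => v v1; apply: (@le_trans _ _ (\I_[a, b] l1 * `|v|)).
  rewrite ler_norml le andbT lerNl.
  by have := le (- v); rewrite linearN/= normrN.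
by rewrite ler_piMr.
Qed.

(** By contradiction: along some [th n] tending to 0 the increment of [V] at time [t] is too small.
    Reverse Fatou replaces the quotients of [L] along this sequence by the integral of [f], which
    contradicts the subgradient inequality at time 0. *)
Lemma adjoint_subdiff t : 0 <= t -> dini_subdiff (value L Gamma t) (x0 t) (xs - Q t).
Proof.
move=> t0; rewrite (value0E t0); apply/(dini_subdiffP (lipV0 t0) (Vlip t0)) => v e e0.
apply: contrapT => hn.
have ex (n : nat) : exists th, [/\ 0 < th, th < n.+1%:R^-1 &
    V L Gamma t (x0 t + th *: v) - V L Gamma t (x0 t) < th * ((xs - Q t) v - e)].
  apply: contrapT => hn2; apply: hn; exists n.+1%:R^-1; first by rewrite invr_gt0.
  move=> th th0 thn; rewrite leNgt; apply/negP => hlt; apply: hn2.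
  by exists th; split.
have [th hth] := choice ex.
have e2 : 0 < e / 2 by rewrite divr_gt0.
have [dl dl0 hdl] := subdiff_value_variation Esep hP x0_opt Hh v t0 hxs e2.
have [N1 _ hN1] := near_infty_natSinv_lt (PosNum dl0).
have [||N2 hN2] := @Rint_limsup_le R 0 t (fun n => quot (th n) v) (fun s => f s v)
  (fun s => `|v| * l1 s) (e / 2)
  (fun n => quotL_int Esep hP x0_opt v (let: And3 h _ _ := hth n in h) t0)
  (selector_int t v) (lintZ `|v| (mi 0 t) (l1i t)) _ _ e2.
- apply: aeW => s s0 _ n; rewrite mulrC; apply: (quotL_bound hP) => //.
  by have [] := hth n.
- apply: filterS hf => s h s0 _ r r0; apply: superdiff_quotL_seq => //; first exact: h.
  by move=> n; have [] := hth n.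
pose n := maxn N1 N2; have [h1 h2 h3] := hth n.
have h4 := hN2 n (leq_maxr _ _).
have h5 := hdl _ h1 (lt_trans h2 (hN1 n (leq_maxl _ _))).
(* The subgradient inequality and Fatou lose [e / 2] each, together the [e] of the supposed
   violation. *)
have : th n * (xs v - e / 2) < th n * (xs v - Q t v + (Q t v + e / 2) - e).
  apply: le_lt_trans h5 _; apply: (@lt_le_trans _ _
    (th n * \I_[0, t] (quotL L x0 (th n) v) + th n * ((xs - Q t) v - e))).
    by rewrite ltrD2l.
  rewrite -mulrDr (ler_pM2l h1) dualB (hQ t0); move: h4; rewrite /quot.
  by move: (\I_[0, t] (quotL L x0 (th n) v)) (\I_[0, t] (fun s => f s v)) (xs v) => A B C; lra.
by rewrite (ltr_pM2l h1) (_ : _ - e = xs v - e / 2) ?ltxx//; field.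
Qed.

End Selector.
End Adjoint.

Lemma eventually_sum_le (R : realType) (I : Type) (l : seq I) (u : I -> nat -> R) (c : I -> R) :
  (forall i, exists N, forall n, (N <= n)%N -> u i n <= c i) ->
  exists N, forall n, (N <= n)%N -> \sum_(i <- l) u i n <= \sum_(i <- l) c i.
Proof.
move=> h; elim: l => [|i l [N IH]]; first by exists 0%N => n _; rewrite !big_nil.
have [M hM] := h i; exists (maxn M N) => n; rewrite geq_max => /andP[Mn Nn].
by rewrite !big_cons lerD ?hM ?IH.
Qed.

(** Dividing by one more than the length keeps the share positive for the empty list too. *)
Lemma sum_share_le (R : realType) (I : Type) (l : seq I) (a : R) : 0 <= a ->
  \sum_(i <- l) a / ((size l).+1)%:R <= a.
Proof.
move=> a0; rewrite big_const_seq count_predT iter_addr_0 -[leLHS]mulr_natr -mulrA ler_piMr//.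
by rewrite ler_pdivrMl// mulr1 ler_nat.
Qed.

Section Properties.
Context {R : realType} {E : completeNormedModType R}.
Hypothesis Esep : separable E.
Local Notation mu := (@completed_lebesgue_measure R).
Local Notation T := (lebesgue_type R).
Local Notation Lint D f := (mu.-integrable (D : set T) (EFin \o (f : R -> R))).
Variables (L : R -> E -> E -> \bar R) (Gamma : R -> E -> set E) (l1 l2 gamma : R -> R).
Hypothesis hP : standing L Gamma l1 l2 gamma.

Let mi r s : measurable (`[r, s]%classic : set T). Proof. exact: lebesgue_itv. Qed.
Variables (xi : E) (x0 : R -> E).
Hypothesis x0_opt : optimal L Gamma xi x0.
Hypothesis Hh : forall S, 0 < S -> exists2 eta, 0 < eta &
  {ae mu, forall t : R, 0 <= t <= S ->
    forall v, `|v| < 1 -> Gamma t (x0 t + eta *: v) (derive1 x0 t)}.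
Implicit Types (t s th : R) (v : E).
Let v0 := derive1 x0.
Let quot := quotL L x0.

Let l1i t : Lint `[0, t] l1.
Proof. exact: (lint_cy_itv t (lexx 0) (st_l1_int hP)). Qed.

(* No measurable selector of the superdifferentials is needed: by Fatou the
   lower quotients of V(t, .) at x0 t along vectors of sum zero have a
   nonnegative sum, so that Hahn-Banach applies to them. *)
Lemma value_subdiff_neq0 t xs : 0 <= t ->
  dini_subdiff (value L Gamma 0) (x0 0) xs ->
  {ae mu, forall s : R, 0 <= s ->
    dini_superdiff (fun x => L s x (v0 s)) (x0 s) !=set0} ->
  dini_subdiff (value L Gamma t) (x0 t) !=set0.
Proof.
move=> t0 hxs hne.
have K0 : 0 <= lipV l1 l2 gamma t by exact: (lipV_ge0 hP).
have Vl y y' : V L Gamma t y <= V L Gamma t y' + lipV l1 l2 gamma t * `|y - y'|.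
  exact: (V_lip Esep hP).
set P := lower_quotient (V L Gamma t) (x0 t).
suff [q hq] : exists q : dual E, forall v, q v <= P v.
  exists q; rewrite (_ : value L Gamma t = EFin \o V L Gamma t).
    exact: (lower_quotient_subdiff K0 Vl).
  by apply/funext => y; exact: (value_fin Esep hP).
apply: (@dual_below_homogeneous R E P (lipV l1 l2 gamma t)).
- by move=> a v a0; exact: (lower_quotientZ Vl).
- by move=> v; exact: (lower_quotient_le Vl).
move=> l l0; apply/ler_addgt0Pr => e0 e00.
(* One third of [e0] for the subgradient inequality, one for the lower quotients and one for Fatou;
   [e] is the share of a single vector. *)
pose e := e0 / 3 / ((size l).+1)%:R.
have e30 : 0 < e0 / 3 by rewrite divr_gt0.
have e_gt0 : 0 < e by rewrite divr_gt0.
have se : \sum_(v <- l) e <= e0 / 3.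
  exact: (sum_share_le _ (ltW e30)).
(* The steps that realize a lower quotient depend on the direction, so [th] is indexed by the vector
   as well as by [n]. *)
have ex (w : E * nat) : exists th : R, [/\ 0 < th, th < w.2.+1%:R^-1 &
    V L Gamma t (x0 t + th *: w.1) - V L Gamma t (x0 t) <= th * (P w.1 + e)].
  by apply: (lower_quotient_freq Vl) => //; rewrite invr_gt0.
have [th hth] := choice ex.
have th0 v n : 0 < th (v, n) by have [] := hth (v, n).
have lq n v : Lint `[0, t] (quot (th (v, n)) v) by exact: (quotL_int Esep hP x0_opt).
pose G n s := \sum_(v <- l) quot (th (v, n)) v s.
have lG n : Lint `[0, t] (G n) by exact: (Rint_sum (mi 0 t) l (lq n)).1.
have IG n : \I_[0, t] (G n) = \sum_(v <- l) \I_[0, t] (quot (th (v, n)) v).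
  exact: (Rint_sum (mi 0 t) l (lq n)).2.
have [v|N1 hN1] := @eventually_sum_le _ _ l
    (fun v n => xs v - \I_[0, t] (quot (th (v, n)) v)) (fun v => P v + (e + e)).
  have [dl dl0 hdl] := subdiff_value_variation Esep hP x0_opt Hh v t0 hxs e_gt0.
  have [N _ hN] := near_infty_natSinv_lt (PosNum dl0).
  exists N => n Nn; have [h1 h2 /= h3] := hth (v, n).
  have h5 := hdl _ h1 (lt_trans h2 (hN n Nn)).
  rewrite lerBlDr; have := le_trans h5 (lerD (lexx _) h3).
  rewrite -mulrDr (ler_pM2l h1) -/quot.
  rewrite lerBlDr => h; apply: le_trans h _.
  by rewrite le_eqVlt; apply/orP; left; apply/eqP; ring.
have l00 : Lint `[0, t] (fun=> 0) by exact: integrable0.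
have [||N2 hN2] := @Rint_limsup_le R 0 t G (fun=> 0)
  (fun s => (\sum_(v <- l) `|v|) * l1 s) (e0 / 3) lG l00 (lintZ _ (mi 0 t) (l1i t)) _ _ e30.
- apply: aeW => s s0 _ n; apply: le_trans (ler_norm_sum _ _ _) _.
  rewrite mulr_suml; apply: ler_sum => v _; rewrite mulrC.
  exact: (quotL_bound hP).
- apply: filterS hne => s hs s0 _ r r0; have [q hq] := hs s0.
  pose r' := r / ((size l).+1)%:R; have r'0 : 0 < r' by rewrite divr_gt0.
  have [|N hN] := @eventually_sum_le _ _ l
      (fun v n => quot (th (v, n)) v s) (fun v => q v + r').
    move=> v; apply: (superdiff_quotL_seq hP v s0 hq r'0 (th := fun n => th (v, n))) => n.
    by have [] := hth (v, n).
  exists N => n Nn; apply: le_trans (hN n Nn) _; rewrite big_split/=.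
  rewrite -linear_sum l0 linear0 lerD2l.
  exact: (sum_share_le _ (ltW r0)).
pose n := maxn N1 N2.
have := hN1 n (leq_maxl _ _); have := hN2 n (leq_maxr _ _).
rewrite IG /Rintegral integral0 add0r sumrB -linear_sum l0 linear0 !big_split/=.
rewrite /Rintegral; move: (\sum_(v <- l) _) (\sum_(v <- l) P v) (\sum_(v <- l) e) se => A B C; lra.
Qed.

Section Selector.
Variables (xs : dual E) (f : R -> dual E).
Hypothesis hxs : dini_subdiff (value L Gamma 0) (x0 0) xs.
Hypothesis mf : weakly_star_measurable f.
Hypothesis hf : {ae mu, forall t : R, 0 <= t ->
  dini_superdiff (fun x => L t x (v0 t)) (x0 t) (f t)}.
Variable Q : R -> dual E.
Hypothesis hQ : forall t, 0 <= t -> forall v, Q t v = \I_[0, t] (fun s => f s v).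

Let p t := Q t - xs.

Let pB a b : p b - p a = Q b - Q a.
Proof. by rewrite /p opprB addrA subrK. Qed.

Lemma adjoint_lac : locally_absolutely_continuous p.
Proof.
move=> tau tau0 e e0.
have [dl dl0 h] := Rint_abs_cont (l1i tau) (st_l1_ge0 hP) e0.
exists dl => // n a b ab dj sd; apply: le_lt_trans (h n a b ab dj sd).
apply: ler_sum => i _; have [a0 [aib _]] := ab i.
by rewrite pB; exact: (adjoint_increment_norm hP mf hf hQ).
Qed.

Lemma value_subdiff_adjoint t : 0 <= t -> dini_subdiff (value L Gamma t) (x0 t) (- p t).
Proof. by move=> t0; rewrite /p opprB; exact: (adjoint_subdiff Esep hP x0_opt Hh hxs mf hf hQ). Qed.

Lemma adjoint_cvg0 : p t @[t --> +oo] --> (0 : dual E).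
Proof.
apply/cvgr0Pnorm_le => e e0; have [T0 T00 h] := lipV_cvg0 hP e0.
exists T0; split; first exact: num_real.
move=> t /ltW Tt; apply: ltW; apply: le_lt_trans (h t Tt).
rewrite -normrN; have t0 := le_trans T00 Tt.
exact: (value_subdiff_norm Esep hP t0 (value_subdiff_adjoint t0)).
Qed.

(** One null set for all directions: [t] is a Lebesgue point of [f] along a dense sequence and of
    [l1], and the bound [l1 s * |u|] on [f s u] handles the remainder [u]. *)
Lemma adjoint_variation : {ae mu, forall t, 0 <= t -> forall v e, 0 < e ->
  exists2 dl, 0 < dl & forall a b, 0 <= a -> a <= t -> t <= b -> b - a < dl ->
    `|Q b v - Q a v - (b - a) * f t v| <= e * (b - a)}.
Proof.
have [ds dsP] := dense_seq Esep.
have aed : {ae mu, forall t, forall n, 0 <= t -> lpoint 0 (fun s => f s (ds n)) t}.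
  by apply: ae_foralln => n; apply: lpoint_ae => m; exact: (selector_int hP mf hf).
have ael : {ae mu, forall t, 0 <= t -> lpoint 0 l1 t} by apply: lpoint_ae => m; exact: l1i.
apply: filterS3 aed ael hf => t hd hl hft t0 v e e0.
have lt0 : 0 <= l1 t by exact: (st_l1_ge0 hP).
(* Per unit length the remainder contributes at most [|u| * c]: 1 for the mean oscillation of [l1],
   and [2 * l1 t] for the functionals at times [s] and [t]. *)
pose c := 1 + 2 * l1 t; have c0 : 0 < c by rewrite /c; lra.
have [n vn] := dsP v (e / 2 / c) (divr_gt0 (divr_gt0 e0 (ltr0n R 2)) c0).
set u := v - ds n in vn.
have [d1 d10 h1] := hd n t0 _ (divr_gt0 e0 (ltr0n R 2)).
have [d2 d20 h2] := hl t0 _ ltr01.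
exists (Num.min d1 d2); first by rewrite lt_min d10.
move=> a b a0 at_ tb; rewrite lt_min => /andP[/(h1 _ _ a0 at_ tb) {}h1 /(h2 _ _ a0 at_ tb) {}h2].
have ab := le_trans at_ tb; have b0 := le_trans t0 tb.
have lf w : Lint `[a, b] (fun s => f s w) by apply: lint_itvS (selector_int hP mf hf b w).
have ll : Lint `[a, b] l1 by apply: lint_itvS (l1i b).
have lc r : Lint `[a, b] (fun=> r) by exact: lint_itv_cst.
have -> : Q b v - Q a v - (b - a) * f t v = \I_[a, b] (fun s => f s v - f t v).
  rewrite (hQ b0) (hQ a0) (selector_increment hP mf hf v a0 ab).
  by rewrite (RintegralB (mi a b) (lf v) (lc (f t v))) Rint_itv_cst// [_ * (b - a)]mulrC.
apply: le_trans (le_normr_Rintegral (mi a b) (lintB (mi a b) (lf v) (lc (f t v)))) _.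
pose A s := `|f s (ds n) - f t (ds n)|; pose B s := `|u| * `|l1 s - l1 t|.
have lA : Lint `[a, b] A := lint_norm (mi a b) (lintB (mi a b) (lf _) (lc _)).
have lB0 : Lint `[a, b] (fun s => `|l1 s - l1 t|) := lint_norm (mi a b) (lintB (mi a b) ll (lc _)).
have lB : Lint `[a, b] B := lintZ `|u| (mi a b) lB0.
have lAB : Lint `[a, b] (fun s => A s + B s) := lintD (mi a b) lA lB.
apply: (@le_trans _ _ (\I_[a, b] (fun s => (A s + B s) + 2 * l1 t * `|u|))).
  apply: le_Rint_itv_ae.
  - exact: (lint_norm (mi a b) (lintB (mi a b) (lf v) (lc _))).
  - exact: (lintD (mi a b) lAB (lc _)).
  apply: filterS hf => s hfs as_ sb; have s0 := le_trans a0 as_.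
  have b1 := superdiff_norm hP u s0 (hfs s0).
  have b2 := superdiff_norm hP u t0 (hft t0).
  have -> : f s v - f t v = (f s (ds n) - f t (ds n)) + (f s u - f t u).
    have lin (q : dual E) : q u = q v - q (ds n) :> R by exact: linearB.
    by rewrite !lin; ring.
  apply: le_trans (ler_normD _ _) _; rewrite -addrA lerD2l.
  apply: le_trans (ler_normB _ _) _; apply: le_trans (lerD b1 b2) _.
  rewrite /B -mulrDl [leRHS](_ : _ = (`|l1 s - l1 t| + 2 * l1 t) * `|u|); last by ring.
  rewrite ler_wpM2r// -lerBlDr (_ : _ - _ = l1 s - l1 t) ?ler_norm//; ring.
rewrite (RintegralD (mi a b) lAB (lc _)) Rint_itv_cst// (RintegralD (mi a b) lA lB).
rewrite (RintegralZl _ (mi a b) lB0).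
have uc : `|u| * c <= e / 2 by rewrite -ler_pdivlMr// ltW.
have ba0 : 0 <= b - a by rewrite subr_ge0.
have h3 := ler_wpM2l (normr_ge0 u) h2.
apply: le_trans (lerD (lerD h1 h3) (lexx _)) _.
have := ler_wpM2r ba0 uc; rewrite /c.
rewrite mul1r; move: `|u| (b - a) (l1 t) => m d l h; have -> : e / 2 * d + m * d + 2 * l * m * d = e / 2 * d + m * (1 + 2 * l) * d by ring.
by rewrite [leRHS](_ : _ = e / 2 * d + e / 2 * d); [rewrite lerD2l|field].
Qed.

(** Time 0 is discarded as a null set, since the derivative is two-sided and [Q] is specified at
    nonnegative times only. *)
Lemma adjoint_derivative : {ae mu, forall t, 0 <= t -> is_weak_star_derivative p t (f t)}.
Proof.
apply: filterS2 (ae_neq 0) adjoint_variation => t tn0 h t0 v.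
have tp : 0 < t by rewrite lt_neqAle t0 andbT eq_sym; exact/eqP.
apply/cvgrPdist_le => e e0; have [dl dl0 hd] := h t0 v e e0.
exists (Num.min dl t); first by rewrite /= lt_min dl0.
move=> r /=; rewrite sub0r normrN lt_min => /andP[rd rt] r0.
have -> : p (t + r) v - p t v = Q (t + r) v - Q t v.
  by rewrite -!dualB pB.
have hq : `|Q (t + r) v - Q t v - r * f t v| <= e * `|r|.
  have [rp|rn|re] := ltgtP 0 r; last by rewrite -re eqxx in r0.
    rewrite (gtr0_norm rp) in rd *.
    by have := hd t (t + r) t0 (lexx t); rewrite lerDl addrAC subrr add0r => /(_ (ltW rp) rd).
  rewrite (ltr0_norm rn) in rd rt *.
  have := hd (t + r) t; rewrite opprD addrA subrr sub0r gerDl => /(_ _ (ltW rn) (lexx t) rd).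
  rewrite -lerBlDr sub0r => /(_ (ltW rt)).
  have alg (A B C : R) : `|A - B - - r * C| = `|B - A - r * C|.
    by rewrite -normrN; congr `|_|; ring.
  by rewrite alg.
have alg (A C : R) : `|C - r^-1 * A| = `|r|^-1 * `|A - r * C|.
  rewrite -normfV -normrM -normrN; congr `|_|.
  by rewrite mulrBr mulrA mulVf// mul1r opprB.
rewrite alg ler_pdivrMl ?normr_gt0//.
by rewrite [leRHS]mulrC; exact: hq.
Qed.

End Selector.
End Properties.

(** * The maximum principle *)

Section Needle.
Context {R : realType} {E : completeNormedModType R}.
Hypothesis Esep : separable E.
Local Notation mu := (@completed_lebesgue_measure R).
Local Notation T := (lebesgue_type R).
Local Notation Lint D f := (mu.-integrable (D : set T) (EFin \o (f : R -> R))).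
Variables (L : R -> E -> E -> \bar R) (Gamma : R -> E -> set E) (l1 l2 gamma : R -> R).
Hypothesis hP : standing L Gamma l1 l2 gamma.

Let mcy t : measurable (`[t, +oo[%classic : set T). Proof. exact: lebesgue_itv. Qed.
Let mi r s : measurable (`[r, s]%classic : set T). Proof. exact: lebesgue_itv. Qed.
Implicit Types (t s th e : R) (x y u v : E).

Lemma lsc_dist t x y e : 0 <= t -> Gamma t x y -> 0 < e ->
  exists2 dl, 0 < dl & forall s, 0 <= s -> `|s - t| < dl -> dist_to (Gamma s x) y < e.
Proof.
move=> t0 Gy e0; have [U oU UE] := st_lsc hP x (ball_open y e).
have : (`[0, +oo[ `&` U) t.
  by rewrite -UE; split=> //; exists y; split=> //; exact: ballxx.
move=> [_ Ut]; have /nbhs_ballP[dl /= dl0 hU] := open_nbhs_nbhs (conj oU Ut).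
exists dl => // s s0 st.
have : (`[0, +oo[ `&` U) s.
  by split; [rewrite /= in_itv/= s0|apply: hU; rewrite /ball/= distrC].
rewrite -UE => -[_ [c [Gc]]]; rewrite -ball_normE /= => yc.
exact: le_lt_trans (dist_le y Gc) yc.
Qed.

Lemma velocity_affine t a y : velocity t (fun s => a + (s - t) *: y) (fun=> y).
Proof.
split; [exact: smeas_cst|by move=> s _; exact: lint_itv_cst|].
move=> s q ts; rewrite Rint_itv_cst// subrr scale0r addr0 addrAC subrr add0r.
by rewrite linearZ/= mulrC.
Qed.

(** Filippov's theorem is applied to the segment from [x + th *: u] with slope [y]. Its defect is at
    most [e + th * (|u| + |y|) * gamma s], of integral at most [th * e * (1 + |u| + |y|)]; the
    tolerance adds [th * e], whence [M]. The factor [expR 1] appears because [gamma] has integral at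
    most [e <= 1]. The velocity is close to [y] in mean only. *)
Lemma needle_trajectory t x y u e : 0 <= t -> Gamma t x y -> 0 < e -> e <= 1 ->
  let M := 2 + `|u| + `|y| in
  exists2 dl, 0 < dl & forall th, 0 < th -> th < dl -> exists (x' v' : R -> E),
  [/\ x' t = x + th *: u, atraj Gamma t x' v',
    forall s, t <= s -> s <= t + th ->
      `|x' s - (x + th *: u + (s - t) *: y)| <= th * e * (expR 1 * M),
    Lint `[t, t + th] (fun s => `|v' s - y|) &
    \I_[t, (t + th)] (fun s => `|v' s - y|) <= th * e * (M + expR 1 * M)].
Proof.
move=> t0 Gy e0 e1 M; set C := expR 1 * M.
have M2 : 0 <= M by rewrite !addr_ge0.
have C0 : 0 <= C by rewrite mulr_ge0 ?expR_ge0.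
have [d1 d10 h1] := lsc_dist t0 Gy e0.
have [d2 d20 h2] := Rint_itv_small (gamma_int_itv hP (t + 1) t0) e0.
exists (Num.min d1 (Num.min d2 1)); first by rewrite !lt_min d10 d20 ltr01.
move=> th th0; rewrite !lt_min => /andP[t1 /andP[t2 t3]].
have the0 : 0 < th * e by rewrite mulr_gt0.
have [p [p0 mp lp p1 _]] := positive_integrable the0.
pose z s := x + th *: u + (s - t) *: y.
have hz : velocity t z (fun=> y) := velocity_affine t (x + th *: u) y.
have zt : z t = x + th *: u by rewrite /z subrr scale0r addr0.
pose rho s := dist_to (Gamma s (z s)) y.
have g0 s : t <= s -> 0 <= gamma s by move=> ts; apply: (st_gamma_ge0 hP); exact: le_trans ts.
have lg s : Lint `[t, s] gamma := gamma_int_itv hP s t0.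
have rho0 s : t <= s -> 0 <= rho s.
  by move=> ts; apply: dist_ge0; apply: (Gamma_neq0 (st_closed hP)); exact: le_trans ts.
have mrho : measurable_fun (`[t, +oo[ : set T) rho.
  exact: (dist_Gamma_meas2 Esep (st_closed hP) (st_lsc hP) (st_gamma_ge0 hP) (st_Glip hP)
    t0 (vel_traj_meas Esep hz) (vel_meas hz)).
have lrho s : Lint `[t, s] rho.
  pose N := `|x + th *: u| + `|s - t| * `|y|.
  apply: (lint_le (mi t s) (measurable_funS (mcy t) (itvcc_itvcy (lexx t)) mrho)
    (lintD (mi t s) (lint_itv_cst t s `|y|) (lintZ (1 + N) (mi t s) (lg s)))).
  move=> r /=; rewrite in_itv/= => /andP[tr rs]; have r0 := le_trans t0 tr.
  have [c Gc] := Gamma_neq0 (st_closed hP) (z r) r0.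
  rewrite (ger0_norm (rho0 r tr)); apply: le_trans (dist_le y Gc) _.
  apply: le_trans (ler_normB _ _) _; rewrite lerD2l mulrC.
  apply: le_trans (Gamma_growth hP r0 Gc) _; rewrite (ler_wpM2l (g0 r tr))// lerD2l.
  apply: le_trans (ler_normD _ _) _; rewrite lerD2l normrZ ler_wpM2r//.
  by rewrite !ger0_norm ?subr_ge0 ?(le_trans tr)// lerD2r.
have lpi s : Lint `[t, s] p by exact: lint_cy_itv lp.
have [x' [v' [x't hx' xz vw]]] := standing_filippov Esep hP (z t) t0 hz
  (fun s ts => p0 s (le_trans t0 ts)) (measurable_funTS mp) (fun s _ => lpi s)
  (fun s _ => lrho s).
have rhole s : t <= s -> s <= t + th -> rho s <= e + th * (`|u| + `|y|) * gamma s.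
  move=> ts sth; have s0 := le_trans t0 ts.
  apply: le_trans (dist_Gamma_lip (st_closed hP) (st_gamma_ge0 hP) (st_Glip hP) (z s) x y s0) _.
  apply: lerD; first by rewrite ltW// h1// ger0_norm ?subr_ge0// (le_lt_trans _ t1)// lerBlDl.
  rewrite [leRHS]mulrC; apply: (ler_wpM2l (g0 s ts)).
  rewrite /z addrAC (addrAC x) subrr add0r; apply: le_trans (ler_normD _ _) _.
  rewrite !normrZ (gtr0_norm th0) mulrDr lerD2l ler_wpM2r// ger0_norm ?subr_ge0//.
  by rewrite lerBlDl.
have Ig s : t <= s -> s <= t + th -> \I_[t, s] gamma <= e.
  move=> ts sth; apply: (le_trans _ (ltW (h2 t s (lexx t) ts _ _))); last first.
  - by rewrite (le_lt_trans _ t2)// lerBlDl.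
  - by rewrite (le_trans sth)// lerD2l ltW.
  apply: le_Rint_itv; [exact: lg|exact: (lint_norm (mi t s) (lg s))|].
  by move=> r _ _; exact: ler_norm.
have Ip s : t <= s -> \I_[t, s] p <= th * e.
  move=> ts; apply: le_trans p1; rewrite (Rint_cy_cat (le_trans t0 ts) lp).
  apply: (@le_trans _ _ (\I_[0, s] p)).
    apply: le_Rint_itvS => //; first exact: lint_cy_itv lp.
    by move=> r r0 _; rewrite ltW// p0.
  by rewrite lerDl; apply: Rint_cy_ge0 => r sr; rewrite ltW// p0// (le_trans t0)// (le_trans ts).
have IJ s : t <= s -> s <= t + th -> \I_[t, s] (fun r => rho r + p r) <= th * e * M.
  move=> ts sth; rewrite (RintegralD (mi t s) (lrho s) (lpi s)).
  have lc : Lint `[t, s] (fun=> e) by exact: lint_itv_cst.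
  have lgz := lintZ (th * (`|u| + `|y|)) (mi t s) (lg s).
  have : \I_[t, s] rho <= \I_[t, s] (fun r => e + th * (`|u| + `|y|) * gamma r).
    apply: (le_Rint_itv (lrho s) (lintD (mi t s) lc lgz)) => r tr rs.
    by apply: rhole => //; exact: le_trans sth.
  rewrite (RintegralD (mi t s) lc lgz) Rint_itv_cst// (RintegralZl _ (mi t s) (lg s)) => h.
  have uy0 : 0 <= th * (`|u| + `|y|) by rewrite mulr_ge0 ?(ltW th0)// addr_ge0.
  have h3 : th * (`|u| + `|y|) * \I_[t, s] gamma <= th * (`|u| + `|y|) * e.
    by apply: ler_wpM2l => //; exact: Ig.
  have h4 : e * (s - t) <= e * th by rewrite ler_pM2l// lerBlDl.
  apply: le_trans (lerD (le_trans h (lerD h4 h3)) (Ip s ts)) _.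
  by rewrite le_eqVlt; apply/orP; left; apply/eqP; rewrite /M; ring.
have IN s : t <= s -> s <= t + th -> expR (\I_[t, s] gamma) * (`|z t - z t| +
      \I_[t, s] (fun r => rho r + p r)) <= th * e * C.
  move=> ts sth; rewrite subrr normr0 add0r [leRHS]mulrCA.
  apply: ler_pM; [exact: expR_ge0| |by rewrite ler_expR (le_trans (Ig s ts sth))|exact: IJ].
  apply: Rint_itv_ge0 => r tr _; rewrite addr_ge0 ?rho0//.
  by rewrite ltW// p0// (le_trans t0).
have tth : t <= t + th by rewrite lerDl ltW.
have lv : Lint `[t, t + th] (fun s => `|v' s - y|).
  have hv := at_vel hx'.
  apply: (lint_le (mi _ _) (smeas_dist (vel_meas_itv hv _ (lexx t)) y)
    (lintD (mi _ _) (vel_int hv tth) (lint_itv_cst _ _ `|y|))).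
  by move=> s _; rewrite normr_id; exact: ler_normB.
exists x', v'; split; [by rewrite x't zt|exact: hx'| |exact: lv|].
- by move=> s ts sth; apply: le_trans (xz s ts) _; exact: IN.
have lrp := lintD (mi t (t + th)) (lrho (t + th)) (lpi (t + th)).
have lgz := lintZ (th * e * C) (mi t (t + th)) (lg (t + th)).
apply: (@le_trans _ _ (\I_[t, (t + th)] (fun s => (rho s + p s) + th * e * C * gamma s))).
  apply: (le_Rint_itv lv (lintD (mi _ _) lrp lgz)) => s ts sth.
  apply: le_trans (vw s ts) _; rewrite lerD2l mulrC; apply: ler_wpM2r; first exact: g0.
  exact: IN.
rewrite (RintegralD (mi _ _) lrp lgz) (RintegralZl _ (mi _ _) (lg _)) mulrDr.
apply: lerD; first exact: IJ.
rewrite ler_piMr// ?mulr_ge0// ?(ltW th0)// ?(ltW e0)//.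
exact: le_trans (Ig _ tth (lexx _)) e1.
Qed.

End Needle.

Lemma ler_small_mul (R : realType) (a b C : R) :
  (forall e, 0 < e -> e <= 1 -> a <= b + e * C) -> a <= b.
Proof.
move=> h; apply/ler_addgt0Pr => d d0.
have C1 : 0 < `|C| + 1 by rewrite ltr_wpDl.
pose e := Num.min 1 (d / (`|C| + 1)).
have e0 : 0 < e by rewrite lt_min ltr01 divr_gt0.
have e1 : e <= 1 by rewrite ge_min lexx.
apply: le_trans (h e e0 e1) _; rewrite lerD2l.
apply: (@le_trans _ _ (e * (`|C| + 1))).
  by rewrite ler_pM2l// (le_trans (ler_norm _))// lerDl.
by rewrite -ler_pdivlMr// ge_min lexx orbT.
Qed.

Lemma increment_le (R : realType) (A I B S W I' : R) :
  A <= S + (B + W) -> I' <= I -> A - (I + B) <= S - I' + W.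
Proof. by lra. Qed.

Section MaximumPrinciple.
Context {R : realType} {E : completeNormedModType R}.
Hypothesis Esep : separable E.
Local Notation mu := (@completed_lebesgue_measure R).
Local Notation T := (lebesgue_type R).
Local Notation Lint D f := (mu.-integrable (D : set T) (EFin \o (f : R -> R))).
Variables (L : R -> E -> E -> \bar R) (Gamma : R -> E -> set E) (l1 l2 gamma : R -> R).
Hypothesis hP : standing L Gamma l1 l2 gamma.

Let mcy t : measurable (`[t, +oo[%classic : set T). Proof. exact: lebesgue_itv. Qed.
Let mi r s : measurable (`[r, s]%classic : set T). Proof. exact: lebesgue_itv. Qed.
Variables (xi : E) (x0 : R -> E).
Hypothesis x0_opt : optimal L Gamma xi x0.
Hypothesis l2_loc : forall t, 0 <= t -> exists M dl,
  0 < dl /\ forall s, 0 <= s -> `|s - t| < dl -> l2 s <= M.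
Implicit Types (t s th e : R) (x y u v : E).
Let v0 := derive1 x0.

Let l1i t : Lint `[0, t] l1.
Proof. exact: (lint_cy_itv t (lexx 0) (st_l1_int hP)). Qed.

Let l2i t : Lint `[0, t] l2.
Proof. exact: (lint_cy_itv t (lexx 0) (st_l2_int hP)). Qed.

Lemma ell_cst_int t x y : Lint `[0, t] (fun s => ell L s x y).
Proof.
apply: (lint_le (mi 0 t) _ (lintD (mi 0 t) (lintZ (1 + `|x|) (mi 0 t) (l1i t))
  (lintZ `|y| (mi 0 t) (l2i t)))).
  apply: (measurable_funS (mcy 0) (itvcc_itvcy (lexx 0))).
  exact: (ell_meas Esep hP (lexx 0) (smeas_cst _ x) (smeas_cst _ y)).
move=> s /=; rewrite in_itv/= => /andP[s0 _].
by rewrite [_ * l1 s]mulrC [_ * l2 s]mulrC; exact: (ell_bound hP).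
Qed.

(** The null set must not depend on [x] and [y], which will be [x0 t] and an arbitrary velocity.
    Lebesgue points along a dense sequence of pairs, of [l1] and of [l2] suffice, each contributing
    [e / 3]. *)
Lemma ell_lpoint : {ae mu, forall t, 0 <= t -> forall x y, lpoint 0 (fun s => ell L s x y) t}.
Proof.
have [ds dsP] := dense_seq Esep.
have aed : {ae mu, forall t, forall m n, 0 <= t ->
    lpoint 0 (fun s => ell L s (ds m) (ds n)) t}.
  apply: ae_foralln => m; apply: ae_foralln => n; apply: lpoint_ae => k.
  exact: ell_cst_int.
have ae1 : {ae mu, forall t, 0 <= t -> lpoint 0 l1 t} by apply: lpoint_ae => m; exact: l1i.
have ae2 : {ae mu, forall t, 0 <= t -> lpoint 0 l2 t} by apply: lpoint_ae => m; exact: l2i.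
apply: filterS3 aed ae1 ae2 => t hd h1 h2 t0 x y e e0.
have e3 : 0 < e / 3 by rewrite divr_gt0.
have c1 : 0 < 1 + 2 * l1 t by have := st_l1_ge0 hP t0; lra.
have c2 : 0 < 1 + 2 * l2 t by have := st_l2_ge0 hP t0; lra.
have [m xm] := dsP x _ (divr_gt0 e3 c1); have [n yn] := dsP y _ (divr_gt0 e3 c2).
have [d0 d00 k0] := hd m n t0 _ e3.
have [d1 d10 k1] := h1 t0 _ ltr01; have [d2 d20 k2] := h2 t0 _ ltr01.
exists (Num.min d0 (Num.min d1 d2)); first by rewrite !lt_min d00 d10 d20.
move=> a b a0 at_ tb; rewrite !lt_min => /andP[/(k0 _ _ a0 at_ tb) {}k0].
move=> /andP[/(k1 _ _ a0 at_ tb) {}k1 /(k2 _ _ a0 at_ tb) {}k2].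
have lN g : Lint `[0, b] g -> Lint `[a, b] (fun s => `|g s - g t|).
  move=> lg; apply: (lint_norm (mi a b)); apply: (lintB (mi a b)); last exact: lint_itv_cst.
  exact: lint_itvS lg.
have lx := lN _ (ell_cst_int b x y); have ld := lN _ (ell_cst_int b (ds m) (ds n)).
have ll1 := lN _ (l1i b); have ll2 := lN _ (l2i b).
set X := `|x - ds m| in xm; set Y := `|y - ds n| in yn.
have lc r : Lint `[a, b] (fun=> r) by exact: lint_itv_cst.
have lz1 := lintZ X (mi a b) (lintD (mi a b) ll1 (lc (2 * l1 t))).
have lz2 := lintZ Y (mi a b) (lintD (mi a b) ll2 (lc (2 * l2 t))).
have lz := lintD (mi a b) lz1 lz2.
apply: (@le_trans _ _ (\I_[a, b] (fun s => `|ell L s (ds m) (ds n) - ell L t (ds m) (ds n)| +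
    (X * (`|l1 s - l1 t| + 2 * l1 t) + Y * (`|l2 s - l2 t| + 2 * l2 t))))).
  apply: (le_Rint_itv lx (lintD (mi a b) ld lz)) => s as_ sb.
  have s0 := le_trans a0 as_.
  have j1 := ell_lip hP x y (ds m) (ds n) s0; have j2 := ell_lip hP x y (ds m) (ds n) t0.
  rewrite -/X -/Y in j1 j2.
  rewrite (_ : ell L s x y - ell L t x y = (ell L s (ds m) (ds n) - ell L t (ds m) (ds n)) +
    ((ell L s x y - ell L s (ds m) (ds n)) - (ell L t x y - ell L t (ds m) (ds n)))); last by ring.
  apply: le_trans (ler_normD _ _) _; rewrite lerD2l.
  apply: le_trans (ler_normB _ _) _; apply: le_trans (lerD j1 j2) _.
  rewrite addrACA -!mulrDl [X * _]mulrC [Y * _]mulrC.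
  have tr (g : R -> R) : g s + g t <= `|g s - g t| + 2 * g t.
    by rewrite -lerBlDr (_ : _ - _ = g s - g t) ?ler_norm//; ring.
  by apply: lerD; rewrite ler_wpM2r// /X /Y.
rewrite (RintegralD (mi a b) ld lz) (RintegralD (mi a b) lz1 lz2).
rewrite (RintegralZl _ (mi a b) (lintD (mi a b) ll1 (lc _))).
rewrite (RintegralZl _ (mi a b) (lintD (mi a b) ll2 (lc _))).
rewrite (RintegralD (mi a b) ll1 (lc _)) (RintegralD (mi a b) ll2 (lc _)).
have ab := le_trans at_ tb; rewrite !Rint_itv_cst//.
have ba0 : 0 <= b - a by rewrite subr_ge0.
have key (Z I l : R) : 0 <= Z -> Z < e / 3 / (1 + 2 * l) -> 0 < 1 + 2 * l ->
    I <= 1 * (b - a) -> Z * (I + 2 * l * (b - a)) <= e / 3 * (b - a).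
  move=> Z0 hZ l0 hI; apply: (@le_trans _ _ (Z * (1 + 2 * l) * (b - a))).
    rewrite (_ : Z * (1 + 2 * l) * (b - a) = Z * (1 * (b - a) + 2 * l * (b - a))); last by ring.
    by rewrite ler_wpM2l// lerD2r.
  by rewrite ler_wpM2r// -ler_pdivlMr// ltW.
apply: le_trans (lerD k0 (lerD (key _ _ _ _ xm c1 k1) (key _ _ _ _ yn c2 k2))) _.
- exact: normr_ge0.
- exact: normr_ge0.
by rewrite le_eqVlt; apply/orP; left; apply/eqP; field.
Qed.

Let value0E t : 0 <= t -> value L Gamma t = EFin \o V L Gamma t.
Proof. by move=> t0; apply/funext => y; exact: (value_fin Esep hP). Qed.

Lemma lpoint_right g t e : lpoint 0 g t -> 0 <= t -> (forall s, Lint `[0, s] g) -> 0 < e ->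
  exists2 dl, 0 < dl & forall th, 0 < th -> th < dl ->
    `|\I_[t, (t + th)] g - th * g t| <= th * e.
Proof.
move=> hg t0 lg e0; have [dl dl0 h] := hg e e0; exists dl => // th th0 thd.
have tth : t <= t + th by rewrite lerDl ltW.
have := h t (t + th) t0 (lexx t) tth; rewrite addrAC subrr add0r => /(_ thd) {}h.
have lgt : Lint `[t, t + th] g by apply: lint_itvS (lg (t + th)).
have lc : Lint `[t, t + th] (fun=> g t) by exact: lint_itv_cst.
rewrite [leRHS]mulrC; apply: le_trans h.
apply: le_trans (le_normr_Rintegral (mi _ _) (lintB (mi _ _) lgt lc)).
rewrite (RintegralB (mi _ _) lgt lc) Rint_itv_cst// [t + th - t]addrAC subrr add0r.
by rewrite [g t * th]mulrC.
Qed.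

Lemma le_lipV t : 0 <= t -> lipV l1 l2 gamma t <= lipV l1 l2 gamma 0.
Proof.
move=> t0; rewrite /lipV (Rint_cy_cat t0 (weight_int hP)) lerDr.
by apply: Rint_itv_ge0 => s s0 _; exact: (weight_ge0 hP).
Qed.

(* The optimal velocity on [t, t + th] is traded for y, starting from a point
   shifted by th (v0 t - y), so that the endpoint changes by o(th) only. *)
Lemma value_subdiff_maximality : {ae mu, forall t, 0 <= t -> forall q y,
  dini_subdiff (value L Gamma t) (x0 t) q -> Gamma t (x0 t) y ->
  q (v0 t - y) <= ell L t (x0 t) y - ell L t (x0 t) (v0 t)}.
Proof.
have hat := optimal_atraj Esep x0_opt (lexx 0); have hv := at_vel hat.
have lc := atraj_cost_int Esep hP (lexx 0) hat.
have lci s : Lint `[0, s] (fun s => ell L s (x0 s) (v0 s)) by exact: lint_cy_itv lc.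
have ae0 : {ae mu, forall t, 0 <= t -> lpoint 0 (fun s => ell L s (x0 s) (v0 s)) t}.
  by apply: lpoint_ae => m; exact: lci.
apply: filterS3 (vel_strong_derivative Esep hv) ell_lpoint ae0 => t hd hl h0 t0 q y hq Gy.
set u := v0 t - y; have uy : u + y = v0 t := subrK y (v0 t).
pose M := 2 + `|u| + `|y|; pose C := expR 1 * M.
pose K := lipV l1 l2 gamma 0; have K0 : 0 <= K by exact: (lipV_ge0 hP).
(* The velocity error of the needle is small in mean only, so its factor [l2 s] has to be bounded
   pointwise near [t]. *)
have [M2 [d2 [d20 hM2]]] := l2_loc t0.
have M20 : 0 <= M2.
  by apply: le_trans (st_l2_ge0 hP t0) (hM2 t t0 _); rewrite subrr normr0.
have C0 : 0 <= C by rewrite mulr_ge0 ?expR_ge0// !addr_ge0.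
(* The constant collects 3 from the subgradient and two Lebesgue points, then the state error, the
   velocity error and the endpoint error. *)
apply: (@ler_small_mul _ _ _ (3 + (C + `|u| + `|y|) + M2 * (M + C) + K * (C + 1))) => e e0 e1.
have [dn dn0 hn] := needle_trajectory Esep hP u t0 Gy e0 e1.
have Vlip x x' : V L Gamma t x <= V L Gamma t x' + lipV l1 l2 gamma t * `|x - x'|.
  exact: (V_lip Esep hP).
have [dq dq0 {}hq] : exists2 dl, 0 < dl & forall th, 0 < th -> th < dl ->
    th * (q u - e) <= V L Gamma t (x0 t + th *: u) - V L Gamma t (x0 t).
  move: hq; rewrite (value0E t0) => /(dini_subdiffP (lipV_ge0 hP t0) Vlip); exact.
have [ds ds0 {}hd] := hd t0 e e0.
have [dl dl0 {}hl] := lpoint_right (hl t0 (x0 t) y) t0 (fun s => ell_cst_int s _ _) e0.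
have [dm dm0 {}h0] := lpoint_right (h0 t0) t0 lci e0.
have [d1 d10 h1] := Rint_itv_small (l1i (t + 1)) e0.
(* The least of all thresholds and 1; the 1 keeps [t + th] within the interval [[t, t + 1]] used for
   [l1]. *)
pose dd := \big[Num.min/1]_(i <- [:: dn; dq; ds; dl; dm; d1; d2]) i.
have [dd0 [thn [thq [ths [thl [thm [th1 [th2 thd]]]]]]]] : 0 < dd /\ dd <= dn /\ dd <= dq /\
    dd <= ds /\ dd <= dl /\ dd <= dm /\ dd <= d1 /\ dd <= d2 /\ dd <= 1.
  rewrite /dd !big_cons big_nil !lt_min !ge_min !lexx !orbT.
  by rewrite dn0 dq0 ds0 dl0 dm0 d10 d20 ltr01.
have [th [th0 thdd]] : exists th, 0 < th /\ th < dd.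
  by exists (dd / 2); rewrite divr_gt0// ltr_pdivrMr// ltr_pMr// ltr1n.
have tth : t <= t + th by rewrite lerDl ltW.
have r0 := le_trans t0 tth.
have [x' [v' [x't hx' xz lv' Iv']]] := hn th th0 (lt_le_trans thdd thn).
have {}hq := hq th th0 (lt_le_trans thdd thq).
have {}hl := hl th th0 (lt_le_trans thdd thl).
have {}h0 := h0 th th0 (lt_le_trans thdd thm).
have {}hd : `|x0 (t + th) - x0 t - th *: v0 t| <= th * e.
  have := hd t (t + th) t0 (lexx t) tth; rewrite [t + th - t]addrAC subrr add0r mulrC.
  by apply; exact: lt_le_trans ths.
have {}h1 : \I_[t, (t + th)] l1 <= e.
  apply: (le_trans _ (ltW (h1 t (t + th) t0 tth _ _))); last first.
  - by rewrite [t + th - t]addrAC subrr add0r (lt_le_trans thdd th1).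
  - by rewrite lerD2l (le_trans (ltW thdd)).
  apply: le_Rint_itv; [by apply: lint_itvS (l1i (t + th))| |].
    by apply: (lint_norm (mi _ _)); apply: lint_itvS (l1i (t + th)).
  by move=> r _ _; exact: ler_norm.
have aeG : {ae mu, forall s, t <= s -> s <= t + th -> Gamma s (x' s) (v' s)}.
  by apply: filterS (at_incl hx') => s h ts _; exact: h.
have dp := dynamic_programming Esep hP t0 tth (at_vel hx') aeG.
have op : V L Gamma t (x0 t) = \I_[t, (t + th)] (fun s => ell L s (x0 s) (v0 s)) +
    V L Gamma (t + th) (x0 (t + th)).
  have o1 := optimal_V Esep hP x0_opt t0; have := optimal_V Esep hP x0_opt r0.
  by rewrite (Rint_cat t0 tth (lci _)) o1 -addrA => /addrI.
(* As [u + y = v0 t], the needle ends within [th * e * C] of [x0 t + th *: v0 t], and [x0 (t + th)]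
   is within [th * e] of the same point. *)
have vl : V L Gamma (t + th) (x' (t + th)) <= V L Gamma (t + th) (x0 (t + th)) +
    K * (th * e * (C + 1)).
  apply: le_trans (V_lip Esep hP (x' (t + th)) (x0 (t + th)) r0) _; rewrite lerD2l.
  apply: ler_pM; [exact: (lipV_ge0 hP)|exact: normr_ge0|exact: le_lipV|].
  have := xz (t + th) tth (lexx _); rewrite [t + th - t]addrAC subrr add0r -addrA -scalerDr uy.
  have alg (a b c d : E) : a - b = (a - (c + d)) - (b - c - d).
    by rewrite -[b - c - d]addrA -opprD opprB addrA subrK.
  move=> xz'; rewrite (alg _ _ (x0 t) (th *: v0 t)).
  apply: le_trans (ler_normB _ _) _; rewrite mulrDr mulr1; exact: lerD.
have lx' : Lint `[t, t + th] (fun s => ell L s (x' s) (v' s)).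
  exact: (lint_cy_itv _ (lexx t) (atraj_cost_int Esep hP t0 hx')).
have ly : Lint `[t, t + th] (fun s => ell L s (x0 t) y) by apply: lint_itvS (ell_cst_int (t + th) _ _).
have ll1 : Lint `[t, t + th] l1 by apply: lint_itvS (l1i (t + th)).
have lz1 := lintZ (th * (C + `|u| + `|y|)) (mi _ _) ll1; have lz2 := lintZ M2 (mi _ _) lv'.
have lz := lintD (mi _ _) lz1 lz2.
have Ix' : \I_[t, (t + th)] (fun s => ell L s (x' s) (v' s)) <=
    \I_[t, (t + th)] (fun s => ell L s (x0 t) y) +
    (th * (C + `|u| + `|y|) * e + M2 * (th * e * (M + C))).
  apply: (@le_trans _ _ (\I_[t, (t + th)] (fun s => ell L s (x0 t) y +
      (th * (C + `|u| + `|y|) * l1 s + M2 * `|v' s - y|)))).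
    apply: (le_Rint_itv lx' (lintD (mi _ _) ly lz)) => s ts sth; have s0 := le_trans t0 ts.
    rewrite -lerBlDl; apply: le_trans (ler_norm _) _.
    apply: le_trans (ell_lip hP _ _ _ _ s0) _; apply: lerD.
      rewrite mulrC; apply: (ler_wpM2r (st_l1_ge0 hP s0)).
      have := xz s ts sth; rewrite -/u -/M -/C => xzs.
      have alg (a b c : E) : a - b = (a - (b + c)) + c.
        by rewrite opprD addrA subrK.
      rewrite -addrA in xzs; rewrite (alg _ _ (th *: u + (s - t) *: y)).
      apply: le_trans (ler_normD _ _) _; rewrite -addrA mulrDr; apply: lerD.
        apply: le_trans xzs _; rewrite -mulrA ler_pM2l//.
        by rewrite -[leRHS]mul1r ler_wpM2r.
      apply: le_trans (ler_normD _ _) _; rewrite !normrZ (gtr0_norm th0) mulrDr lerD2l.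
      by rewrite ler_wpM2r// ger0_norm ?subr_ge0// lerBlDl.
    apply: ler_wpM2r => //; apply: hM2 => //.
    rewrite ger0_norm ?subr_ge0//; apply: le_lt_trans (lt_le_trans thdd th2).
    by rewrite lerBlDl.
  rewrite (RintegralD (mi _ _) ly lz) lerD2l (RintegralD (mi _ _) lz1 lz2).
  rewrite (RintegralZl _ (mi _ _) ll1) (RintegralZl _ (mi _ _) lv').
  by apply: lerD; rewrite ler_wpM2l// mulr_ge0 ?(ltW th0)// !addr_ge0.
have hl' : \I_[t, (t + th)] (fun s => ell L s (x0 t) y) <= th * ell L t (x0 t) y + th * e.
  by rewrite -lerBlDl; apply: le_trans (ler_norm _) hl.
have h0' : th * ell L t (x0 t) (v0 t) - th * e <= \I_[t, (t + th)] (fun s => ell L s (x0 s) (v0 s)).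
  by rewrite lerBlDl -lerBlDr; apply: le_trans (ler_norm _) _; rewrite distrC.
rewrite x't in dp.
rewrite -(ler_pM2l th0).
have fin : th * (q u - e) <= (th * ell L t (x0 t) y + th * e +
    (th * (C + `|u| + `|y|) * e + M2 * (th * e * (M + C)))) -
    (th * ell L t (x0 t) (v0 t) - th * e) + K * (th * e * (C + 1)).
  apply: le_trans hq _; rewrite op.
  have := le_trans dp (lerD (le_trans Ix' (lerD hl' (lexx _))) vl).
  by move=> /increment_le; apply.
move: fin; rewrite -(lerD2r (th * e)) -mulrDr subrK => fin; apply: le_trans fin _.
by rewrite le_eqVlt; apply/orP; left; apply/eqP; ring.
Qed.

End MaximumPrinciple.

(* Exact penalization turns y0 into a global minimizer of phi - q + k' d_C;
   Hahn-Banach then splits the sum of the two Clarke derivatives. *)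
Lemma clarke_multiplier (R : realType) (E : normedModType R) (phi : E -> R) (k : R)
    (C : set E) (y0 : E) (q : dual E) :
  0 <= k -> (forall x y, phi x <= phi y + k * `|x - y|) -> C y0 ->
  (forall y, C y -> q (y - y0) <= phi y - phi y0) ->
  exists2 q1, clarke_subdiff (EFin \o phi) y0 q1 &
  exists2 r, clarke_normal C y0 r & q = q1 + r.
Proof.
move=> k0 phi_lip Cy0 qmin; have C0 : C !=set0 by exists y0.
have d_lip x y : dist_to C x <= dist_to C y + 1 * `|x - y| by rewrite mul1r; exact: dist_lip.
(* A Lipschitz constant of [phi - q], which makes the penalty exact. *)
pose k' := k + `|q|; have k'0 : 0 <= k' by rewrite addr_ge0.
have qB a b : q (a - b) = q a - q b :> R by exact: linearB.
have qD a b : q (a + b) = q a + q b :> R by exact: linearD.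
have qZ a v : q (a *: v) = a * q v :> R by exact: linearZ.
have pen y : phi y0 - phi y + q (y - y0) <= k' * dist_to C y.
  apply/ler_addgt0Pr => e e0; have k1 : 0 < k' + 1 by rewrite ltr_wpDl.
  have [|c Cc yc] := @dist_ltP _ _ C y (dist_to C y + e / (k' + 1)) C0.
    by rewrite ltrDl divr_gt0.
  have h1 := qmin c Cc; have h2 := phi_lip c y.
  have h3 : q (y - c) <= `|q| * `|y - c| := le_trans (ler_norm _) (dual_le_norm q _).
  have h4 : k' * `|y - c| <= k' * dist_to C y + e.
    apply: le_trans (ler_wpM2l k'0 (ltW yc)) _; rewrite mulrDr lerD2l mulrCA.
    by rewrite ler_piMr ?(ltW e0)// ler_pdivrMr// mul1r lerDl.
  apply: le_trans h4; rewrite /k' mulrDl.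
  rewrite distrC in h2; move: h1 h2 h3; rewrite !qB.
  move: (q y) (q y0) (q c) => a b c'; lra.
have [sa sh] := clarke_real_sublinear phi_lip y0.
have [da dh] := clarke_real_sublinear d_lip y0.
set A := clarke_real phi y0 in sa sh; set B := clarke_real _ y0 in da dh.
have [||||q0 hq0] := @sublinear_sandwich R E (fun v => A v - q v) (fun v => k' * B v) k'.
- split=> [u v|a v a0].
    by have := sa u v; rewrite qD; move: (q u) (q v) => a b; lra.
  by rewrite sh// qZ mulrBr.
- split=> [u v|a v a0]; first by rewrite -mulrDr ler_wpM2l.
  by rewrite dh// mulrCA.
(* By [pen], [y0] minimizes the penalized function, so a small step along [v] shows that the sum of
   the Clarke derivatives is nonnegative. *)
- move=> v; apply/ler_addgt0Pr => e e0; have k1 : 0 < 1 + k' by rewrite ltr_pwDl.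
  have e1 : 0 < e / (1 + k') by rewrite divr_gt0.
  have [d1 d10 h1] := clarke_ub phi_lip y0 v e1.
  have [d2 d20 h2] := clarke_ub d_lip y0 v e1.
  pose d := Num.min d1 d2; have d0 : 0 < d by rewrite lt_min d10.
  have [th [th0 thd]] : exists th, 0 < th /\ th < d.
    by exists (d / 2); rewrite divr_gt0// ltr_pdivrMr// ltr_pMr// ltr1n.
  move: thd; rewrite lt_min => /andP[td1 td2].
  have := h1 y0 th; rewrite subrr normr0 => /(_ d10 th0 td1) {}h1.
  have := h2 y0 th; rewrite subrr normr0 (dist0 Cy0) subr0 => /(_ d20 th0 td2) {}h2.
  have := pen (y0 + th *: v); rewrite qB qD qZ => h3.
  have h4 := ler_wpM2l k'0 h2.
  have eE : e = e / (1 + k') * (1 + k') by rewrite mulfVK// gt_eqF.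
  rewrite eE; rewrite -(pmulr_rge0 _ th0).
  rewrite (_ : th * _ = th * (A v + e / (1 + k')) + k' * (th * (B v + e / (1 + k'))) - th * q v).
    have alg (f f0 X a b D Y : R) : f - f0 <= X -> f0 - f + (a + b - a) <= D -> D <= Y ->
      0 <= X + Y - b by lra.
    exact: alg h1 h3 h4.
  by move: (q v) (e / _) => a b; ring.
- move=> v; rewrite /k' mulrDl; apply: lerD; first exact: (clarke_real_le phi_lip).
  by apply: le_trans (ler_norm _) _; rewrite normrN; exact: dual_le_norm.
exists (q0 + q).
  move=> v; rewrite (clarke_derivative_fin phi_lip) lee_fin dualD.
  by have [h _] := hq0 v; rewrite -lerBrDr.
exists (- q0); last by rewrite addrAC subrr add0r.
(* On tangent vectors [B] vanishes, and the second half of the sandwich then says that [- q0] is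
   normal. *)
move=> v; rewrite /clarke_tangent/= (clarke_derivative_fin d_lip) => -[Bv].
have [_ h] := hq0 v; rewrite /B Bv mulr0 in h; exact: h.
Qed.

Section Conclusion.
Context {R : realType} {E : completeNormedModType R}.
Variables (L : R -> E -> E -> \bar R) (Gamma : R -> E -> set E) (l1 l2 gamma : R -> R).
Hypothesis hP : standing L Gamma l1 l2 gamma.

Lemma hamiltonian_attained t x v (p : dual E) : 0 <= t -> Gamma t x v ->
  (forall y, Gamma t x y -> p (y - v) <= ell L t x y - ell L t x v) ->
  hamiltonian L Gamma t x p = ((p v)%:E - L t x v)%E.
Proof.
move=> t0 Gv h; apply/le_anti/andP; split; last by apply: ereal_sup_ubound; exists v.
apply: ge_ereal_sup => _ [y Gy <-]; rewrite !(L_fin hP)// -!EFinB lee_fin.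
have := h y Gy; rewrite (_ : p (y - v) = p y - p v :> R); last exact: linearB.
by move: (p y) (p v) => a b; lra.
Qed.

End Conclusion.


Theorem theorem4p1 (R : realType) (E : completeNormedModType R)
    (Esep : separable E)
    (L : R -> E -> E -> \bar R) (Gamma : R -> E -> set E)
    (L_codomain : forall t x y, 0 <= t -> L t x y != -oo%E)
    (l1 l2 gamma : R -> R)
    (* (a) *)
    (Ha : forall t xi, 0 <= t -> admissible Gamma t xi !=set0)
    (* (b) *)
    (Hb : forall x y : E,
      measurable_fun (`[0, +oo[%classic : set (lebesgue_type R))
        (fun t => L t x y))
    (* (c) *)
    (l1_ge0 : forall t, 0 <= t -> 0 <= l1 t)
    (l1_int : completed_lebesgue_measure.-integrable `[0, +oo[
                (fun t => (l1 t)%:E))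
    (l2_ge0 : forall t, 0 <= t -> 0 <= l2 t)
    (l2_int : completed_lebesgue_measure.-integrable `[0, +oo[
                (fun t => (l2 t)%:E))
    (l2_locbd : [locally [bounded l2 t | t in `[0, +oo[%classic]])
    (Hc0 : forall t, 0 <= t -> (`|L t 0%R 0%R| <= (l1 t)%:E)%E)
    (Hc : forall t x y x' y', 0 <= t ->
      (`|L t x y - L t x' y'| <=
        (l1 t * `|x - x'| + l2 t * `|y - y'|)%R%:E)%E)
    (* (d) *)
    (Hd : forall t x, 0 <= t -> Gamma t x !=set0 /\ closed (Gamma t x))
    (* (e) *)
    (He : forall x, lsc_multifunction (fun t => Gamma t x))
    (* (f) *)
    (gamma_ge0 : forall t, 0 <= t -> 0 <= gamma t)
    (gamma_int : forall T, 0 <= T ->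
      completed_lebesgue_measure.-integrable `[0, T]
        (fun t => (gamma t)%:E))
    (Hf0 : forall t, 0 <= t ->
      Gamma t 0 `<=` [set gamma t *: v | v in [set v | `|v| < 1]])
    (Hf : forall t x x', 0 <= t ->
      Gamma t x `<=` [set y + (gamma t * `|x - x'|) *: v |
                       y in Gamma t x' & v in [set v | `|v| < 1]])
    (* (g) *)
    (Hg : (\int[completed_lebesgue_measure]_(s in `[0%R, +oo[)
             (let G := (\int[completed_lebesgue_measure]_(tau in `[0%R, s])
                         gamma tau)%R in
              (expR G * (1 + G) * (l1 s + l2 s * gamma s))%:E) < +oo)%E)
    (xi : E) (x0 : R -> E)
    (x0_optimal : optimal L Gamma xi x0)
    (* (h) *)
    (Hh : forall T, 0 < T -> exists2 eta, 0 < eta &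
      {ae completed_lebesgue_measure, forall t : R, 0 <= t <= T ->
        forall v, `|v| < 1 -> Gamma t (x0 t + eta *: v) (derive1 x0 t)})
    (V_subdiff_neq0 : dini_subdiff (value L Gamma 0) (x0 0) !=set0)
    (L_superdiff_neq0 : {ae completed_lebesgue_measure, forall t : R, 0 <= t ->
      dini_superdiff (fun x => L t x (derive1 x0 t)) (x0 t) !=set0}) :
  (forall (xs : dual E) (f : R -> dual E),
    dini_subdiff (value L Gamma 0) (x0 0) xs ->
    weakly_star_measurable f ->
    {ae completed_lebesgue_measure, forall t : R, 0 <= t ->
      dini_superdiff (fun x => L t x (derive1 x0 t)) (x0 t) (f t)} ->
    exists p : R -> dual E,
      (forall t, 0 <= t ->
         exists2 q, is_gelfand_integral `[0, t] f q & p t = q - xs) /\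
      locally_absolutely_continuous p /\
      (* (i) *)
      (forall t, 0 <= t -> dini_subdiff (value L Gamma t) (x0 t) (- p t)) /\
      (* (ii) *)
      {ae completed_lebesgue_measure, forall t : R, 0 <= t ->
        exists2 q, clarke_subdiff (L t (x0 t)) (derive1 x0 t) q &
        exists2 r, clarke_normal (Gamma t (x0 t)) (derive1 x0 t) r &
        p t = q + r} /\
      (* (iii) *)
      {ae completed_lebesgue_measure, forall t : R, 0 <= t ->
        exists2 q, is_weak_star_derivative p t q &
        dini_superdiff (fun x => L t x (derive1 x0 t)) (x0 t) q} /\
      (* (iv) *)
      {ae completed_lebesgue_measure, forall t : R, 0 <= t ->
        hamiltonian L Gamma t (x0 t) (p t) =
          ((p t (derive1 x0 t))%:E - L t (x0 t) (derive1 x0 t))%E} /\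
      (* (v) *)
      p t @[t --> +oo] --> (0 : dual E)) /\
  (forall t, 0 <= t -> dini_subdiff (value L Gamma t) (x0 t) !=set0).
Proof.
have hP : standing L Gamma l1 l2 gamma by constructor.
have l2_loc t : 0 <= t -> exists M dl, 0 < dl /\
    forall s, 0 <= s -> `|s - t| < dl -> l2 s <= M.
  move=> t0; have At : `[0, +oo[%classic t by rewrite /= in_itv/= t0.
  have /pinfty_ex_gt0[M _ /nbhs_ballP[dl /= dl0 h]] := l2_locbd t At.
  exists M, dl; split=> // s s0 st; apply: le_trans (ler_norm _) _; apply: h.
    by rewrite /ball/= distrC.
  by rewrite in_itv/= s0.
(* Nonemptiness at every time does not pass through [p], no measurable selector being given. *)
split; last first.
  by move=> t t0; have [xs hxs] := V_subdiff_neq0;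
    exact: (value_subdiff_neq0 Esep hP x0_optimal Hh t0 hxs L_superdiff_neq0).
move=> xs f hxs mf hf; have [Q hQ] := gelfand_exists hP mf hf.
have hi t (t0 : 0 <= t) := value_subdiff_adjoint Esep hP x0_optimal Hh hxs mf hf hQ t0.
(* Maximality is known for subgradients, and [- p t] is one by (i); its sign and the reversed
   difference cancel. *)
have hmax : {ae completed_lebesgue_measure, forall t, 0 <= t ->
    forall y, Gamma t (x0 t) y -> (Q t - xs) (y - derive1 x0 t) <=
      ell L t (x0 t) y - ell L t (x0 t) (derive1 x0 t)}.
  apply: filterS (value_subdiff_maximality Esep hP x0_optimal l2_loc) => t h t0 y Gy.
  have := h t0 _ y (hi t t0) Gy.
  by rewrite dualN -[derive1 x0 t - y]opprB linearN opprK.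
have hincl := at_incl (optimal_atraj Esep x0_optimal (lexx 0)).
exists (fun t => Q t - xs); split.
  move=> t t0; exists (Q t) => // v; split; first exact: (selector_int hP mf hf).
  exact: hQ.
split; first exact: (adjoint_lac hP _ mf hf hQ).
split; first exact: hi.
split.
  (* For fixed [t] the velocity minimizes [L - p] over [Gamma t (x0 t)], and [L] is Lipschitz in the
     velocity with constant [l2 t], as penalization requires. *)
  apply: filterS2 hmax hincl => t h Gt t0.
  have [|q1 h1 [r hr E1]] := clarke_multiplier (st_l2_ge0 hP t0) _ (Gt t0) (h t0).
    move=> y y'; rewrite -lerBlDl; apply: le_trans (ler_norm _) _.
    by have := ell_lip hP (x0 t) y (x0 t) y' t0; rewrite subrr normr0 mulr0 add0r.
  exists q1; last by exists r.
  rewrite (_ : L t (x0 t) = EFin \o ell L t (x0 t)); first exact: h1.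
  by apply/funext => y; exact: (L_fin hP).
split.
  apply: filterS2 (adjoint_derivative Esep hP xs mf hf hQ) hf => t h1 h2 t0.
  by exists (f t); [exact: h1|exact: h2].
split; last exact: (adjoint_cvg0 Esep hP x0_optimal Hh hxs mf hf hQ).
apply: filterS2 hmax hincl => t h Gt t0.
exact: (hamiltonian_attained hP t0 (Gt t0) (h t0)).
Qed.
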